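(* Let $a\in\mathbb{R}$, $a\neq0$. Let $U\subset\mathbb{R}^2$ be open with coordinates $(x,y)$, let $h,H:U\to\mathbb{R}$ be positive smooth functions such that $\Delta\ln H=-2a^2h^2+4a^2H^2$ on $U$, where $\Delta=\partial_x^2+\partial_y^2$. Let $M=U\times N$ with $N=\{(z,t)\in\mathbb{R}^2: z<0\}$, and let $g=\theta_1^2+\theta_2^2+\theta_3^2+\theta_4^2$, i.e. $g(X,Y)=\sum_{i=1}^4\theta_i(X)\theta_i(Y)$, where $$\theta_1=\cosh(az)\,h\,dx,\qquad \theta_2=\cosh(az)\,h\,dy,$$ $$\theta_3=\sinh(2az)\,dt-\big(\cos(2at)\cosh(2az)H+\sinh(2az)\,l_2\big)dx-\big(-\sin(2at)\cosh(2az)H+\sinh(2az)\,n_2\big)dy,$$ $$\theta_4=dz-\sin(2at)\,H\,dx-\cos(2at)\,H\,dy,$$ with $l_2=-\frac1{2a}(\ln H)_y$, $n_2=\frac1{2a}(\ln H)_x$ (here $h,H,l_2,n_2$ are evaluated at $(x,y)$). Let $\{E_1,E_2,E_3,E_4\}$ be the $g$-orthonormal frame dual to $\{\theta_1,\theta_2,\theta_3,\theta_4\}$, let $\mathcal{D}=\mathrm{span}\{E_3,E_4\}$ and $\mathcal{D}^\perp=\mathrm{span}\{E_1,E_2\}$, let $\bar J$ be the Kähler structure with Kähler form $\bar\Omega=\theta_1\wedge\theta_2+\theta_4\wedge\theta_3$ and $J$ the Hermitian structure with Kähler form $\Omega=\theta_1\wedge\theta_2+\theta_3\wedge\theta_4$,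 with Lee form $\theta=-\alpha\theta_4$, $\alpha=-2a\tanh(az)$. Then: (i) $\Delta\ln H=-2a^2h^2+4a^2H^2$ on $U$. (ii) $\Gamma^2_{11}=-\dfrac{a\sinh(az)\cos(2at)H}{\cosh^2(az)\,h}-\dfrac{h_y}{\cosh(az)\,h^2}$ and $\Gamma^1_{22}=-\dfrac{a\sinh(az)\sin(2at)H}{\cosh^2(az)\,h}-\dfrac{h_x}{\cosh(az)\,h^2}$. (iii) In the frame $\{E_1,E_2,E_3,E_4\}$ the Ricci tensor of $(M,g)$ is $Ric=\mathrm{diag}(\lambda,\lambda,-6a^2,-6a^2)$ with $$\lambda=\frac{4a^2h^2-2a^2H^2-\Delta\ln h}{h^2\cosh^2(az)}-6a^2.$$ (iv) The scalar curvature of $(M,g)$ is $\tau=\dfrac{8a^2h^2-4a^2H^2-2\Delta\ln h}{h^2\cosh^2(az)}-24a^2$. (v) The conformal scalar curvature is $\kappa=\dfrac{8a^2h^2-4a^2H^2-2\Delta\ln h}{h^2\cosh^2(az)}$. (vi) In the frame $\{\Omega,\phi,\psi\}$, where $\{\phi,\psi\}$ is any (local) orthonormal basis of $LM$, the Weyl tensor $W^-$ is $$W^-=\mathrm{diag}\Big(\tfrac{4a^2h^2-2a^2H^2-\Delta\ln h}{3h^2\cosh^2(az)},\ \tfrac{-4a^2h^2+2a^2H^2+\Delta\ln h}{6h^2\cosh^2(az)},\ \tfrac{-4a^2h^2+2a^2H^2+\Delta\ln h}{6h^2\cosh^2(az)}\Big).$$ (vii) The sectional curvature of $(M,g)$ on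 $\mathcal{D}^\perp$ is $K(E_1,E_2)=-\dfrac{2a^2H^2+\Delta\ln h}{\cosh^2(az)\,h^2}-4a^2\tanh^2(az)$ and on $\mathcal{D}$ is $K(E_3,E_4)=-4a^2$. (viii) $(M,g)$ is a space form if and only if $\Delta\ln h=4a^2h^2-2a^2H^2$ on $U$; in that case it is locally isometric to the complex ball $B^2$ with its standard metric of constant holomorphic sectional curvature $-4a^2$.
   Context: It is known from earlier work that, for this metric, $\bar J$ is a Kähler structure and $J$ is an integrable orthogonal complex structure (inducing the opposite orientation) which is not locally conformally Kähler. Conventions. The Kähler form of an almost Hermitian structure $J$ is $\Omega(X,Y)=g(JX,Y)$; thus here $\bar JE_1=E_2$, $\bar JE_3=-E_4$, $JE_1=E_2$, $JE_3=E_4$. $M$ is oriented so that $\bar\Omega$ is self-dual; then $\Omega$ is anti-self-dual. $LM$ denotes the rank-2 bundle of anti-self-dual 2-forms orthogonal to $\Omega$. The Lee form $\theta$ of $(M,g,J)$ is defined by $d\Omega=2\theta\wedge\Omega$. $\Gamma^k_{ij}=g(\nabla_{E_i}E_j,E_k)$, with $\nabla$ the Levi-Civita connection. The curvature tensor is $R(X,Y)Z=([\nabla_X,\nabla_Y]-\nabla_{[X,Y]})Z$, $R(X,Y,Z,W)=g(R(X,Y)Z,W)$, and $K(X,Y)=R(X,Y,Y,X)$ for orthonormal $X,Y$. $Ric(X,Y)=\sum_i g(R(E_i,X)Y,E_i)$, and $\tau=\mathrm{tr}_g Ric$. The conformal scalar curvature (of $(M,g,J)$) is $\kappa=\tau-6(|\theta|^2+\delta\theta)$,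 where $\delta\theta=-\sum_i(\nabla_{E_i}\theta)(E_i)$. $W^-$ is the anti-self-dual part of the Weyl tensor, viewed as a symmetric endomorphism of the bundle of anti-self-dual 2-forms, normalized so that the curvature operator of a space of constant sectional curvature $1$ is the identity on 2-forms. ''Space form'' means that the Kähler surface $(M,g,\bar J)$ has constant holomorphic sectional curvature $R(X,\bar JX,\bar JX,X)$, $|X|=1$. $B^2$ is the unit ball in $\mathbb{C}^2$ with the complex hyperbolic (Bergman) metric, scaled to the indicated holomorphic sectional curvature. *)

(* Defs.v *)
From mathcomp Require Import all_boot all_order all_algebra.
From mathcomp Require Import all_classical all_reals all_analysis.

Set Implicit Arguments.
Unset Strict Implicit.
Unset Printing Implicit Defensive.

Import Order.TTheory GRing.Theory Num.Theory numFieldNormedType.Exports.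

Local Open Scope classical_set_scope.
Local Open Scope ring_scope.

Definition cosh (R : realType) (x : R) : R := (expR x + expR (- x)) / 2.
Definition sinh (R : realType) (x : R) : R := (expR x - expR (- x)) / 2.
Definition tanh (R : realType) (x : R) : R := sinh x / cosh x.

(* Every manifold below is an open subset of some R^n, so that its tangent
   spaces are all 'rV[R]_n.  Tensor fields are total functions on 'rV[R]_n, of
   which only the values on the open set matter. *)

Definition vfield (R : realType) (n : nat) := 'rV[R]_n -> 'rV[R]_n.
Definition form1 (R : realType) (n : nat) := 'rV[R]_n -> R.
Definition form2 (R : realType) (n : nat) := 'rV[R]_n -> 'rV[R]_n -> R.
Definition form4 (R : realType) (n : nat) :=
  'rV[R]_n -> 'rV[R]_n -> 'rV[R]_n -> 'rV[R]_n -> R.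
Definition field1 (R : realType) (n : nat) := 'rV[R]_n -> form1 R n.
Definition field2 (R : realType) (n : nat) := 'rV[R]_n -> form2 R n.
Definition endfield (R : realType) (n : nat) :=
  'rV[R]_n -> 'rV[R]_n -> 'rV[R]_n.

Definition bvec (R : realType) (n : nat) (i : 'I_n) : 'rV[R]_n := delta_mx 0 i.
Arguments bvec {R n} i.

Definition pd (R : realType) (n : nat) (i : 'I_n) (f : 'rV[R]_n -> R) :
  'rV[R]_n -> R := fun p => 'D_(bvec i) f p.

Fixpoint pds (R : realType) (n : nat) (s : seq 'I_n) (f : 'rV[R]_n -> R) :
    'rV[R]_n -> R :=
  if s is i :: s' then pd i (pds s' f) else f.

(* C^oo on the open set U: f is differentiable on U, and so are all its
   iterated partial derivatives (hence they are continuous). *)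
Definition smooth_on (R : realType) (n : nat) (U : set 'rV[R]_n)
    (f : 'rV[R]_n -> R) : Prop :=
  forall (s : seq 'I_n) (p : 'rV[R]_n), U p -> differentiable (pds s f) p.

Definition smooth_map (R : realType) (n m : nat) (U : set 'rV[R]_n)
    (F : 'rV[R]_n -> 'rV[R]_m) : Prop :=
  forall k : 'I_m, smooth_on U (fun p => F p 0 k).

(** Riemannian geometry in coordinates *)

Definition gram (R : realType) (n : nat) (g : field2 R n) (p : 'rV[R]_n) :
  'M[R]_n := \matrix_(i, j) g p (bvec i) (bvec j).

(* The upper index of the Christoffel symbol comes first. *)
Definition christoffel (R : realType) (n : nat) (g : field2 R n)
    (p : 'rV[R]_n) (k i j : 'I_n) : R :=
  2^-1 * \sum_(l < n) invmx (gram g p) k l *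
    (pd i (fun q => g q (bvec j) (bvec l)) p
     + pd j (fun q => g q (bvec i) (bvec l)) p
     - pd l (fun q => g q (bvec i) (bvec j)) p).

(* Levi-Civita connection of g *)
Definition nabla (R : realType) (n : nat) (g : field2 R n) (X Y : vfield R n) :
  vfield R n := fun p =>
  \row_k ('D_(X p) (fun q => Y q 0 k) p
          + \sum_(i < n) \sum_(j < n) christoffel g p k i j * X p 0 i * Y p 0 j).

Definition lie_bracket (R : realType) (n : nat) (X Y : vfield R n) :
  vfield R n := fun p =>
  \row_k ('D_(X p) (fun q => Y q 0 k) p - 'D_(Y p) (fun q => X q 0 k) p).

Definition curvature (R : realType) (n : nat) (g : field2 R n)
    (X Y Z : vfield R n) : vfield R n := fun p =>
  nabla g X (nabla g Y Z) p - nabla g Y (nabla g X Z) p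
  - nabla g (lie_bracket X Y) Z p.

(* The curvature is tensorial, so its value on tangent vectors at p is computed
   on the extensions of these with constant coordinates. *)
Definition riem (R : realType) (n : nat) (g : field2 R n) (p : 'rV[R]_n)
    (u v w z : 'rV[R]_n) : R :=
  g p (curvature g (cst u) (cst v) (cst w) p) z.

Definition sectional (R : realType) (n : nat) (g : field2 R n) (p : 'rV[R]_n)
    (u v : 'rV[R]_n) : R :=
  riem g p u v v u.

(* From here on E is a g-orthonormal frame field. *)

Definition conn_coef (R : realType) (n : nat) (g : field2 R n)
    (E : 'I_n -> vfield R n) (p : 'rV[R]_n) (k i j : 'I_n) : R :=
  g p (nabla g (E i) (E j) p) (E k p).

Definition ricci (R : realType) (n : nat) (g : field2 R n)
    (E : 'I_n -> vfield R n) (p : 'rV[R]_n) (u v : 'rV[R]_n) : R :=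
  \sum_(i < n) riem g p (E i p) u v (E i p).

Definition scalar_curv (R : realType) (n : nat) (g : field2 R n)
    (E : 'I_n -> vfield R n) (p : 'rV[R]_n) : R :=
  \sum_(i < n) ricci g E p (E i p) (E i p).

(* (nabla_X theta)(Y) *)
Definition nabla_form (R : realType) (n : nat) (g : field2 R n)
    (X : vfield R n) (theta : field1 R n) (Y : vfield R n) (p : 'rV[R]_n) : R :=
  'D_(X p) (fun q => theta q (Y q)) p - theta p (nabla g X Y p).

Definition codiff (R : realType) (n : nat) (g : field2 R n)
    (E : 'I_n -> vfield R n) (theta : field1 R n) (p : 'rV[R]_n) : R :=
  - \sum_(i < n) nabla_form g (E i) theta (E i) p.

Definition sqnorm1 (R : realType) (n : nat) (E : 'I_n -> vfield R n)
    (theta : field1 R n) (p : 'rV[R]_n) : R :=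
  \sum_(i < n) theta p (E i p) ^+ 2.

Definition conformal_scalar_curv (R : realType) (n : nat) (g : field2 R n)
    (E : 'I_n -> vfield R n) (theta : field1 R n) (p : 'rV[R]_n) : R :=
  scalar_curv g E p - 6 * (sqnorm1 E theta p + codiff g E theta p).

(** Exterior forms *)

Definition is_form2 (R : realType) (n : nat) (w : form2 R n) : Prop :=
  [/\ forall u, w u u = 0,
      forall (c : R) u v z, w (c *: u + v) z = c * w u z + w v z &
      forall (c : R) u v z, w z (c *: u + v) = c * w z u + w z v].

Definition wedge11 (R : realType) (n : nat) (s t : form1 R n) : form2 R n :=
  fun u v => s u * t v - s v * t u.

Definition wedge12 (R : realType) (n : nat) (s : form1 R n) (w : form2 R n)
    (u v z : 'rV[R]_n) : R :=
  s u * w v z - s v * w u z + s z * w u v.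

Definition wedge22 (R : realType) (n : nat) (s t : form2 R n) : form4 R n :=
  fun u v w z =>
    s u v * t w z - s u w * t v z + s u z * t v w
    + s v w * t u z - s v z * t u w + s w z * t u v.

Definition ext_d2 (R : realType) (n : nat) (w : field2 R n) (p : 'rV[R]_n)
    (u v z : 'rV[R]_n) : R :=
  'D_u (fun q => w q v z) p - 'D_v (fun q => w q u z) p
  + 'D_z (fun q => w q u v) p.

(** Almost Hermitian structures *)

Definition kahler_form (R : realType) (n : nat) (g : field2 R n)
    (J : endfield R n) : field2 R n :=
  fun p u v => g p (J p u) v.

Definition almost_hermitian (R : realType) (n : nat) (M : set 'rV[R]_n)
    (g : field2 R n) (J : endfield R n) : Prop :=
  forall p, M p ->
    [/\ forall (c : R) u v, J p (c *: u + v) = c *: J p u + J p v,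
        forall u, J p (J p u) = - u &
        forall u v, g p (J p u) (J p v) = g p u v].

(* nabla J = 0; this is tensorial, hence tested on constant vector fields. *)
Definition is_kahler (R : realType) (n : nat) (M : set 'rV[R]_n)
    (g : field2 R n) (J : endfield R n) : Prop :=
  almost_hermitian M g J /\
  forall p u v, M p ->
    nabla g (cst u) (fun q => J q v) p = J p (nabla g (cst u) (cst v) p).

Definition is_lee_form (R : realType) (n : nat) (M : set 'rV[R]_n)
    (g : field2 R n) (J : endfield R n) (theta : field1 R n) : Prop :=
  forall p u v z, M p ->
    ext_d2 (kahler_form g J) p u v z
    = 2 * wedge12 (theta p) (kahler_form g J p) u v z.

Definition is_space_form (R : realType) (n : nat) (M : set 'rV[R]_n)
    (g : field2 R n) (J : endfield R n) : Prop :=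
  is_kahler M g J /\
  exists c : R, forall p u, M p -> g p u u = 1 ->
    riem g p u (J p u) (J p u) u = c.

(** Four-dimensional notions *)

(* For an almost Hermitian surface with Kaehler form w, this is the volume form
   of the orientation for which w is self-dual. *)
Definition kahler_vol (R : realType) (w : form2 R 4) : form4 R 4 :=
  fun u v s t => 2^-1 * wedge22 w w u v s t.

(* In the following definitions e is an orthonormal basis of a tangent space,
   and vol is a unit 4-form defining its orientation. *)

Definition inner2 (R : realType) (e : 'I_4 -> 'rV[R]_4) (s t : form2 R 4) : R :=
  2^-1 * \sum_(i < 4) \sum_(j < 4) s (e i) (e j) * t (e i) (e j).

Definition hodge (R : realType) (e : 'I_4 -> 'rV[R]_4) (vol : form4 R 4)
    (w : form2 R 4) : form2 R 4 := fun u v =>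
  2^-1 * \sum_(i < 4) \sum_(j < 4) vol u v (e i) (e j) * w (e i) (e j).

Definition is_asd (R : realType) (e : 'I_4 -> 'rV[R]_4) (vol : form4 R 4)
    (w : form2 R 4) : Prop :=
  is_form2 w /\ forall u v, hodge e vol w u v = - w u v.

Definition asd_part (R : realType) (e : 'I_4 -> 'rV[R]_4) (vol : form4 R 4)
    (w : form2 R 4) : form2 R 4 := fun u v =>
  2^-1 * (w u v - hodge e vol w u v).

(* The fibre of LM, for J with Kaehler form Om at the point *)
Definition in_LM (R : realType) (e : 'I_4 -> 'rV[R]_4) (vol : form4 R 4)
    (Om w : form2 R 4) : Prop :=
  is_asd e vol w /\ inner2 e w Om = 0.

(* The bundle LM has rank 2, so an orthonormal pair is a basis. *)
Definition orthonormal_LM (R : realType) (e : 'I_4 -> 'rV[R]_4)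
    (vol : form4 R 4) (Om phi psi : form2 R 4) : Prop :=
  [/\ in_LM e vol Om phi, in_LM e vol Om psi,
      inner2 e phi phi = 1, inner2 e psi psi = 1 & inner2 e phi psi = 0].

(* R - (1/2) (Ric o g) + (tau/12) (g o g), with o the Kulkarni-Nomizu product
   in the sign convention R(X,Y,Y,X) = K *)
Definition weyl (R : realType) (g : field2 R 4) (E : 'I_4 -> vfield R 4)
    (p : 'rV[R]_4) (u v w z : 'rV[R]_4) : R :=
  riem g p u v w z
  - 2^-1 * (ricci g E p v w * g p u z + ricci g E p u z * g p v w
            - ricci g E p u w * g p v z - ricci g E p v z * g p u w)
  + scalar_curv g E p / 6 * (g p v w * g p u z - g p u w * g p v z).

(* With the same contraction, the curvature tensor
   g(v,w) g(u,z) - g(u,w) g(v,z) of constant curvature 1 acts as the identity. *)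
Definition weyl_op (R : realType) (g : field2 R 4) (E : 'I_4 -> vfield R 4)
    (p : 'rV[R]_4) (w : form2 R 4) : form2 R 4 := fun u v =>
  2^-1 * \sum_(i < 4) \sum_(j < 4)
    weyl g E p u v (E j p) (E i p) * w (E i p) (E j p).

Definition weyl_minus (R : realType) (g : field2 R 4) (E : 'I_4 -> vfield R 4)
    (vol : form4 R 4) (p : 'rV[R]_4) (w : form2 R 4) : form2 R 4 :=
  let e i := E i p in
  asd_part e vol (weyl_op g E p (asd_part e vol w)).

(** Isometries *)

Definition is_isometry (R : realType) (n : nat)
    (V : set 'rV[R]_n) (g : field2 R n) (V' : set 'rV[R]_n) (g' : field2 R n)
    (F G : 'rV[R]_n -> 'rV[R]_n) : Prop :=
  [/\ smooth_map V F /\ smooth_map V' G,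
      forall p, V p -> V' (F p) /\ G (F p) = p,
      forall q, V' q -> V (G q) /\ F (G q) = q &
      forall p u v, V p -> g' (F p) ('D_u F p) ('D_v F p) = g p u v].

Definition locally_isometric (R : realType) (n : nat)
    (M : set 'rV[R]_n) (g : field2 R n) (N : set 'rV[R]_n) (g' : field2 R n) :
    Prop :=
  forall p, M p ->
    exists (V V' : set 'rV[R]_n) (F G : 'rV[R]_n -> 'rV[R]_n),
      [/\ open V, V p /\ V `<=` M, open V', V' `<=` N &
          is_isometry V g V' g' F G].

Definition o1 : 'I_4 := @Ordinal 4 0 isT.
Definition o2 : 'I_4 := @Ordinal 4 1 isT.
Definition o3 : 'I_4 := @Ordinal 4 2 isT.
Definition o4 : 'I_4 := @Ordinal 4 3 isT.

(** The complex ball *)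

Definition dot4 (R : realType) (u v : 'rV[R]_4) : R :=
  \sum_(i < 4) u 0 i * v 0 i.

(* Multiplication by i on C^2 = R^4, (w1, w2) = (x1 + i y1, x2 + i y2) being
   encoded as (x1, y1, x2, y2) *)
Definition mul_i (R : realType) (w : 'rV[R]_4) : 'rV[R]_4 :=
  \row_k [:: - w 0 o2; w 0 o1; - w 0 o4; w 0 o3]`_k.

Definition ball2C (R : realType) : set 'rV[R]_4 := [set w | dot4 w w < 1].

(* The real part of the Hermitian metric
   |dw|^2 / (1 - |w|^2) + |<dw, w>|^2 / (1 - |w|^2)^2, divided by a^2.  On the
   disc w2 = 0 it is |dw|^2 / (a^2 (1 - |w|^2)^2), of curvature - 4 a^2. *)
Definition bergman (R : realType) (a : R) : field2 R 4 := fun w u v =>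
  a ^- 2 * (dot4 u v / (1 - dot4 w w)
            + (dot4 u w * dot4 v w + dot4 u (mul_i w) * dot4 v (mul_i w))
              / (1 - dot4 w w) ^+ 2).

(** The metric on U x N; the coordinates are (x, y) on 'rV_2 and (x, y, z, t)
    on 'rV_4. *)

Definition dx2 (R : realType) (f : 'rV[R]_2 -> R) : 'rV[R]_2 -> R :=
  pd (@Ordinal 2 0 isT) f.
Definition dy2 (R : realType) (f : 'rV[R]_2 -> R) : 'rV[R]_2 -> R :=
  pd (@Ordinal 2 1 isT) f.
Definition laplacian (R : realType) (f : 'rV[R]_2 -> R) : 'rV[R]_2 -> R :=
  fun q => dx2 (dx2 f) q + dy2 (dy2 f) q.
Definition lnf (R : realType) (f : 'rV[R]_2 -> R) : 'rV[R]_2 -> R :=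
  fun q => ln (f q).

Definition xy (R : realType) (p : 'rV[R]_4) : 'rV[R]_2 :=
  \row_k [:: p 0 o1; p 0 o2]`_k.
Definition zc (R : realType) (p : 'rV[R]_4) : R := p 0 o3.
Definition tc (R : realType) (p : 'rV[R]_4) : R := p 0 o4.

Definition domM (R : realType) (U : set 'rV[R]_2) : set 'rV[R]_4 :=
  [set p | U (xy p) /\ zc p < 0].

Definition l2 (R : realType) (a : R) (H : 'rV[R]_2 -> R) (q : 'rV[R]_2) : R :=
  - (1 / (2 * a)) * dy2 (lnf H) q.
Definition n2 (R : realType) (a : R) (H : 'rV[R]_2 -> R) (q : 'rV[R]_2) : R :=
  1 / (2 * a) * dx2 (lnf H) q.

Definition theta1 (R : realType) (a : R) (h : 'rV[R]_2 -> R) : field1 R 4 :=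
  fun p u => cosh (a * zc p) * h (xy p) * u 0 o1.
Definition theta2 (R : realType) (a : R) (h : 'rV[R]_2 -> R) : field1 R 4 :=
  fun p u => cosh (a * zc p) * h (xy p) * u 0 o2.
Definition theta3 (R : realType) (a : R) (H : 'rV[R]_2 -> R) : field1 R 4 :=
  fun p u =>
    sinh (2 * a * zc p) * u 0 o4
    - (cos (2 * a * tc p) * cosh (2 * a * zc p) * H (xy p)
       + sinh (2 * a * zc p) * l2 a H (xy p)) * u 0 o1
    - (- sin (2 * a * tc p) * cosh (2 * a * zc p) * H (xy p)
       + sinh (2 * a * zc p) * n2 a H (xy p)) * u 0 o2.
Definition theta4 (R : realType) (a : R) (H : 'rV[R]_2 -> R) : field1 R 4 :=
  fun p u =>
    u 0 o3 - sin (2 * a * tc p) * H (xy p) * u 0 o1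
    - cos (2 * a * tc p) * H (xy p) * u 0 o2.

Definition coframe (R : realType) (a : R) (h H : 'rV[R]_2 -> R) (i : 'I_4) :
  field1 R 4 := fun p u =>
  [:: theta1 a h p u; theta2 a h p u; theta3 a H p u; theta4 a H p u]`_i.

Definition metric (R : realType) (a : R) (h H : 'rV[R]_2 -> R) : field2 R 4 :=
  fun p u v => \sum_(i < 4) coframe a h H i p u * coframe a h H i p v.

Definition dual_frame (R : realType) (M : set 'rV[R]_4) (th : 'I_4 -> field1 R 4)
    (E : 'I_4 -> vfield R 4) : Prop :=
  forall p i j, M p -> th i p (E j p) = (i == j)%:R.

Definition OmegaBar (R : realType) (a : R) (h H : 'rV[R]_2 -> R) : field2 R 4 :=
  fun p u v => wedge11 (theta1 a h p) (theta2 a h p) u v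
               + wedge11 (theta4 a H p) (theta3 a H p) u v.
Definition Omega (R : realType) (a : R) (h H : 'rV[R]_2 -> R) : field2 R 4 :=
  fun p u v => wedge11 (theta1 a h p) (theta2 a h p) u v
               + wedge11 (theta3 a H p) (theta4 a H p) u v.

Definition alpha (R : realType) (a : R) (p : 'rV[R]_4) : R :=
  - 2 * a * tanh (a * zc p).
Definition lee_theta (R : realType) (a : R) (H : 'rV[R]_2 -> R) : field1 R 4 :=
  fun p u => - alpha a p * theta4 a H p u.

(* Main.v *)
(** Cartan's method.  In the coframe [theta_i] the connection forms are explicit:
    [omega_14 = omega_23 = a tanh(az) theta_1], [omega_24 = - omega_13 = a tanh(az) theta_2],
    and two rotation forms [omega_21 = psi], [omega_34 = chi].  Being skew and satisfying
    the first structure equation, they are the Levi-Civita connection; by the equation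
    for [Delta ln H], the second structure equation gives the curvature of the complex
    hyperbolic plane of holomorphic curvature [- 4 a^2] plus [mu (theta_1 /\ theta_2)^2],
    where [mu = (4 a^2 h^2 - 2 a^2 H^2 - Delta ln h) / (h^2 cosh(az)^2)].  All the
    curvature formulas follow, and the Kaehler surface is a space form iff [mu = 0].

    In that case the two Laplace equations say that a [u(2,1)]-valued one-form on [U] is
    flat.  A parallel pseudo-unitary frame [f_0, f_1, f_2] of [C^(2,1)] gives the map
    [cosh(az) f_0 + sinh(az) i e^(2iat) f_2] into the hyperquadric [<X, X> = -1], and its
    projection to the ball is the local isometry. *)

From HB Require Import structures.
Require Import Defs.
From mathcomp Require Import all_boot all_order all_algebra.
From mathcomp Require Import all_classical all_reals all_analysis.
From mathcomp Require Import ring lra.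

Set Implicit Arguments.
Unset Strict Implicit.
Unset Printing Implicit Defensive.

Import Order.TTheory GRing.Theory Num.Theory numFieldNormedType.Exports.

Local Open Scope classical_set_scope.
Local Open Scope ring_scope.

(** * Differential calculus in coordinates *)

(** Neither [E] nor the complex structures are assumed smooth: [E] is known only by duality, [Jb]
    and [J] only through their Kaehler forms, so their regularity has to be recovered from the
    coframe. Once the derivatives of h and H are written through those of ln h and ln H, both
    structure equations become polynomial identities modulo cosh^2 - sinh^2 = 1, cos^2 + sin^2 = 1
    and the Laplace equation for ln H; they are checked on pairs of coordinate vectors. The
    perturbation mu acts on one plane only. Since theta_1 /\ theta_2 = (Omega + OmegaBar) / 2, its
    anti-self-dual part is Omega / 2, and removing the trace yields the eigenvalues mu/3, -mu/6,
    -mu/6 of W^-; the complex hyperbolic part contributes nothing. The statement on the ball is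
    local for two reasons: the parallel frame is obtained by integrating along rays in a small ball,
    and the developing map is inverted only near a point, where an isometric map has invertible
    differential. *)

Section RowVectors.
Context {R : realType} {n : nat}.
Implicit Types (v p : 'rV[R]_n) (f : 'rV[R]_n -> R).

Lemma ler_coord_norm v i : `|v 0 i| <= `|v|.
Proof.
by rewrite [leRHS]/Num.norm /= mx_normrE; apply/bigmax_geP; right => /=; exists (0, i).
Qed.

Lemma norm_rV_le v (e : R) : 0 <= e -> (forall i, `|v 0 i| <= e) -> `|v| <= e.
Proof.
move=> e0 ve; rewrite [leLHS]/Num.norm /= mx_normrE; apply/bigmax_leP; split => //=.
by case=> i j _ /=; rewrite ord1.
Qed.

Lemma norm_sum_rV_le v (d : 'I_n -> R) (K : R) : (forall i, `|d i| <= K) ->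
  `|\sum_i v 0 i * d i| <= n%:R * K * `|v|.
Proof.
move=> dK; apply: (le_trans (ler_norm_sum _ _ _)).
have -> : n%:R * K * `|v| = \sum_(i < n) K * `|v|.
  by rewrite sumr_const card_ord -[RHS]mulr_natl mulrA.
by apply: ler_sum => i _; rewrite normrM mulrC ler_pM // ler_coord_norm.
Qed.

Lemma rV_eq_sum v : v = \sum_i v 0 i *: bvec i.
Proof. by rewrite [LHS]row_sum_delta. Qed.

(** Bundled as a continuous linear map, so that [diff_unique] can identify it as the
    differential. *)
Let lform (d : 'I_n -> R) v := \sum_i v 0 i * d i.

Let lform_linear d : linear (lform d).
Proof.
move=> a u v; rewrite /lform scaler_sumr -big_split; apply: eq_bigr => i _.
by rewrite !mxE mulrDl /= -mulrA.
Qed.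

HB.instance Definition _ d := GRing.isLinear.Build R 'rV[R]_n R _ (lform d) (lform_linear d).

Let lform_continuous d : continuous (lform d).
Proof.
apply: bounded_linear_continuous => /=.
apply/ex_bound; exists (n%:R * \sum_i `|d i|).
near=> v; apply: (le_trans (norm_sum_rV_le _ (K := \sum_i `|d i|) _)).
  by move=> i; rewrite (bigD1 i) //= lerDl sumr_ge0.
apply: ler_piMr.
  by rewrite mulr_ge0 // sumr_ge0.
have : ball (0 : 'rV[R]_n) 1 v by near: v; exact: nbhsx_ballx.
by rewrite -ball_normE /ball_ /= sub0r normrN => /ltW.
Unshelve. all: by end_near. Qed.

(** A remainder bounded by C |v|^2 is o(v). The quadratic form of the hypothesis is what Taylor
    estimates deliver, both for the inverse of a map and for the solution of a flat linear
    system. *)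
Lemma quadratic_differentiable f p (d : 'I_n -> R) (C : R) :
  (\forall v \near (0 : 'rV[R]_n),
     `|f (v + p) - f p - \sum_i v 0 i * d i| <= C * `|v| ^+ 2) ->
  differentiable f p /\ forall v, 'D_v f p = \sum_i v 0 i * d i.
Proof.
move=> Hq.
have L : f \o shift p = cst (f p) + lform d +o_ (0 : 'rV[R]_n) id.
  apply/eqaddoP => _/posnumP[e]; near=> v.
  rewrite !fctE /= opprD addrA.
  have /le_trans -> // : `|f (v + p) - f p - lform d v| <= C * `|v| ^+ 2 by near: v.
  rewrite expr2 mulrA ler_wpM2r //.
  (* [C] may be zero or negative; [|C| + 1] can be divided by. *)
  have /le_trans -> // : C * `|v| <= (`|C| + 1) * `|v|.
    by rewrite ler_wpM2r // (le_trans (ler_norm _)) // lerDl.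
  have C0 : 0 < `|C| + 1 by rewrite ltr_wpDl.
  rewrite -(ler_pdivlMl _ _ C0).
  have : ball (0 : 'rV[R]_n) ((`|C| + 1)^-1 * e%:num) v.
    by near: v; apply: nbhsx_ballx; apply: mulr_gt0.
  by rewrite -ball_normE /ball_ /= sub0r normrN => /ltW.
have dE := diff_unique (@lform_continuous d) L.
have df : differentiable f p.
  by apply/diff_locallyP; rewrite dE; split; [exact: lform_continuous|exact: L].
by split=> // v; rewrite deriveE // dE.
Unshelve. all: by end_near. Qed.

(** The difference [g - f] vanishes near p, so the quadratic criterion applies to it with C = 0. *)
Lemma near_eq_differentiable f g p : (\forall q \near p, f q = g q) ->
  differentiable f p -> differentiable g p.
Proof.
move=> fg df.
have fgp : f p = g p by exact: nbhs_singleton fg.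
have -> : g = f + (g - f) by rewrite addrC subrK.
apply: differentiableD => //.
apply: (quadratic_differentiable (d := fun=> 0) (C := 0) _).1.
have : \forall v \near (0 : 'rV[R]_n), f (v + p) = g (v + p).
  by move: fg; rewrite (near_shift 0 p) /= subr0.
apply: filterS => v; rewrite !fctE => <-.
by rewrite -fgp !subrr big1 ?subr0 ?normr0 ?mul0r // => i _; rewrite mulr0.
Qed.

Lemma derive_pd f p v : differentiable f p -> 'D_v f p = \sum_i v 0 i * pd i f p.
Proof.
move=> df; rewrite deriveE // {1}(rV_eq_sum v) linear_sum; apply: eq_bigr => i _.
by rewrite linearZ /= /pd deriveE.
Qed.

(** Both difference quotients are the same function of the increment, so one-variable theorems apply
    along a line without differentiability of [f]. *)
Lemma is_derive_line f p v (t df : R) :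
  is_derive (p + t *: v) v f df <-> is_derive t 1 (fun s => f (p + s *: v)) df.
Proof.
have E : (fun h => h^-1 *: ((f \o shift (p + t *: v)) (h *: v) - f (p + t *: v)))
  = (fun h => h^-1 *: (((fun s => f (p + s *: v)) \o shift t) (h *: 1) - f (p + t *: v))).
  apply/funext => h /=; congr (_ *: (f _ - _)).
  have -> : h *: (1 : R) = h by exact: mulr1.
  by rewrite scalerDl addrCA.
by split=> -[D1 D2]; apply: DeriveDef;
  rewrite ?/derivable ?/derive ?E ?[in X in X = _]/= in D1 D2 *.
Qed.

Lemma is_derive_comp1 (phi : R -> R) f p v (df dphi : R) :
  is_derive (f p) 1 phi dphi -> is_derive p v f df ->
  is_derive p v (phi \o f) (dphi * df).
Proof.
move=> Hphi Hf.
have p0 : p = p + 0 *: v by rewrite scale0r addr0.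
rewrite p0; apply/is_derive_line.
apply: (@is_derive1_comp _ phi (fun s => f (p + s *: v))); last by apply/is_derive_line; rewrite -p0.
by rewrite -p0.
Qed.

End RowVectors.

(** * Mean value and Taylor estimates, symmetry of second derivatives *)

Section MeanValue.
Context {R : realType}.

Lemma mean_value01 (g dg : R -> R) :
  (forall t : R, 0 <= t <= 1 -> is_derive t 1 g (dg t)) ->
  forall s, 0 <= s <= 1 -> exists2 xi, 0 <= xi <= 1 & g s - g 0 = dg xi * s.
Proof.
move=> Hg s /andP[s0 s1].
have [t|t|xi] := @MVT_segment R g dg 0 s s0.
- rewrite in_itv /= => /andP[t0 ts]; apply: Hg.
  by rewrite (ltW t0) (le_trans (ltW ts)).
- apply: continuous_in_subspaceT => {}t; rewrite inE /= in_itv /= => /andP[t0 ts].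
  have [] := Hg t; first by rewrite t0 (le_trans ts).
  by move=> /derivable1_diffP /differentiable_continuous.
- rewrite in_itv /= subr0 => /andP[x0 xs] ->; exists xi => //.
  by rewrite x0 (le_trans xs).
Qed.

Context {n : nat}.
Implicit Types (f : 'rV[R]_n -> R) (p q v w : 'rV[R]_n).

Lemma mean_value_segment f p v :
  (forall t : R, 0 <= t <= 1 -> differentiable f (p + t *: v)) ->
  exists2 xi : R, 0 <= xi <= 1 & f (p + v) - f p = 'D_v f (p + xi *: v).
Proof.
move=> Hf.
have Hd (t : R) : 0 <= t <= 1 ->
    is_derive t 1 (fun t => f (p + t *: v)) ('D_v f (p + t *: v)).
  by move=> /Hf /diff_derivable dft; apply/is_derive_line/derivableP.
have [|xi x01] := mean_value01 Hd (s := 1); first by rewrite ler01 lexx.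
by rewrite scale1r scale0r addr0 mulr1 => ->; exists xi.
Qed.

Lemma ball_norm p q (r : R) : ball p r q = (`|q - p| < r).
Proof. by rewrite -ball_normE /ball_ /= distrC. Qed.

Lemma near_ball p (P : 'rV[R]_n -> Prop) : (\forall q \near p, P q) ->
  exists2 r : R, 0 < r & forall q, ball p r q -> P q.
Proof. by move=> /nbhs_ballP[r r0 Hr]; exists r. Qed.

Lemma ball_segment p q w (r t : R) : ball p r q -> ball p r (q + w) ->
  0 <= t <= 1 -> ball p r (q + t *: w).
Proof.
rewrite !ball_norm => Hq Hqw /andP[t0 t1].
have -> : q + t *: w - p = (1 - t) *: (q - p) + t *: (q + w - p).
  by apply/rowP => k; rewrite !mxE; ring.
apply: (le_lt_trans (ler_normD _ _)).
rewrite !normrZ (ger0_norm t0) ger0_norm ?subr_ge0 //.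
(* The strict inequality comes from the summand with factor t, hence the separate case t = 0. *)
have [t01|/eqP t01] := ltP 0 t; last first.
  have -> : t = 0 by apply/eqP; rewrite eq_le t0 andbT; apply/eqP.
  by rewrite mul0r addr0 subr0 mul1r.
have -> : r = (1 - t) * r + t * r by rewrite -mulrDl subrK mul1r.
by rewrite ler_ltD // ?ltr_pM2l // ler_wpM2l ?subr_ge0 // ltW.
Qed.

Lemma lipschitz_pd f p (r K : R) q w :
  (forall q, ball p r q -> differentiable f q) ->
  (forall i q, ball p r q -> `|pd i f q| <= K) ->
  ball p r q -> ball p r (q + w) ->
  `|f (q + w) - f q| <= n%:R * K * `|w|.
Proof.
move=> df fK Hq Hqw.
have Hs (t : R) : 0 <= t <= 1 -> ball p r (q + t *: w) by exact: ball_segment.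
have [t t01|xi x01 ->] := @mean_value_segment f q w; first exact/df/Hs.
by rewrite derive_pd; [apply: norm_sum_rV_le => i; apply/fK/Hs|apply/df/Hs].
Qed.

(** The mean value point turns the remainder into a difference of first derivatives, to which the
    Lipschitz bound applies. *)
Lemma taylor2_pd f p (r K : R) q w :
  (forall q, ball p r q -> differentiable f q) ->
  (forall i q, ball p r q -> differentiable (pd i f) q) ->
  (forall i j q, ball p r q -> `|pd j (pd i f) q| <= K) ->
  ball p r q -> ball p r (q + w) ->
  `|f (q + w) - f q - \sum_i w 0 i * pd i f q| <= n%:R * (n%:R * K * `|w|) * `|w|.
Proof.
move=> df d2f fK Hq Hqw.
have Hs (t : R) : 0 <= t <= 1 -> ball p r (q + t *: w) by exact: ball_segment.
have [t t01|xi x01 ->] := @mean_value_segment f q w; first exact/df/Hs.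
rewrite derive_pd; last exact/df/Hs.
rewrite -sumrB; under eq_bigr do rewrite -mulrBr.
apply: norm_sum_rV_le => i.
apply: le_trans (lipschitz_pd (d2f i) (fK i) Hq (Hs _ x01)) _.
have K0 : 0 <= K by apply: le_trans (fK i i _ Hq); exact: normr_ge0.
rewrite ler_wpM2l ?mulr_ge0 // normrZ.
by have /andP[x0 x1] := x01; rewrite ger0_norm // ler_piMl.
Qed.

Lemma norm_bvec i : `|bvec i : 'rV[R]_n| <= 1.
Proof.
by apply: norm_rV_le => // j; rewrite !mxE eqxx /=; case: eqP; rewrite ?normr1 ?normr0.
Qed.

Let scaleRE (x y : R) : x *: y = x * y. Proof. by []. Qed.

(** Mean value theorem twice: along e_i for the increment [phi] in direction e_j, then along e_j for
    the i-th partial derivative. The second difference is symmetric in i and j, which is what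
    [pd_comm] exploits. *)
Let second_difference f i j p (s : R) : 0 < s ->
  (forall q, `|q - p| <= 2 * s -> differentiable f q) ->
  (forall q, `|q - p| <= 2 * s -> differentiable (pd i f) q) ->
  exists2 q, `|q - p| <= 2 * s &
    f (p + s *: bvec i + s *: bvec j) - f (p + s *: bvec i)
    - (f (p + s *: bvec j) - f p) = s ^+ 2 * pd j (pd i f) q.
Proof.
move=> s0 df d2f.
have Hn k (t : R) : 0 <= t <= 1 -> `|t *: (s *: bvec k) : 'rV[R]_n| <= s.
  move=> /andP[t0 t1]; rewrite !normrZ (ger0_norm t0) (gtr0_norm s0).
  apply: (@le_trans _ _ (s * `|bvec k : 'rV[R]_n|)); first by rewrite ler_piMl // mulr_ge0 // ltW.
  by rewrite ler_piMr // ?norm_bvec // ltW.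
have H1 : s *: bvec j = 1 *: (s *: bvec j) :> 'rV[R]_n by rewrite scale1r.
have ss : s <= 2 * s by rewrite mulrDl mul1r lerDl ltW.
pose phi q := f (q + s *: bvec j) - f q.
have dphi (t : R) : 0 <= t <= 1 ->
  differentiable (fun q => f (q + s *: bvec j)) (p + t *: (s *: bvec i)) /\
  differentiable f (p + t *: (s *: bvec i)).
  move=> t01; split; last first.
    by apply: df; rewrite addrAC subrr add0r (le_trans (Hn _ _ t01)).
  apply: (@differentiable_comp _ _ _ _ (fun q => q + s *: bvec j) f).
    exact: differentiableD.
  apply: df; rewrite -(addrA p) addrAC subrr add0r (le_trans (ler_normD _ _)) //.
  by rewrite mulrDl mul1r lerD // ?Hn // H1 Hn // lexx ler01.
have [t t01|xi x01] := @mean_value_segment phi p (s *: bvec i).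
  by have [] := dphi t t01; exact: differentiableB.
have -> : phi (p + s *: bvec i) - phi p = f (p + s *: bvec i + s *: bvec j) - f (p + s *: bvec i)
    - (f (p + s *: bvec j) - f p) by [].
move=> ->.
set q0 := p + xi *: _.
have [d1 d2] := dphi _ x01.
have Dshift : 'D_(bvec i) (fun q => f (q + s *: bvec j)) q0 = pd i f (q0 + s *: bvec j).
  rewrite /pd /derive; set F := (X in lim (X @ _)); set G := (X in _ = lim (X @ _)).
  have -> // : F = G.
  apply/funext => h; by rewrite /F /G /= -(addrA (h *: _)).
have -> : 'D_(s *: bvec i) phi q0 = s * (pd i f (q0 + s *: bvec j) - pd i f q0).
  rewrite deriveE; last exact: differentiableB.
  rewrite linearZ /= -deriveE; last exact: differentiableB.
  rewrite [LHS]scaleRE -Dshift /pd -deriveB //; exact: diff_derivable.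
have Hq0 (t : R) : 0 <= t <= 1 -> `|q0 + t *: (s *: bvec j) - p| <= 2 * s.
  move=> t01; rewrite /q0 -(addrA p) addrAC subrr add0r (le_trans (ler_normD _ _)) //.
  by rewrite mulrDl mul1r lerD // Hn.
have [t t01|eta e01 ->] := @mean_value_segment (pd i f) q0 (s *: bvec j).
  exact/d2f/Hq0.
exists (q0 + eta *: (s *: bvec j)); first exact: Hq0.
rewrite deriveE; last exact/d2f/Hq0.
rewrite linearZ /= /pd -deriveE; last exact/d2f/Hq0.
by rewrite scaleRE mulrA -expr2.
Qed.

Lemma pd_comm f i j p :
  (\forall q \near p, [/\ differentiable f q, differentiable (pd i f) q
     & differentiable (pd j f) q]) ->
  {for p, continuous (pd j (pd i f))} -> {for p, continuous (pd i (pd j f))} ->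
  pd j (pd i f) p = pd i (pd j f) p.
Proof.
move=> Hd c1 c2; apply/eqP; rewrite -subr_eq0 -normr_le0; apply/ler_addgt0Pr => e e0.
rewrite add0r.
have e2 : 0 < e / 2 by rewrite divr_gt0.
have /cvgrPdist_lt /(_ _ e2) n1 := c1; have /cvgrPdist_lt /(_ _ e2) n2 := c2.
have [r r0 Hr] := near_ball (filterI Hd (filterI n1 n2)).
(* The intermediate points lie within 2s of p, so s = r/3 keeps them in the ball of radius r. *)
have s0 : 0 < r / 3 by rewrite divr_gt0.
have Hb q : `|q - p| <= 2 * (r / 3) -> ball p r q.
  by rewrite ball_norm => /le_lt_trans; apply; move: (r0 : 0 < r); lra.
have [q /Hb /Hr [[? ? ?] //]|q /Hb /Hr [[? ? ?] //]|q1 q1p E1] :=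
  @second_difference f i j p _ s0.
have [q /Hb /Hr [[? ? ?] //]|q /Hb /Hr [[? ? ?] //]|q2 q2p E2] :=
  @second_difference f j i p _ s0.
have E : pd j (pd i f) q1 = pd i (pd j f) q2.
  apply: (mulfI (x := (r / 3) ^+ 2)); first by rewrite expf_neq0 // gt_eqF.
  have sub4AC (x y z t : R) : x - y - (z - t) = x - z - (y - t) by ring.
  apply: etrans (esym E1) _; apply: etrans _ E2.
  have -> : p + r / 3 *: bvec i + r / 3 *: bvec j = p + r / 3 *: bvec j + r / 3 *: bvec i.
    by rewrite addrAC.
  exact: sub4AC.
have [_ [/= h1 _]] := Hr _ (Hb _ q1p); have [_ [/= _ h2]] := Hr _ (Hb _ q2p).
rewrite E in h1.
apply: le_trans (ler_distD (pd i (pd j f) q2) _ _) _.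
rewrite (splitr e); apply: lerD; first exact: ltW h1.
by rewrite distrC; exact: ltW h2.
Qed.

End MeanValue.

(** A finite-order version of [smooth_on], so that closure properties can be proved by induction on
    the order. The index is shifted: order 0 already means differentiable, and order k means
    differentiable k + 1 times. *)
Fixpoint Ck (R : realType) (n : nat) (U : set 'rV[R]_n) (k : nat)
    (f : 'rV[R]_n -> R) : Prop :=
  (forall p, U p -> differentiable f p) /\
  (if k is k'.+1 then forall i, Ck U k' (pd i f) else True).

Section Ck.
Context {R : realType} {n : nat} (U : set 'rV[R]_n) (U_open : open U).
Implicit Types (f g : 'rV[R]_n -> R) (p v : 'rV[R]_n).

Lemma near_open p : U p -> \forall q \near p, U q.
Proof. by move=> Up; apply: open_nbhs_nbhs; split. Qed.

Lemma Ck_differentiable k f p : Ck U k f -> U p -> differentiable f p.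
Proof. by case: k => [|k] [df _] /df. Qed.

(** Asking for every order m < k at once fits strong induction and absorbs the case k = 0. *)
Lemma Ck_intro k f : (forall p, U p -> differentiable f p) ->
  (forall m i, (m < k)%N -> Ck U m (pd i f)) -> Ck U k f.
Proof. by case: k => [|k] df d2f; split=> // i; exact: d2f. Qed.

Lemma Ck_le k m f : (m <= k)%N -> Ck U k f -> Ck U m f.
Proof.
elim: m k f => [|m IH] [|k] f // mk [df d2f]; split=> // i.
exact: IH mk (d2f i).
Qed.

Lemma Ck_pd k m f i : (m < k)%N -> Ck U k f -> Ck U m (pd i f).
Proof. by case: k => // k mk [_ d2f]; exact: Ck_le (d2f i). Qed.

Lemma eq_on_derive f g v p : (forall q, U q -> f q = g q) -> U p -> 'D_v f p = 'D_v g p.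
Proof.
by move=> fg Up; apply: near_eq_derive; apply: filterS (near_open Up) => q; exact: fg.
Qed.

Lemma eq_on_differentiable f g p : (forall q, U q -> f q = g q) -> U p ->
  differentiable f p -> differentiable g p.
Proof.
move=> fg Up; apply: near_eq_differentiable.
by apply: filterS (near_open Up) => q; exact: fg.
Qed.

Lemma Ck_eq k f g : (forall q, U q -> f q = g q) -> Ck U k f -> Ck U k g.
Proof.
elim/ltn_ind: k f g => k IH f g fg cf; apply: Ck_intro => [p Up|m i mk].
  by apply: (eq_on_differentiable fg) => //; exact: Ck_differentiable cf Up.
apply: (IH m mk (pd i f)); last exact: Ck_pd cf.
by move=> q Uq; exact: eq_on_derive.
Qed.

(** [pds] applies the head of the list last, so it is the last index that gets absorbed into the
    function. *)
Lemma smooth_onP f : smooth_on U f <-> forall k, Ck U k f.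
Proof.
split=> [Hf k|].
- elim/ltn_ind: k f Hf => k IH f Hf; apply: Ck_intro => [p|m i mk]; first exact: (Hf [::]).
  apply: IH => // s p Up; have := Hf (rcons s i) p Up.
  suff -> : pds (rcons s i) f = pds s (pd i f) by [].
  by elim: s => //= j s ->.
- move=> Hf s; elim/last_ind: s f Hf => [|s i IH] f Hf p Up.
    exact: Ck_differentiable (Hf 0%N) Up.
  have -> : pds (rcons s i) f = pds s (pd i f) by elim: s {IH} => //= j s ->.
  by apply: IH Up => k; exact: (Ck_pd i (ltnSn k)).
Qed.

Lemma Ck_cst k (c : R) : Ck U k (fun=> c).
Proof.
elim/ltn_ind: k c => k IH c; apply: Ck_intro => [p _|m i mk]; first exact: differentiable_cst.
by apply: (Ck_eq _ (IH m mk 0)) => q _; rewrite /pd derive_cst.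
Qed.

Lemma Ck_coord k i : Ck U k (fun p => p 0 i).
Proof.
apply: Ck_intro => [p _|m j mk]; first exact: differentiable_coord.
apply: (Ck_eq _ (Ck_cst m ((bvec j : 'rV[R]_n) 0 i))) => q _.
have /matrixP/(_ 0 i) := derive_mx (@derivable_id R 'rV[R]_n q (bvec j)).
by rewrite derive_id [X in _ = X -> _]mxE => ->.
Qed.

Lemma CkD k f g : Ck U k f -> Ck U k g -> Ck U k (fun p => f p + g p).
Proof.
elim/ltn_ind: k f g => k IH f g cf cg.
have df p (Up : U p) := Ck_differentiable cf Up; have dg p (Up : U p) := Ck_differentiable cg Up.
apply: Ck_intro => [p Up|m i mk]; first by apply: differentiableD; [exact: df|exact: dg].
apply: (Ck_eq _ (IH m mk _ _ (Ck_pd i mk cf) (Ck_pd i mk cg))) => p Up.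
apply: esym; apply: deriveD; apply: diff_derivable; [exact: df|exact: dg].
Qed.

Lemma CkM k f g : Ck U k f -> Ck U k g -> Ck U k (fun p => f p * g p).
Proof.
elim/ltn_ind: k f g => k IH f g cf cg.
have df p (Up : U p) := Ck_differentiable cf Up; have dg p (Up : U p) := Ck_differentiable cg Up.
apply: Ck_intro => [p Up|m i mk]; first by apply: differentiableM; [exact: df|exact: dg].
have mk' := ltnW mk.
apply: (Ck_eq _ (CkD (IH m mk _ _ (Ck_le mk' cf) (Ck_pd i mk cg))
                     (IH m mk _ _ (Ck_le mk' cg) (Ck_pd i mk cf)))) => p Up.
apply: esym; apply: deriveM; apply: diff_derivable; [exact: df|exact: dg].
Qed.

Lemma CkN k f : Ck U k f -> Ck U k (fun p => - f p).
Proof.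
move=> cf; apply: (Ck_eq _ (CkM (Ck_cst k (-1)) cf)) => q _.
by rewrite mulN1r.
Qed.

Lemma CkB k f g : Ck U k f -> Ck U k g -> Ck U k (fun p => f p - g p).
Proof. by move=> cf cg; apply: CkD => //; exact: CkN. Qed.

Lemma Ck_sum k (I : Type) (s : seq I) (F : I -> 'rV[R]_n -> R) :
  (forall i, Ck U k (F i)) -> Ck U k (fun p => \sum_(i <- s) F i p).
Proof.
move=> cF; elim: s => [|i s IH].
  by apply: (Ck_eq _ (Ck_cst k 0)) => q _; rewrite big_nil.
by apply: (Ck_eq _ (CkD (cF i) IH)) => q _; rewrite big_cons.
Qed.

Lemma Ck_prod k (I : Type) (s : seq I) (F : I -> 'rV[R]_n -> R) :
  (forall i, Ck U k (F i)) -> Ck U k (fun p => \prod_(i <- s) F i p).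
Proof.
move=> cF; elim: s => [|i s IH].
  by apply: (Ck_eq _ (Ck_cst k 1)) => q _; rewrite big_nil.
by apply: (Ck_eq _ (CkM (cF i) IH)) => q _; rewrite big_cons.
Qed.

Lemma CkX k f m : Ck U k f -> Ck U k (fun p => f p ^+ m).
Proof.
move=> cf; elim: m => [|m IH]; first exact: Ck_cst.
by apply: (Ck_eq _ (CkM cf IH)) => q _; rewrite exprS.
Qed.

Lemma derive_comp1 (phi : R -> R) f p v (d : R) : is_derive (f p) 1 phi d ->
  differentiable f p ->
  differentiable (fun q => phi (f q)) p /\ 'D_v (fun q => phi (f q)) p = d * 'D_v f p.
Proof.
move=> Hphi df; split.
  apply: (@differentiable_comp _ _ _ _ f phi) => //.
  by case: Hphi => /derivable1_diffP.
have Hf := @derivableP _ _ _ f p v (@diff_derivable _ _ _ f p v df).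
by have [_ <-] := is_derive_comp1 Hphi Hf.
Qed.

Lemma CkV k f : (forall p, U p -> f p != 0) -> Ck U k f -> Ck U k (fun p => (f p)^-1).
Proof.
move=> f0; elim/ltn_ind: k f f0 => k IH f f0 cf.
have df p (Up : U p) := Ck_differentiable cf Up.
apply: Ck_intro => [p Up|m i mk]; first by apply: differentiableV; [exact: df|exact: f0].
have cI := IH m mk f f0 (Ck_le (ltnW mk) cf).
apply: (Ck_eq _ (CkN (CkM (CkM cI cI) (Ck_pd i mk cf)))) => p Up.
apply: etrans (esym (deriveV _ (diff_derivable _))); [|exact: f0|exact: df].
by rewrite -mulNr -expr2 -exprVn.
Qed.

Lemma Ck_expR k f : Ck U k f -> Ck U k (fun p => expR (f p)).
Proof.
elim/ltn_ind: k f => k IH f cf; have df p (Up : U p) := Ck_differentiable cf Up.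
apply: Ck_intro => [p Up|m i mk].
  by have [] := derive_comp1 0 (is_derive_expR (f p)) (df _ Up).
apply: (Ck_eq _ (CkM (IH m mk _ (Ck_le (ltnW mk) cf)) (Ck_pd i mk cf))) => p Up.
by rewrite /pd; have [_ ->] := derive_comp1 (bvec i) (is_derive_expR (f p)) (df _ Up).
Qed.

(** Proved jointly, because differentiation exchanges the two functions. *)
Lemma Ck_trig k f : Ck U k f ->
  Ck U k (fun p => cos (f p)) /\ Ck U k (fun p => sin (f p)).
Proof.
elim/ltn_ind: k f => k IH f cf; have df p (Up : U p) := Ck_differentiable cf Up.
split; apply: Ck_intro => [p Up|m i mk].
- by have [] := derive_comp1 0 (is_derive_cos (f p)) (df _ Up).
- have [_ IHs] := IH m mk _ (Ck_le (ltnW mk) cf).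
  apply: (Ck_eq _ (CkM (CkN IHs) (Ck_pd i mk cf))) => p Up.
  by rewrite /pd; have [_ ->] := derive_comp1 (bvec i) (is_derive_cos (f p)) (df _ Up).
- by have [] := derive_comp1 0 (is_derive_sin (f p)) (df _ Up).
- have [IHc _] := IH m mk _ (Ck_le (ltnW mk) cf).
  apply: (Ck_eq _ (CkM IHc (Ck_pd i mk cf))) => p Up.
  by rewrite /pd; have [_ ->] := derive_comp1 (bvec i) (is_derive_sin (f p)) (df _ Up).
Qed.

Lemma Ck_ln k f : (forall p, U p -> 0 < f p) -> Ck U k f -> Ck U k (fun p => ln (f p)).
Proof.
move=> f0 cf; have df p (Up : U p) := Ck_differentiable cf Up.
apply: Ck_intro => [p Up|m i mk].
  by have [] := derive_comp1 0 (is_derive1_ln (f0 _ Up)) (df _ Up).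
have fn0 p : U p -> f p != 0 by move=> /f0; rewrite lt0r => /andP[].
apply: (Ck_eq _ (CkM (CkV fn0 (Ck_le (ltnW mk) cf)) (Ck_pd i mk cf))) => p Up.
by rewrite /pd; have [_ ->] := derive_comp1 (bvec i) (is_derive1_ln (f0 _ Up)) (df _ Up).
Qed.

End Ck.

(** * Chain rule for maps between spaces of row vectors *)

Section Composition.
Context {R : realType} {m n : nat}.
Implicit Types (G : 'rV[R]_m -> 'rV[R]_n) (f : 'rV[R]_n -> R) (p v : 'rV[R]_m).

Lemma differentiable_rowfun G p : (forall k, differentiable (fun q => G q 0 k) p) ->
  differentiable G p.
Proof.
move=> dG.
have -> : G = \sum_(k < n) (fun q => G q 0 k *: (bvec k : 'rV[R]_n)).
  apply/funext => q; rewrite [LHS]rV_eq_sum fct_sumE //.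
by apply: differentiable_sum => k; exact: differentiableZl.
Qed.

Lemma derive_rowfun G p v : (forall k, differentiable (fun q => G q 0 k) p) ->
  forall k, 'D_v G p 0 k = 'D_v (fun q => G q 0 k) p.
Proof.
move=> dG k; rewrite derive_mx ?mxE //.
exact/diff_derivable/differentiable_rowfun.
Qed.

Lemma derive_comp_rowfun f G p v : (forall k, differentiable (fun q => G q 0 k) p) ->
  differentiable f (G p) ->
  differentiable (fun q => f (G q)) p /\
  'D_v (fun q => f (G q)) p = \sum_k 'D_v (fun q => G q 0 k) p * pd k f (G p).
Proof.
move=> dG df; have dGp := differentiable_rowfun dG.
have dfG : differentiable (f \o G) p by exact: differentiable_comp.
split=> //; rewrite (deriveE _ dfG) diff_comp //= -deriveE // -deriveE //.
by rewrite derive_pd //; apply: eq_bigr => k _; rewrite derive_rowfun.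
Qed.

Lemma Ck_comp (U : set 'rV[R]_m) (W : set 'rV[R]_n) k f G : open U ->
  (forall p, U p -> W (G p)) ->
  (forall i, Ck U k (fun p => G p 0 i)) -> Ck W k f -> Ck U k (fun p => f (G p)).
Proof.
move=> Uo UW; elim/ltn_ind: k f => k IH f cG cf.
have dG p (Up : U p) i := Ck_differentiable (cG i) Up.
have df q (Wq : W q) := Ck_differentiable cf Wq.
apply: Ck_intro => [p Up|l i lk].
  exact: (derive_comp_rowfun 0 (dG _ Up) (df _ (UW _ Up))).1.
have cpd j : Ck U l (fun p => pd j f (G p)).
  apply: IH => //; last exact: Ck_pd cf.
  by move=> i'; apply: Ck_le (cG i'); exact: ltnW.
apply: (Ck_eq Uo _ (Ck_sum Uo _ (fun j => CkM Uo (Ck_pd i lk (cG j)) (cpd j)))) => p Up.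
by rewrite [RHS](derive_comp_rowfun (bvec i) (dG _ Up) (df _ (UW _ Up))).2.
Qed.

End Composition.

Section MatrixFunctions.
Context {R : realType} {n : nat} (U : set 'rV[R]_n) (U_open : open U).

Lemma Ck_det k m (A : 'rV[R]_n -> 'M[R]_m) : (forall i j, Ck U k (fun p => A p i j)) ->
  Ck U k (fun p => \det (A p)).
Proof.
move=> cA; apply: (Ck_sum U_open) => s; apply: (CkM U_open); first exact: Ck_cst.
exact: (Ck_prod U_open).
Qed.

(** By Cramer's rule the entries are cofactors divided by the determinant. *)
Lemma Ck_invmx k m (A : 'rV[R]_n -> 'M[R]_m) : (forall i j, Ck U k (fun p => A p i j)) ->
  (forall p, U p -> A p \in unitmx) ->
  forall i j, Ck U k (fun p => invmx (A p) i j).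
Proof.
move=> cA uA i j.
apply: (@Ck_eq _ _ _ U_open _ (fun p => (\det (A p))^-1 * cofactor (A p) j i)).
  by move=> q Uq; rewrite /invmx uA // !mxE.
apply: (CkM U_open).
  apply: (CkV U_open); last exact: Ck_det.
  by move=> p /uA; rewrite unitmxE unitfE.
apply: (CkM U_open); first exact: Ck_cst.
apply: Ck_det => a b; apply: (Ck_eq U_open _ (cA (lift j a) (lift i b))) => q _.
by rewrite !mxE.
Qed.

Lemma near_bounded (f : 'rV[R]_n -> R) p : {for p, continuous f} ->
  \forall q \near p, `|f q| <= `|f p| + 1.
Proof.
move=> /cvgrPdist_lt /(_ 1 ltr01); apply: filterS => q.
by move=> H; rewrite -lerBlDl (le_trans (lerB_dist _ _)) // distrC ltW.
Qed.

End MatrixFunctions.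

(** Rows are indexed by directions, in keeping with row vectors: [v *m jac F p] is the derivative of
    [F] along [v]. *)
Definition jac (R : realType) (m n : nat) (F : 'rV[R]_m -> 'rV[R]_n) (p : 'rV[R]_m) :
  'M[R]_(m, n) := \matrix_(i, k) pd i (fun q => F q 0 k) p.

Section InverseFunction.
Context {R : realType} {n : nat}.

Lemma norm_mulmx_le (v : 'rV[R]_n) m (B : 'M[R]_(n, m)) (K : R) :
  0 <= K -> (forall i j, `|B i j| <= K) -> `|v *m B| <= n%:R * K * `|v|.
Proof.
move=> K0 BK; apply: norm_rV_le => [|j]; first by rewrite !mulr_ge0.
by rewrite mxE; apply: norm_sum_rV_le => i.
Qed.

Lemma matrix_bounded m l (B : 'M[R]_(m, l)) :
  exists2 K : R, 0 <= K & forall i j, `|B i j| <= K.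
Proof.
exists `|B| => // i j.
rewrite [leRHS]/Num.norm /= mx_normrE; apply/bigmax_geP; right => /=.
by exists (i, j).
Qed.

End InverseFunction.

(** * The inverse function theorem *)

Section InverseFunction.
Context {R : realType} {n : nat}.
Implicit Types (F G : 'rV[R]_n -> 'rV[R]_n) (p q : 'rV[R]_n).

Lemma Ck_continuous (U : set 'rV[R]_n) k (f : 'rV[R]_n -> R) p :
  Ck U k f -> U p -> {for p, continuous f}.
Proof. by move=> cf Up; apply: differentiable_continuous; exact: Ck_differentiable cf Up. Qed.

Lemma det_near_neq0 (U : set 'rV[R]_n) (A : 'rV[R]_n -> 'M[R]_n) p : open U -> U p ->
  (forall i j, Ck U 0 (fun q => A q i j)) -> A p \in unitmx ->
  \forall q \near p, A q \in unitmx.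
Proof.
move=> Uo Up cA; rewrite unitmxE unitfE => A0.
have /cvgrPdist_lt /(_ `|\det (A p)|) := Ck_continuous (Ck_det Uo cA) Up.
rewrite normr_gt0 => /(_ A0); apply: filterS => q Hq.
by rewrite unitmxE unitfE; apply: contraTneq Hq => ->; rewrite subr0 ltxx.
Qed.

(* The Banach iteration is avoided: a point of a closed ball where [|T q - q|] is
   minimal has to be a fixed point. *)
Lemma contraction_fixed_point (T : 'rV[R]_n -> 'rV[R]_n) p (r : R) : 0 <= r ->
  (forall q, `|q - p| <= r -> {for q, continuous T}) ->
  (forall q, `|q - p| <= r -> `|T q - p| <= r) ->
  (forall q q', `|q - p| <= r -> `|q' - p| <= r -> `|T q - T q'| <= 2^-1 * `|q - q'|) ->
  exists2 q, `|q - p| <= r & T q = q.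
Proof.
move=> r0 cT Tr Tc.
pose A := [set q : 'rV[R]_n | `|q - p| <= r].
have nA : continuous (fun q : 'rV[R]_n => `|q - p|).
  move=> q; have cB : (fun q : 'rV[R]_n => q - p) q' @[q' --> q] --> q - p.
    have ci : (id : 'rV[R]_n -> 'rV[R]_n) q' @[q' --> q] --> q by exact: cvg_id.
    exact: (@cvgB _ _ _ _ _ id (cst p) q p ci (cvg_cst p)).
  exact: cvg_norm cB.
have cA : compact A.
  apply: bounded_closed_compact.
    exists (r + `|p|); split; first exact: num_real.
    move=> x rx q Aq; apply: le_trans (ltW rx).
    by rewrite -{1}(subrK p q) (le_trans (ler_normD _ _)) // lerD.
  by apply: (@preimage_closed _ _ (fun q : 'rV[R]_n => `|q - p|) _ _ (@closed_le R r)) => q _; exact: nA.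
have cTn : {within A, continuous (fun q => `|T q - q|)}.
  apply: continuous_in_subspaceT => q; rewrite inE => Aq.
  have cB : (fun q : 'rV[R]_n => T q - q) q' @[q' --> q] --> T q - q.
    have ci : (id : 'rV[R]_n -> 'rV[R]_n) q' @[q' --> q] --> q by exact: cvg_id.
    exact: (@cvgB _ _ _ _ _ T id (T q) q (cT _ Aq) ci).
  exact: cvg_norm cB.
have [|q Aq Tmin] := EVT_min_rV _ cA cTn.
  by exists p; rewrite /A /= subrr normr0.
rewrite inE in Aq.
exists q => //; apply/eqP; rewrite -subr_eq0 -normr_le0.
have := Tmin (T q); rewrite inE => /(_ (Tr _ Aq)) /le_trans /(_ (Tc _ _ (Tr _ Aq) Aq)).
lra.
Qed.

Lemma near_bounded_family (I : finType) (f : I -> 'rV[R]_n -> R) p :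
  (forall i, {for p, continuous (f i)}) ->
  exists2 K : R, 0 <= K & \forall q \near p, forall i, `|f i q| <= K.
Proof.
move=> cf; exists (\sum_i (`|f i p| + 1)); first by apply: sumr_ge0 => i _; rewrite addr_ge0.
apply: (@filter_forall _ I (fun i q => `|f i q| <= _) (nbhs p)) => i; apply: filterS (near_bounded (cf i)) => q /le_trans; apply.
by rewrite (bigD1 i) //= lerDl; apply: sumr_ge0 => j _; rewrite addr_ge0.
Qed.

Lemma derive_mulmx m F (B : 'M[R]_(n, m)) p v k :
  (forall l, differentiable (fun q => F q 0 l) p) ->
  is_derive p v (fun q => (F q *m B) 0 k) (\sum_l 'D_v (fun q => F q 0 l) p * B l k).
Proof.
move=> dF.
have -> : (fun q => (F q *m B) 0 k) = \sum_(l < n) (fun q => F q 0 l * B l k).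
  by apply/funext => q; rewrite mxE fct_sumE.
apply: is_derive_sum => l.
have D : is_derive p v (fun q => F q 0 l) ('D_v (fun q => F q 0 l) p).
  exact/derivableP/diff_derivable.
apply: is_derive_eq (is_deriveM D (is_derive_cst (B l k) p v)) _.
by rewrite scaler0 add0r [LHS]mulrC.
Qed.

Lemma Ck_sub (U W : set 'rV[R]_n) k (f : 'rV[R]_n -> R) : W `<=` U -> Ck U k f -> Ck W k f.
Proof.
move=> WU; elim/ltn_ind: k f => k IH f cf; apply: Ck_intro => [q /WU|m i mk].
  exact: Ck_differentiable cf.
exact: IH mk _ (Ck_pd i mk cf).
Qed.

(** The derivatives of [G] are smooth functions of [G] itself, so each order of regularity of [G]
    yields the next. *)
Lemma Ck_bootstrap l (U : set 'rV[R]_n) (W : set 'rV[R]_l) (G : 'rV[R]_n -> 'rV[R]_l)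
    (Q : 'I_n -> 'I_l -> 'rV[R]_l -> R) : open U ->
  (forall p, U p -> W (G p)) ->
  (forall k p, U p -> differentiable (fun q => G q 0 k) p) ->
  (forall i k p, U p -> pd i (fun q => G q 0 k) p = Q i k (G p)) ->
  (forall m i k, Ck W m (Q i k)) ->
  forall m k, Ck U m (fun q => G q 0 k).
Proof.
move=> Uo UW dG pdG cQ m; elim/ltn_ind: m => m IH k; apply: Ck_intro => [p|m' i mm'].
  exact: dG.
apply: (Ck_eq Uo _ (Ck_comp Uo UW (IH _ mm') (cQ m' i k))) => q Uq.
by rewrite pdG.
Qed.

(** Newton's method with the inverse Jacobian [B] frozen at p: solutions of F q = y are the fixed
    points of [Phi q + y *m B], whose differential vanishes at p. Near p this is a contraction with
    factor 1/2, and the same estimate makes [F] injective with Lipschitz inverse. *)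
Lemma inverse_function (U : set 'rV[R]_n) F p : open U -> smooth_map U F -> U p ->
  jac F p \in unitmx ->
  exists (V V' : set 'rV[R]_n) G,
    [/\ [/\ open V, V p, V `<=` U & open V'],
        smooth_map V' G,
        forall q, V q -> V' (F q) /\ G (F q) = q &
        forall y, V' y -> V (G y) /\ F (G y) = y].
Proof.
move=> Uo sF Up uJ.
have cF m k : Ck U m (fun q => F q 0 k) by exact: (smooth_onP _ _).1 (sF k) m.
have dF q (Uq : U q) k := Ck_differentiable (cF 0%N k) Uq.
pose B := invmx (jac F p).
have [KB KB0 BK] := matrix_bounded B.
pose CB := n%:R * KB.
have CB0 : 0 <= CB by rewrite mulr_ge0.
have CBP (v : 'rV[R]_n) : `|v *m B| <= CB * `|v| by exact: norm_mulmx_le.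
pose Phi q := q - F q *m B.
have cPhi m k : Ck U m (fun q => Phi q 0 k).
  apply: (Ck_eq Uo _ (CkB Uo (Ck_coord Uo m k)
    (Ck_sum Uo (index_enum 'I_n) (fun l => CkM Uo (cF m l) (Ck_cst Uo m (B l k)))))) => q _.
  by rewrite !mxE.
have dPhi0 i k : pd i (fun q => Phi q 0 k) p = 0.
  have D1 : is_derive p (bvec i) (fun q : 'rV[R]_n => q 0 k) ((bvec i : 'rV[R]_n) 0 k).
    apply: DeriveDef; first exact/diff_derivable/differentiable_coord.
    have /matrixP/(_ 0 k) := derive_mx (@derivable_id R 'rV[R]_n p (bvec i)).
    by rewrite derive_id [X in _ = X -> _]mxE => ->.
  have D2 := @derive_mulmx n F B p (bvec i) k (dF _ Up).
  have -> : (fun q => Phi q 0 k) = (fun q : 'rV[R]_n => q 0 k) - (fun q => (F q *m B) 0 k).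
    by apply/funext => q; rewrite !fctE !mxE.
  rewrite /pd (derive_val (is_derive := is_deriveB D1 D2)).
  have /matrixP/(_ i k) := mulmxV uJ; rewrite !mxE eqxx /= eq_sym => <-.
  by apply/eqP; rewrite subr_eq0; apply/eqP/eq_bigr => l _; rewrite mxE.
(* With [n.+1] the constant is positive even for n = 0, and n K <= 1/2 is the Lipschitz constant
   wanted for [Phi]. *)
pose K : R := (2 * n.+1%:R)^-1.
have K0 : 0 < K by rewrite invr_gt0 mulr_gt0.
have nK : n%:R * K <= 2^-1.
  by rewrite /K invfM mulrCA ler_piMr // ler_pdivrMr // mul1r ler_nat.
pose I3 := ('I_n * 'I_n * 'I_n)%type.
have c2F (x : I3) : {for p, continuous (pd x.1.2 (pd x.1.1 (fun q => F q 0 x.2)))}.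
  apply: (@Ck_continuous U 0%N) => //.
  exact: Ck_pd (ltnSn 0) (Ck_pd _ (ltnSn 1) (cF 2 x.2)).
have [K2 K20 nK2] := near_bounded_family c2F.
have cdPhi (x : 'I_n * 'I_n) : {for p, continuous (pd x.1 (fun q => Phi q 0 x.2))}.
  by apply: (@Ck_continuous U 0%N) => //; exact: Ck_pd (ltnSn 0) (cPhi 1%N x.2).
have nPhi : \forall q \near p, forall x : 'I_n * 'I_n,
    `|pd x.1 (fun q => Phi q 0 x.2) q| <= K.
  apply: (@filter_forall _ _ (fun (x : 'I_n * 'I_n) q => `|pd x.1 (fun q => Phi q 0 x.2) q| <= K) (nbhs p)) => x.
  have /cvgrPdist_lt /(_ _ K0) := cdPhi x; apply: filterS => q.
  by rewrite dPhi0 sub0r normrN => /ltW.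
have cJ i k : Ck U 0 (fun q => jac F q i k).
  apply: (Ck_eq Uo _ (Ck_pd i (ltnSn 0) (cF 1%N k))) => q _.
  by rewrite mxE.
have nJ := det_near_neq0 Uo Up cJ uJ.
have [r r0 Hr] := near_ball (filterI (filterI (near_open Uo Up) nPhi) (filterI nJ nK2)).
have rU q : ball p r q -> U q by move=> /Hr [[]].
have PhiL q q' : ball p r q -> ball p r q' -> `|Phi q' - Phi q| <= 2^-1 * `|q' - q|.
  move=> Hq Hq'; apply: norm_rV_le => [|k]; first by rewrite mulr_ge0.
  have qq' : q + (q' - q) = q' by apply/rowP => l; rewrite !mxE; ring.
  have -> : (Phi q' - Phi q) 0 k = Phi (q + (q' - q)) 0 k - Phi q 0 k.
    by rewrite qq' !mxE.
  apply: (le_trans (@lipschitz_pd _ _ (fun q => Phi q 0 k) p r K q (q' - q) _ _ Hq _)).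
  - by move=> q1 /rU; exact: Ck_differentiable (cPhi 0%N k).
  - by move=> i q1 /Hr [[_ /(_ (i, k))]].
  - by rewrite qq'.
  - by rewrite ler_wpM2r.
have Finv q q' : ball p r q -> ball p r q' -> `|q' - q| <= 2 * (CB * `|F q' - F q|).
  move=> Hq Hq'; have := PhiL _ _ Hq Hq'.
  have -> : Phi q' - Phi q = (q' - q) - (F q' - F q) *m B.
    by rewrite /Phi mulmxBl; apply/rowP => k; rewrite !mxE; ring.
  have := CBP (F q' - F q); have := lerB_dist (q' - q) ((F q' - F q) *m B).
  move: `|q' - q| `|(F q' - F q) *m B| (CB * _) => x y z; lra.
(* This makes [(y - F p) *m B] shorter than r/8. Then [T] sends the closed ball of radius 3r/8 to
   distance at most 3r/16 + r/8 < 3r/8 from p. *)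
pose delta := r / 8 / (CB + 1).
have CB1 : 0 < CB + 1 by rewrite ltr_wpDl.
have delta0 : 0 < delta by rewrite !divr_gt0.
pose V' := ball (F p) delta.
pose V := [set q | ball p (r / 2) q /\ V' (F q)].
have r2 q : ball p (r / 2) q -> ball p r q.
  by rewrite !ball_norm => /lt_trans; apply; move: (r0 : 0 < r); lra.
have pp (s : R) : 0 < s -> ball p s p by move=> s0; rewrite ball_norm subrr normr0.
(* A preimage selected by choice; [Finv] shows that it is unique in the ball. *)
pose G y := xget p [set q | ball p (r / 2) q /\ F q = y].
have GP y : V' y -> ball p (r / 2) (G y) /\ F (G y) = y.
  move=> Vy; suff : exists q, ball p (r / 2) q /\ F q = y.
    by move=> Eq; have := @xgetPex _ p [set q | ball p (r / 2) q /\ F q = y] Eq.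
  have yB : `|(y - F p) *m B| < r / 8.
    apply: le_lt_trans (CBP _) _.
    have : `|y - F p| < delta by rewrite -ball_norm.
    rewrite /delta ltr_pdivlMr // => /le_lt_trans; apply.
    by rewrite [CB * _]mulrC ler_wpM2l // lerDl.
  have rr q : `|q - p| <= 3 / 8 * r -> ball p r q.
    by rewrite ball_norm => /le_lt_trans; apply; move: (r0 : 0 < r); lra.
  pose T q := Phi q + y *m B.
  have TB q q' : T q - T q' = Phi q - Phi q'.
    by apply/rowP => k; rewrite !mxE; ring.
  have [||q Hq|q q' Hq Hq'|q Hq Tq] := @contraction_fixed_point T p (3 / 8 * r).
  - by move: (r0 : 0 < r); lra.
  - move=> q /rr /rU Uq; apply: differentiable_continuous.
    apply: differentiable_rowfun => k.
    have -> : (fun q => T q 0 k) = (fun q => Phi q 0 k) + cst ((y *m B) 0 k).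
      by apply/funext => q'; rewrite !fctE !mxE.
    by apply: differentiableD => //; exact: Ck_differentiable (cPhi 0%N k) Uq.
  - have -> : T q - p = (Phi q - Phi p) + (y - F p) *m B.
      by rewrite mulmxBl; apply/rowP => k; rewrite !mxE; ring.
    apply: le_trans (ler_normD _ _) _.
    have := PhiL _ _ (pp _ r0) (rr _ Hq); move: Hq yB.
    by move: `|q - p| `|Phi q - Phi p| `|_ *m B| => x y' z; lra.
  - by rewrite TB; exact: PhiL (rr _ Hq') (rr _ Hq).
  exists q; split.
    by rewrite ball_norm (le_lt_trans Hq) //; move: (r0 : 0 < r); lra.
  have E : F q *m B = y *m B.
    by move: Tq; rewrite /T /Phi => /(congr1 (fun z => z - q + F q *m B)) /rowP E;
      apply/rowP => k; have := E k; rewrite !mxE => Ek; lra.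
  by have := congr1 (mulmx^~ (jac F p)) E; rewrite -!mulmxA mulVmx // !mulmx1.
have Vo : open V.
  rewrite openE => q [Hq VFq]; rewrite /interior.
  have cFq : {for q, continuous F}.
    by apply/differentiable_continuous/differentiable_rowfun => k; exact/dF/rU/r2.
  have n1 : \forall q' \near q, ball p (r / 2) q'.
    by apply: open_nbhs_nbhs; split => //; exact: ball_open.
  have n2 : \forall q' \near q, V' (F q').
    apply: (cFq V'); apply: open_nbhs_nbhs; split => //; exact: ball_open.
  exact: filterI n1 n2.
have V'o : open V' by exact: ball_open.
exists V, V', G; split.
- split=> //; first by split; [exact: pp (divr_gt0 r0 _)|exact: ballxx].
  by move=> q [/r2 /rU].
- have Wo : open (ball p r) by exact: ball_open.
  have WG y : V' y -> ball p r (G y) by move=> /GP [/r2].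
  have cQ m i k : Ck (ball p r) m (fun q => invmx (jac F q) i k).
    apply: (Ck_invmx Wo) => [a b|q /Hr [_ []] //].
    apply: (Ck_eq Wo _ (Ck_sub rU (Ck_pd a (ltnSn m) (cF m.+1 b)))) => q _.
    by rewrite mxE.
  (* With [w] the increment of [G] and [e] the Taylor remainder of [F], the error of the linear
     approximation is [- e *m invmx (jac F q)]. It is quadratic in v because |w| <= 2 CB |v|. *)
  have dG k y : V' y -> differentiable (fun y => G y 0 k) y /\
      forall v, 'D_v (fun y => G y 0 k) y = \sum_i v 0 i * invmx (jac F (G y)) i k.
    move=> V'y; have [Hg Fg] := GP _ V'y.
    have [KQ KQ0 QK] := matrix_bounded (invmx (jac F (G y))).
    apply: (quadratic_differentiable (C := n%:R * KQ * (n%:R * (n%:R * K2) * (2 * CB) ^+ 2))).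
    have nV : \forall v \near (0 : 'rV[R]_n), V' (v + y).
      by have := near_open V'o V'y; rewrite (near_shift 0 y) /= subr0.
    apply: filterS nV => v V'v; have [Hg' Fg'] := GP _ V'v.
    set q := G y in Hg Fg *; set q' := G (v + y) in Hg' Fg' *.
    pose w := q' - q; pose e := v - w *m jac F q.
    have qw : q + w = q' by apply/rowP => l; rewrite !mxE; ring.
    have wv : `|w| <= 2 * CB * `|v|.
      by have := Finv _ _ (r2 _ Hg) (r2 _ Hg'); rewrite Fg Fg' addrK mulrA.
    have eK : `|e| <= n%:R * (n%:R * K2 * `|w|) * `|w|.
      apply: norm_rV_le => [|k']; first by rewrite !mulr_ge0.
      have -> : e 0 k' = F (q + w) 0 k' - F q 0 k' - \sum_i w 0 i * pd i (fun q => F q 0 k') q.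
        rewrite qw Fg Fg' /e !mxE addrK; congr (_ - _).
        by apply: eq_bigr => i _; rewrite !mxE.
      apply: (@taylor2_pd _ _ (fun q => F q 0 k') p r K2).
      - by move=> q1 /rU; exact: Ck_differentiable (cF 0%N k').
      - by move=> i q1 /rU; exact: Ck_differentiable (Ck_pd i (ltnSn 0) (cF 1%N k')).
      - by move=> i j q1 /Hr [_ [_ /(_ (i, j, k'))]].
      - exact: r2.
      - by rewrite qw; exact: r2.
    have -> : q' 0 k - q 0 k - \sum_i v 0 i * invmx (jac F q) i k = - (e *m invmx (jac F q)) 0 k.
      have uJq : jac F q \in unitmx by have [_ []] := Hr _ (r2 _ Hg).
      rewrite /e mulmxBl mulmxK // /w !mxE; ring.
    rewrite normrN; apply: le_trans (ler_coord_norm _ _) _.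
    apply: le_trans (norm_mulmx_le _ KQ0 QK) _.
    have wv2 : `|w| ^+ 2 <= (2 * CB) ^+ 2 * `|v| ^+ 2.
      by rewrite -exprMn ler_sqr ?nnegrE ?mulr_ge0.
    have assoc (s1 s2 s3 : R) : s1 * (s1 * s2 * s3) * s3 = s1 * (s1 * s2) * s3 ^+ 2 by ring.
    rewrite -[leRHS]mulrA ler_wpM2l ?mulr_ge0 //.
    apply: le_trans eK _; rewrite assoc -[leRHS]mulrA.
    by apply: ler_wpM2l => //; rewrite !mulr_ge0.
  move=> k; apply/smooth_onP => m.
  apply: (Ck_bootstrap V'o WG (fun k y Vy => (dG k y Vy).1) _ cQ) => i k' y V'y.
  rewrite /pd (dG k' y V'y).2 (bigD1 i) //= big1 ?addr0 => [|j ji].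
    by rewrite !mxE !eqxx mul1r.
  by rewrite !mxE eqxx (negbTE ji) mul0r.
- move=> q [Hq VFq]; split=> //; have [Hg Fg] := GP _ VFq.
  apply/eqP; rewrite -subr_eq0 -normr_le0.
  by have := Finv _ _ (r2 _ Hq) (r2 _ Hg); rewrite Fg subrr normr0 !mulr0.
- by move=> y V'y; have [Hg Fg] := GP _ V'y; split=> //; split; rewrite ?Fg.
Qed.

End InverseFunction.

(** * Linear differential equations and flat connections *)

Section LinearODE.
Context {R : realType}.

(** The intervals of centre [u n] and radius D / 2^n are nested, and the supremum of their left ends
    lies in all of them. *)
Lemma geometric_limit (u : nat -> R) (D : R) :
  (forall n, `|u n.+1 - u n| <= D / 2 ^+ n.+1) ->
  exists l : R, forall n, `|l - u n| <= D / 2 ^+ n.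
Proof.
move=> Hu.
have D0 : 0 <= D.
  have := le_trans (normr_ge0 _) (Hu 0%N); rewrite expr1; lra.
have step n : D / 2 ^+ n = D / 2 ^+ n.+1 + D / 2 ^+ n.+1.
  have : (2 : R) ^+ n != 0 by rewrite expf_neq0.
  by rewrite exprS; move: (2 ^+ n) => x x0; field.
have lo n m : u n - D / 2 ^+ n <= u (n + m)%N - D / 2 ^+ (n + m).
  elim: m => [|m IH]; first by rewrite addn0.
  apply: le_trans IH _; rewrite addnS.
  have := Hu (n + m)%N; rewrite ler_norml => /andP[h _].
  rewrite (step (n + m)%N); move: h; move: (u _) (u _) (D / _) => x y z; lra.
have hi n m : u (n + m)%N + D / 2 ^+ (n + m) <= u n + D / 2 ^+ n.
  elim: m => [|m IH]; first by rewrite addn0.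
  apply: le_trans IH; rewrite addnS.
  have := Hu (n + m)%N; rewrite ler_norml => /andP[_ h].
  rewrite (step (n + m)%N); move: h; move: (u _) (u _) (D / _) => x y z; lra.
have lohi n m : u n - D / 2 ^+ n <= u m + D / 2 ^+ m.
  have Dn k : 0 <= D / 2 ^+ k by rewrite divr_ge0 // exprn_ge0.
  apply: (le_trans (lo n m)); rewrite addnC; apply: le_trans (hi m n).
  by rewrite lerD2l (le_trans _ (Dn _)) // oppr_le0.
pose A := [set u n - D / 2 ^+ n | n in [set: nat]].
have supA : has_sup A.
  split; first by exists (u 0%N - D / 2 ^+ 0); exists 0%N.
  by exists (u 0%N + D / 2 ^+ 0) => _ [n _ <-].
exists (sup A) => n; rewrite ler_norml; apply/andP; split.
  have := sup_upper_bound supA; move=> /(_ (u n - D / 2 ^+ n)) /(_ (ex_intro2 _ _ n I erefl)).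
  by move: (sup A) (u n) (D / _) => x y z; lra.
have := @ge_sup _ A (u n + D / 2 ^+ n) supA.1 => /(_ _).
by rewrite lerBlDl => -> // _ [m _ <-].
Qed.

Lemma antiderivative (f : R -> R) : continuous f ->
  exists F : R -> R, forall x : R, 0 <= x <= 1 -> is_derive x 1 F (f x).
Proof.
move=> cf.
(* Integrating over [-1, 2] keeps [0, 1] in the interior, so that the derivatives at 0 and 1 are
   two-sided. *)
have fi : (@lebesgue_measure R).-integrable `[-1, 2] (EFin \o f).
  apply: continuous_compact_integrable; first exact: segment_compact.
  exact: continuous_subspaceT.
exists (fun x => (\int[@lebesgue_measure R]_(t in [set` `[-1, x]]) (f t))%R) => x /andP[x0 x1].
have [|||dF Ff] := @continuous_FTC1_closed R f (-1) x 2 _ fi.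
- by apply: le_lt_trans x1 _; rewrite ltr1n.
- by apply: lt_le_trans x0; rewrite oppr_lt0.
- exact: cf.
by apply: DeriveDef; [exact: dF|rewrite -derive1E; exact: Ff].
Qed.

(** The retraction of the line onto [0, 1], written with absolute values so that continuity is
    immediate. It extends functions controlled only on [0, 1] to continuous functions on the
    line. *)
Definition clamp (s : R) : R := (1 + `|s| - `|s - 1|) / 2.

Lemma clampE s : 0 <= s <= 1 -> clamp s = s.
Proof.
move=> /andP[s0 s1]; rewrite /clamp ger0_norm // ler0_norm ?subr_le0 //; lra.
Qed.

Lemma clamp01 s : 0 <= clamp s <= 1.
Proof.
rewrite /clamp; have [s0|s0] := lerP 0 s; have [s1|s1] := lerP s 1;
  by rewrite ?(ger0_norm s0) ?(ltr0_norm s0); apply/andP; split; lra.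
Qed.

Lemma continuous_clamp : continuous clamp.
Proof.
move=> s; rewrite /clamp; apply: cvgM; last exact: cvg_cst.
apply: cvgB; last first.
  by apply: cvg_norm; apply: cvgB; [exact: cvg_id|exact: cvg_cst].
by apply: cvgD; [exact: cvg_cst|apply: cvg_norm; exact: cvg_id].
Qed.

Context {N : nat}.
Implicit Types (phi psi : R -> 'rV[R]_N) (M : R -> 'M[R]_N) (c : 'rV[R]_N).

Lemma mulmx_half (v : 'rV[R]_N) (B : 'M[R]_N) k : (forall k, \sum_l `|B l k| <= 2^-1) ->
  `|(v *m B) 0 k| <= 2^-1 * `|v|.
Proof.
move=> HB; rewrite mxE (le_trans (ler_norm_sum _ _ _)) //.
apply: (@le_trans _ _ (\sum_l `|v| * `|B l k|)).
  by apply: ler_sum => l _; rewrite normrM ler_wpM2r // ler_coord_norm.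
by rewrite -mulr_sumr mulrC ler_wpM2r.
Qed.

Lemma gronwall_half (P d : R -> 'rV[R]_N) (e : R) :
  (forall k (s : R), 0 <= s <= 1 -> is_derive s 1 (fun t => P t 0 k) (d s 0 k)) ->
  (forall k s, 0 <= s <= 1 -> `|d s 0 k| <= 2^-1 * `|P s| + e) ->
  0 <= e -> P 0 = 0 -> forall s, 0 <= s <= 1 -> `|P s| <= 2 * e.
Proof.
move=> HP Hd e0 P0.
have cP : {within `[0, 1], continuous (fun s => `|P s|)}.
  apply: continuous_in_subspaceT => s; rewrite inE /= in_itv /= => s01.
  have : {for s, continuous P}.
    apply/differentiable_continuous/derivable1_diffP/derivable_mxP => i k.
    by rewrite ord1; have [] := HP k s s01.
  by move=> cPs; exact: cvg_norm cPs.
have [m + Pm] := EVT_max ler01 cP.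
rewrite in_itv /= => m01.
have e1 : 0 <= 2^-1 * `|P m| + e by rewrite addr_ge0 // mulr_ge0.
suff : `|P m| <= 2^-1 * `|P m| + e.
  move=> h s s01; have := Pm s; rewrite in_itv /= => /(_ s01) => h2.
  by move: h h2; move: `|P m| `|P s| => x y; lra.
apply: norm_rV_le => // k.
have [xi xi01] := mean_value01 (HP k) m01; rewrite P0 mxE subr0 => ->.
have /andP[m0 m1] := m01.
rewrite normrM (ger0_norm m0); apply: le_trans (ler_piMr (normr_ge0 _) m1) _.
apply: le_trans (Hd k xi xi01) _; rewrite lerD2r ler_wpM2l //.
by apply: Pm; rewrite in_itv.
Qed.

(** * Picard iteration for a linear equation on the unit interval *)

Section Picard.
Variables (M : R -> 'M[R]_N) (c : 'rV[R]_N).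
Hypothesis M_continuous : forall i j, continuous (fun s => M s i j).
Hypothesis M_half : forall s k, \sum_l `|M s l k| <= 2^-1.

Let step phi psi := psi 0 = c /\ forall k (s : R), 0 <= s <= 1 ->
  is_derive s 1 (fun t => psi t 0 k) ((phi s *m M s) 0 k).

Let continuous_coords phi := forall k, continuous (fun t => phi t 0 k).

Let step_exists phi : continuous_coords phi -> exists psi, step phi psi.
Proof.
move=> cphi.
have cf k : continuous (fun s => (phi s *m M s) 0 k).
  have -> : (fun s => (phi s *m M s) 0 k) = (fun s => \sum_l phi s 0 l * M s l k).
    by apply/funext => s; rewrite mxE.
  move=> s; apply: cvg_big => [|l _]; [exact: add_continuous|apply: cvgM; [exact: cphi|exact: M_continuous]].
have [F HF] := choice (fun k => antiderivative (cf k)).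
exists (fun s => \row_k (c 0 k + F k s - F k 0)); split.
  by apply/rowP => k; rewrite mxE addrK.
move=> k s s01.
have -> : (fun t => (\row_k (c 0 k + F k t - F k 0)) 0 k) = cst (c 0 k) + F k - cst (F k 0).
  by apply/funext => t; rewrite mxE.
apply: (is_derive_eq (is_deriveB (is_deriveD (is_derive_cst (c 0 k) s 1) (HF k s s01)) (is_derive_cst (F k 0) s 1))).
by rewrite add0r subr0.
Qed.

(** The interval has length 1 and the absolute column sums of [M] are at most 1/2, so the plain sup
    distance is halved. *)
Let step_contract phi phi' psi psi' (D : R) : step phi psi -> step phi' psi' ->
  (forall s, 0 <= s <= 1 -> `|phi s - phi' s| <= D) ->
  forall s, 0 <= s <= 1 -> `|psi s - psi' s| <= 2^-1 * D.
Proof.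
move=> [p0 Hp] [p0' Hp'] HD s s01.
have D0 : 0 <= D by apply: le_trans (HD s s01).
apply: norm_rV_le => [|k]; first by rewrite mulr_ge0.
have Hd (t : R) : 0 <= t <= 1 -> is_derive t 1 (fun t => psi t 0 k - psi' t 0 k)
    (((phi t - phi' t) *m M t) 0 k).
  move=> t01; have -> : ((phi t - phi' t) *m M t) 0 k = (phi t *m M t) 0 k - (phi' t *m M t) 0 k.
    by rewrite mulmxBl !mxE.
  exact: is_deriveB (Hp k t t01) (Hp' k t t01).
have [xi xi01 E] := mean_value01 Hd s01.
have -> : (psi s - psi' s) 0 k = psi s 0 k - psi' s 0 k - (psi 0 0 k - psi' 0 0 k).
  by rewrite p0 p0' subrr subr0 !mxE.
rewrite E.
have /andP[s0 s1] := s01.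
rewrite normrM (ger0_norm s0); apply: le_trans (ler_piMr (normr_ge0 _) s1) _.
apply: le_trans (mulmx_half _ _ (M_half xi)) _.
by rewrite ler_wpM2l // HD.
Qed.

Let step_continuous phi psi : step phi psi -> continuous_coords (fun s => psi (clamp s)).
Proof.
move=> [_ Hpsi] k s.
apply: (@continuous_comp _ _ _ clamp (fun t => psi t 0 k)); first exact: continuous_clamp.
have [] := Hpsi k (clamp s) (clamp01 s).
by move=> /derivable1_diffP /differentiable_continuous.
Qed.

Let T phi := xget (fun=> 0) [set psi | step phi psi].

Let TP phi : continuous_coords phi -> step phi (T phi).
Proof. by move=> /step_exists; exact: (@xgetPex _ _ [set psi | step phi psi]). Qed.

Let v n := iter n (fun phi s => T phi (clamp s)) (fun=> c).

Let cv n : continuous_coords (v n).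
Proof.
elim: n => [|n IH]; first by move=> k; exact: cst_continuous.
exact: step_continuous (TP IH).
Qed.

Let vS n (s : R) : 0 <= s <= 1 -> v n.+1 s = T (v n) s.
Proof. by move=> s01; rewrite /v /= clampE. Qed.

Let v_clamp n (s : R) : v n (clamp s) = v n s.
Proof. by case: n => // n; rewrite /v /= clampE // clamp01. Qed.

Let v_dist n (s : R) : `|v n.+1 s - v n s| <= `|c| / 2 ^+ n.+1.
Proof.
rewrite -v_clamp -[v n s]v_clamp; move: (clamp s) (clamp01 s) => {}s s01.
elim: n s s01 => [|n IH] s s01.
  rewrite vS // expr1 mulrC.
  have [T0 HT] := TP (@cv 0%N).
  apply: norm_rV_le => [|k]; first by rewrite mulr_ge0.
  have [xi xi01 E] := mean_value01 (HT k) s01.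
  have -> : (T (v 0) s - v 0 s) 0 k = T (v 0) s 0 k - T (v 0) 0 0 k by rewrite T0 !mxE.
  rewrite E.
  have /andP[s0 s1] := s01.
  rewrite normrM (ger0_norm s0); apply: le_trans (ler_piMr (normr_ge0 _) s1) _.
  exact: mulmx_half.
rewrite !vS // exprS invfM mulrCA.
apply: step_contract s01; [exact: TP (@cv n.+1)|exact: TP (@cv n)|exact: IH].
Qed.

Lemma linear_ode : exists phi, phi 0 = c /\ forall k (s : R), 0 <= s <= 1 ->
  is_derive s 1 (fun t => phi t 0 k) ((phi s *m M s) 0 k).
Proof.
have Hl (s : R) k : exists l : R, forall n, `|l - v n s 0 k| <= `|c| / 2 ^+ n.
  apply: geometric_limit => n; apply: le_trans (v_dist n s).
  by have := ler_coord_norm (v n.+1 s - v n s) k; rewrite !mxE.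
have [phi0 Hphi0] := choice (fun sk : R * 'I_N => Hl sk.1 sk.2).
pose phi s := \row_k phi0 (s, k).
have phiv n (s : R) : `|phi s - v n s| <= `|c| / 2 ^+ n.
  apply: norm_rV_le => [|k]; first by rewrite mulr_ge0 // invr_ge0 exprn_ge0.
  by have := Hphi0 (s, k) n; rewrite !mxE.
have small (e : R) : 0 < e -> exists n, `|c| / 2 ^+ n < e.
  move=> e0; exists (Num.truncn (`|c| / e)).+1.
  rewrite ltr_pdivrMr ?exprn_gt0 // mulrC -ltr_pdivrMr //.
  have := truncnS_gt (`|c| / e); move=> /lt_le_trans; apply.
  by rewrite -natrX ler_nat ltnW // ltn_expl.
have cphi : continuous_coords phi.
  move=> k s; apply/cvgrPdist_lt => e e0.
  have e4 : 0 < e / 4 by rewrite divr_gt0.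
  have [n Hn] := small _ e4.
  have /cvgrPdist_lt /(_ _ e4) := @cv n k s; apply: filterS => t Ht.
  have Hk r : `|phi r 0 k - v n r 0 k| < e / 4.
    apply: le_lt_trans Hn; apply: le_trans (phiv n r).
    by have := ler_coord_norm (phi r - v n r) k; rewrite !mxE.
  have := Hk s; have := Hk t; move: Ht.
  rewrite !ltr_norml; move: (phi s 0 k) (phi t 0 k) (v n s 0 k) (v n t 0 k) => x y z w.
  by move=> /andP[? ?] /andP[? ?] /andP[? ?]; apply/andP; split; lra.
(* The limit [phi] is only known to be continuous. Its own Picard iterate [psi] is differentiable,
   and both are shown to agree on [0, 1]. *)
have [psi Hpsi] := step_exists cphi.
have psiphi (s : R) : 0 <= s <= 1 -> psi s = phi s.
  move=> s01; apply/eqP; rewrite -subr_eq0 -normr_le0; apply/ler_addgt0Pr => e e0.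
  have e2 : 0 < e / 2 by rewrite divr_gt0.
  have [n Hn] := small _ e2.
  have h1 := step_contract Hpsi (TP (@cv n)) (fun s _ => phiv n s) s01.
  have h2 := phiv n.+1 s; rewrite vS // in h2.
  have c0 : 0 <= `|c| / 2 ^+ n by rewrite divr_ge0 // exprn_ge0.
  have h3 : `|c| / 2 ^+ n.+1 <= `|c| / 2 ^+ n.
    by rewrite exprS invfM mulrCA ler_piMl // invf_le1 // ler1n.
  rewrite add0r; apply: le_trans (ler_distD (T (v n) s) _ _) _.
  rewrite [`|T _ _ - phi s|]distrC; move: h1 h2 h3 Hn c0.
  by move: `|psi s - _| `|phi s - _| (_ / 2 ^+ n.+1) (_ / 2 ^+ n) => x y z w; lra.
exists psi; split; first exact: Hpsi.1.
by move=> k s s01; rewrite psiphi //; exact: Hpsi.2.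
Qed.

End Picard.

End LinearODE.

Section MatrixNorm.
Context {R : realType}.

Lemma ler_entry_norm m l (B : 'M[R]_(m, l)) i j : `|B i j| <= `|B|.
Proof.
rewrite [leRHS]/Num.norm /= mx_normrE; apply/bigmax_geP; right => /=.
by exists (i, j).
Qed.

Lemma norm_mx_le m l (B : 'M[R]_(m, l)) (K : R) : 0 <= K ->
  (forall i j, `|B i j| <= K) -> `|B| <= K.
Proof.
move=> K0 BK; rewrite [leLHS]/Num.norm /= mx_normrE; by apply/bigmax_leP; split.
Qed.

Lemma norm_mulmx m l k (A : 'M[R]_(m, l)) (B : 'M[R]_(l, k)) :
  `|A *m B| <= l%:R * `|A| * `|B|.
Proof.
apply: norm_mx_le => [|i j]; first by rewrite !mulr_ge0.
rewrite mxE; apply: (le_trans (ler_norm_sum _ _ _)).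
have -> : l%:R * `|A| * `|B| = \sum_(i < l) `|A| * `|B|.
  by rewrite sumr_const card_ord -[RHS]mulr_natl mulrA.
by apply: ler_sum => a _; rewrite normrM ler_pM // ler_entry_norm.
Qed.

Lemma norm_lincomb n m l (u : 'rV[R]_n) (B : 'I_n -> 'M[R]_(m, l)) (K : R) :
  (forall i, `|B i| <= K) -> `|\sum_i u 0 i *: B i| <= n%:R * K * `|u|.
Proof.
move=> BK; apply: (le_trans (ler_norm_sum _ _ _)).
have -> : n%:R * K * `|u| = \sum_(i < n) K * `|u|.
  by rewrite sumr_const card_ord -[RHS]mulr_natl mulrA.
by apply: ler_sum => i _; rewrite normrZ mulrC ler_pM // ler_coord_norm.
Qed.

End MatrixNorm.

Lemma is_derive_mulmx_row (R : realType) (N : nat) (phi : R -> 'rV[R]_N) (B : R -> 'M[R]_N)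
    (dphi : 'rV[R]_N) (dB : 'M[R]_N) (s : R) k :
  (forall k, is_derive s 1 (fun t => phi t 0 k) (dphi 0 k)) ->
  (forall a b, is_derive s 1 (fun t => B t a b) (dB a b)) ->
  is_derive s 1 (fun t => (phi t *m B t) 0 k) ((dphi *m B s + phi s *m dB) 0 k).
Proof.
move=> Hphi HB.
have -> : (fun t => (phi t *m B t) 0 k) = \sum_(l < N) (fun t => phi t 0 l * B t l k).
  by apply/funext => t; rewrite mxE fct_sumE.
have -> : (dphi *m B s + phi s *m dB) 0 k = \sum_(l < N) (phi s 0 l * dB l k + B s l k * dphi 0 l).
  by rewrite !mxE addrC -big_split; apply: eq_bigr => l _ /=; rewrite [dphi _ _ * _]mulrC.
by apply: is_derive_sum => l; exact: is_deriveM.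
Qed.

(** * Frobenius theorem for flat linear systems *)

Section Frobenius.
Context {R : realType} {n N : nat}.
Variables (U : set 'rV[R]_n) (A : 'I_n -> 'rV[R]_n -> 'M[R]_N).
Hypothesis U_open : open U.
Hypothesis cA : forall m i a b, Ck U m (fun q => A i q a b).

Let dA i k q : 'M[R]_N := \matrix_(a, b) pd k (fun q => A i q a b) q.

Hypothesis flat : forall p i j, U p ->
  dA i j p + A j p *m A i p = dA j i p + A i p *m A j p.

Let lc (u : 'rV[R]_n) q : 'M[R]_N := \sum_i u 0 i *: A i q.

Section Estimates.
Variables (p0 : 'rV[R]_n) (r K : R).
Hypothesis K0 : 0 <= K.
Hypothesis rU : forall q, ball p0 r q -> U q.
Hypothesis AK : forall i q, ball p0 r q -> `|A i q| <= K.
Hypothesis dAK : forall i k q, ball p0 r q -> `|dA i k q| <= K.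
Hypothesis d2AK : forall i a b j k q, ball p0 r q ->
  `|pd k (pd j (fun q => A i q a b)) q| <= K.

Let A_lip i q w : ball p0 r q -> ball p0 r (q + w) ->
  `|A i (q + w) - A i q| <= n%:R * K * `|w|.
Proof.
move=> Hq Hw; apply: norm_mx_le => [|a b]; first by rewrite !mulr_ge0.
rewrite !mxE; apply: (@lipschitz_pd _ _ (fun q => A i q a b) p0 r K) => //.
  by move=> q1 /rU; exact: Ck_differentiable (cA 0%N i a b).
move=> k q1 Hq1; apply: le_trans (dAK i k Hq1).
by have := ler_entry_norm (dA i k q1) a b; rewrite mxE.
Qed.

Let A_taylor i q w : ball p0 r q -> ball p0 r (q + w) ->
  `|A i (q + w) - A i q - \sum_k w 0 k *: dA i k q| <= n%:R * (n%:R * K * `|w|) * `|w|.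
Proof.
move=> Hq Hw; apply: norm_mx_le => [|a b]; first by rewrite !mulr_ge0.
have -> : (A i (q + w) - A i q - \sum_k w 0 k *: dA i k q) a b =
  A i (q + w) a b - A i q a b - \sum_k w 0 k * pd k (fun q => A i q a b) q.
  by rewrite !mxE summxE; congr (_ - _); apply: eq_bigr => k _; rewrite !mxE.
apply: (@taylor2_pd _ _ (fun q => A i q a b) p0 r K) => //.
- by move=> q1 /rU; exact: Ck_differentiable (cA 0%N i a b).
- by move=> k q1 /rU; exact: Ck_differentiable (Ck_pd k (ltnSn 0) (cA 1%N i a b)).
- by move=> j k q1; exact: d2AK.
Qed.

Variables (u v : 'rV[R]_n).
Hypotheses (u1 : `|u| <= 1) (s01 : forall s : R, 0 <= s <= 1 ->
  ball p0 r (p0 + s *: u) /\ ball p0 r (p0 + s *: (u + v))).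

(* The defect of [phi_u (1 + s A_v)] as an approximate solution along the ray of
   direction [u + v]; flatness cancels its terms of first order in [v]. *)
Let defect (s : R) : 'M[R]_N :=
  let q := p0 + s *: u in
  lc (u + v) (p0 + s *: (u + v)) - lc u q - lc v q
  - s *: (\sum_i \sum_k (v 0 i * u 0 k) *: dA i k q)
  - s *: (lc u q *m lc v q) + s *: (lc v q *m lc (u + v) (p0 + s *: (u + v))).

(** The summands bound, in this order, the Taylor remainder of A_u, the increment of A_v between the
    two rays, and the quadratic term of the defect. *)
Definition defect_const : R :=
  n%:R * (n%:R * (n%:R * K)) + n%:R * (n%:R * K)
  + N%:R * (n%:R * K) * (n%:R * (n%:R * K) + n%:R * K).

Let lc_bound q w : ball p0 r q -> `|lc w q| <= n%:R * K * `|w|.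
Proof. by move=> Hq; apply: norm_lincomb => i; exact: AK. Qed.

Let lcD w1 w2 q : lc (w1 + w2) q = lc w1 q + lc w2 q.
Proof. by rewrite -big_split; apply: eq_bigr => i _; rewrite mxE scalerDl. Qed.

(** Flatness contracted with u and v: it trades the derivative of A_u along v for that of A_v along
    u plus a commutator. *)
Let flat_uv q : U q ->
  \sum_i \sum_k (u 0 i * v 0 k) *: dA i k q - \sum_i \sum_k (v 0 i * u 0 k) *: dA i k q
  = lc u q *m lc v q - lc v q *m lc u q.
Proof.
move=> Uq; rewrite [X in _ - X]exchange_big -sumrB.
have mulE w1 w2 : lc w1 q *m lc w2 q = \sum_i \sum_k (w1 0 i * w2 0 k) *: (A i q *m A k q).
  rewrite mulmx_suml; apply: eq_bigr => i _; rewrite mulmx_sumr; apply: eq_bigr => k _.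
  by rewrite -scalemxAl -scalemxAr scalerA.
rewrite !mulE [X in _ = _ - X]exchange_big -sumrB; apply: eq_bigr => i _.
rewrite -!sumrB; apply: eq_bigr => k _; rewrite [v 0 k * _]mulrC -!scalerBr; congr (_ *: _).
apply/eqP; rewrite subr_eq addrAC -subr_eq opprK; apply/eqP.
by rewrite (flat i k Uq) addrC.
Qed.

Lemma defect_bound s : 0 <= s <= 1 -> `|defect s| <= defect_const * `|v| ^+ 2.
Proof.
move=> s1; have [Hq Hq'] := s01 s1.
rewrite /defect; set q := p0 + s *: u in Hq *; set q' := p0 + s *: (u + v) in Hq' *.
have qq' : q + s *: v = q' by rewrite /q /q' scalerDr addrA.
have sv : `|s *: v| <= `|v|.
  by rewrite normrZ; have /andP[s0 ?] := s1; rewrite ger0_norm // ler_piMl.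
have H1 : `|\sum_i u 0 i *: (A i q' - A i q - \sum_k (s *: v) 0 k *: dA i k q)|
    <= n%:R * (n%:R * (n%:R * K)) * `|v| ^+ 2.
  have := norm_lincomb u (K := n%:R * (n%:R * K * `|v|) * `|v|)
    (B := fun i => A i q' - A i q - \sum_k (s *: v) 0 k *: dA i k q).
  move=> /(_ _)/le_trans; apply => [i|].
    rewrite -qq' in Hq' *; apply: le_trans (A_taylor i Hq Hq') _.
    by rewrite ler_pM ?mulr_ge0 // ler_wpM2l // ler_wpM2l // mulr_ge0.
  have E (x y z : R) : x * (x * (x * y * z) * z) = x * (x * (x * y)) * z ^+ 2 by ring.
  by rewrite E ler_piMr // !mulr_ge0 // exprn_ge0.
have Hd (w : 'rV[R]_n) : `|\sum_i w 0 i *: (A i q' - A i q)| <= n%:R * (n%:R * K * `|v|) * `|w|.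
  apply: norm_lincomb => i; rewrite -qq' in Hq' *; apply: le_trans (A_lip i Hq Hq') _.
  by rewrite ler_wpM2l // mulr_ge0.
have H2 : `|lc v q' - lc v q| <= n%:R * (n%:R * K) * `|v| ^+ 2.
  rewrite -sumrB; under eq_bigr do rewrite -scalerBr.
  by apply: le_trans (Hd v) _; rewrite expr2 !mulrA.
have H3 : `|lc v q *m (lc (u + v) q' - lc u q)|
    <= N%:R * (n%:R * K) * (n%:R * (n%:R * K) + n%:R * K) * `|v| ^+ 2.
  have h : `|lc (u + v) q' - lc u q| <= (n%:R * (n%:R * K) + n%:R * K) * `|v|.
    rewrite lcD addrAC mulrDl; apply: le_trans (ler_normD _ _) _; apply: lerD; last exact: lc_bound.
    rewrite -sumrB; under eq_bigr do rewrite -scalerBr.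
    have E (x y z t : R) : x * (x * y * z) * t = x * (x * y) * z * t by ring.
    by apply: le_trans (Hd u) _; rewrite E; apply: ler_piMr => //; rewrite !mulr_ge0.
  apply: le_trans (norm_mulmx _ _) _.
  have E (x y z t : R) : x * y * z * t ^+ 2 = x * (y * t) * (z * t) by ring.
  rewrite E; apply: ler_pM => //.
  by rewrite ler_wpM2l // lc_bound.
(* Flatness turns the defect into three pieces, each of second order in v. *)
have -> : lc (u + v) q' - lc u q - lc v q - s *: (\sum_i \sum_k (v 0 i * u 0 k) *: dA i k q)
  - s *: (lc u q *m lc v q) + s *: (lc v q *m lc (u + v) q')
  = \sum_i u 0 i *: (A i q' - A i q - \sum_k (s *: v) 0 k *: dA i k q)
    + (lc v q' - lc v q) + s *: (lc v q *m (lc (u + v) q' - lc u q)).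
  have -> : \sum_i u 0 i *: (A i q' - A i q - \sum_k (s *: v) 0 k *: dA i k q)
    = lc u q' - lc u q - s *: (\sum_i \sum_k (u 0 i * v 0 k) *: dA i k q).
    rewrite scaler_sumr -!sumrB; apply: eq_bigr => i _.
    rewrite !scalerBr; congr (_ - _ - _); rewrite !scaler_sumr; apply: eq_bigr => k _.
    by rewrite mxE !scalerA mulrCA.
  have F := flat_uv (rU Hq).
  have -> : \sum_i \sum_k (u 0 i * v 0 k) *: dA i k q = lc u q *m lc v q - lc v q *m lc u q
     + \sum_i \sum_k (v 0 i * u 0 k) *: dA i k q by rewrite -F subrK.
  rewrite mulmxBr lcD.
  move: (lc u q') (lc v q') (lc u q) (lc v q) (\sum_i _) (_ *m _) (_ *m _) (_ *m _) => a b c d e f g k.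
  by apply/matrixP => x y; rewrite !mxE; ring.
apply: le_trans (ler_normD _ _) _; rewrite /defect_const mulrDl.
apply: lerD; last first.
  rewrite normrZ; have /andP[s0 s1'] := s1; rewrite ger0_norm //.
  by apply: le_trans (ler_piMl _ s1') H3.
rewrite mulrDl; apply: le_trans (ler_normD _ _) _.
exact: lerD.
Qed.

End Estimates.

Section Ray.
Variables (p0 : 'rV[R]_n) (r K : R).
Hypothesis K0 : 0 <= K.
Hypothesis rU : forall q, ball p0 r q -> U q.
Hypothesis AK : forall i q, ball p0 r q -> `|A i q| <= K.
Hypothesis dAK : forall i k q, ball p0 r q -> `|dA i k q| <= K.
Hypothesis d2AK : forall i a b j k q, ball p0 r q ->
  `|pd k (pd j (fun q => A i q a b)) q| <= K.
Hypothesis r0 : 0 < r.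
Hypothesis r1 : r <= 1.
Hypothesis rK : N%:R * (n%:R * K * r) <= 2^-1.

Let ray_ball u s : `|u| < r -> 0 <= s <= 1 -> ball p0 r (p0 + s *: u).
Proof.
move=> ur /andP[s0 s1].
rewrite ball_norm addrC addKr normrZ ger0_norm //.
exact: le_lt_trans (ler_piMl _ s1) ur.
Qed.

Let half_bound u q k : `|u| < r -> ball p0 r q -> \sum_l `|lc u q l k| <= 2^-1.
Proof.
move=> ur Hq; apply: le_trans rK.
have -> : N%:R * (n%:R * K * r) = \sum_(l < N) (n%:R * K * r).
  by rewrite sumr_const card_ord -[RHS]mulr_natl.
apply: ler_sum => l _; apply: le_trans (ler_entry_norm _ _ _) _.
apply: le_trans (norm_lincomb u (fun i => AK i Hq)) _.
by apply: ler_wpM2l; [rewrite mulr_ge0|exact: ltW].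
Qed.

Let solves (c : 'rV[R]_N) u (phi : R -> 'rV[R]_N) := phi 0 = c /\
  forall k (s : R), 0 <= s <= 1 ->
    is_derive s 1 (fun t => phi t 0 k) ((phi s *m lc u (p0 + s *: u)) 0 k).

Let solves_exists c u : `|u| < r -> exists phi, solves c u phi.
Proof.
move=> ur.
pose M (s : R) := lc u (p0 + clamp s *: u).
have cM a b : continuous (fun s => M s a b).
  move=> s; apply: (@continuous_comp _ _ _ (fun s => p0 + clamp s *: u) (fun q => lc u q a b)).
    apply: (@cvgD _ _ _ _ _ (cst p0) (fun s => clamp s *: u)); first exact: cvg_cst.
    apply: cvgZ; [exact: continuous_clamp|exact: cvg_cst].
  have cl : Ck (ball p0 r) 0 (fun q => lc u q a b).
    have bo : open (ball p0 r) by exact: ball_open.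
    apply: (Ck_eq bo _ (Ck_sum bo (index_enum 'I_n) (fun i => CkM bo (Ck_cst bo 0 (u 0 i))
      (Ck_sub rU (cA 0 i a b))))) => q _.
    by rewrite summxE; apply: eq_bigr => i _; rewrite mxE.
  exact: Ck_continuous cl (ray_ball ur (clamp01 s)).
have [phi [phi0 Hphi]] := linear_ode c cM (fun s k => half_bound k ur (ray_ball ur (clamp01 s))).
exists phi; split=> // k s s01.
by have := Hphi k s s01; rewrite /M clampE.
Qed.

(** [gronwall_half] applied to phi - c bounds it by |c|, whence the factor 2. *)
Let solves_bounded c u phi : `|u| < r -> solves c u phi ->
  forall s, 0 <= s <= 1 -> `|phi s| <= 2 * `|c|.
Proof.
move=> ur [phi0 Hphi] s s01.
have := @gronwall_half R N (fun s => phi s - c) (fun s => phi s *m lc u (p0 + s *: u)) (2^-1 * `|c|).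
move=> /(_ _ _ _ _ s s01) h.
have {h} : `|phi s - c| <= 2 * (2^-1 * `|c|).
  apply: h => [k t t01|k t t01||].
  - have -> : (fun t => (phi t - c) 0 k) = (fun t => phi t 0 k) - cst (c 0 k).
      by apply/funext => t'; rewrite !fctE !mxE.
    apply: is_derive_eq (is_deriveB (Hphi k t t01) (is_derive_cst (c 0 k) t 1)) _.
    by rewrite subr0.
  - apply: le_trans (mulmx_half _ _ (fun k => half_bound k ur (ray_ball ur t01))) _.
    rewrite -mulrDr ler_wpM2l //.
    by rewrite -{1}(subrK c (phi t)) ler_normD.
  - by rewrite mulr_ge0.
  - by rewrite phi0 subrr.
have := ler_normD (phi s - c) c; rewrite subrK.
by move: `|phi s| `|phi s - c| `|c| => x y z; lra.
Qed.

(** Moving the end point of the ray by v changes the final value by [phi 1 *m lc v], up to order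
    |v|^2. This is the quadratic bound from which differentiability in the end point is deduced;
    comparing solutions on two nearby rays replaces any theorem on dependence on parameters. *)
Let ray_estimate c u v phi phi' : `|u| < r -> `|u + v| < r ->
  solves c u phi -> solves c (u + v) phi' ->
  `|phi' 1 - phi 1 - phi 1 *m lc v (p0 + u)|
    <= 2 * (N%:R * (2 * `|c|) * (defect_const K * `|v| ^+ 2)).
Proof.
move=> ur uvr Hphi Hphi'.
pose D q := \sum_i \sum_k (v 0 i * u 0 k) *: dA i k q.
pose P s := phi' s - phi s - s *: (phi s *m lc v (p0 + s *: u)).
pose d s := phi' s *m lc (u + v) (p0 + s *: (u + v)) - phi s *m lc u (p0 + s *: u)
  - (phi s *m lc v (p0 + s *: u) + s *: (phi s *m lc u (p0 + s *: u) *m lc v (p0 + s *: u)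
     + phi s *m D (p0 + s *: u))).
have H := @gronwall_half R N P d (N%:R * (2 * `|c|) * (defect_const K * `|v| ^+ 2)).
have -> : phi' 1 - phi 1 - phi 1 *m lc v (p0 + u) = P 1 by rewrite /P !scale1r.
have dc0 : 0 <= defect_const K by rewrite /defect_const !addr_ge0 // !mulr_ge0 // addr_ge0 // !mulr_ge0.
apply: H => [k s s01|k s s01|||]; last by rewrite ler01 lexx.
- have Dphi := Hphi.2 ^~ s; have Dphi' := Hphi'.2 k s s01.
  have Dlc a b : is_derive s 1 (fun t => lc v (p0 + t *: u) a b) (D (p0 + s *: u) a b).
    have -> : (fun t : R => lc v (p0 + t *: u) a b)
        = \sum_(i < n) (fun t : R => v 0 i * A i (p0 + t *: u) a b).
      by apply/funext => t; rewrite fct_sumE summxE; apply: eq_bigr => i _; rewrite mxE.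
    have -> : D (p0 + s *: u) a b = \sum_(i < n) (v 0 i * \sum_k u 0 k * dA i k (p0 + s *: u) a b).
      rewrite summxE; apply: eq_bigr => i _; rewrite summxE mulr_sumr; apply: eq_bigr => k' _.
      by rewrite mxE mulrA.
    apply: is_derive_sum => i.
    have dAi := Ck_differentiable (cA 0 i a b) (rU (ray_ball ur s01)).
    have DA : is_derive s 1 (fun t : R => A i (p0 + t *: u) a b) (\sum_k u 0 k * dA i k (p0 + s *: u) a b).
      apply/(is_derive_line (fun q => A i q a b)); apply: DeriveDef; first exact: diff_derivable.
      by rewrite derive_pd //; apply: eq_bigr => k' _; rewrite mxE.
    apply: is_derive_eq (is_deriveM (is_derive_cst (v 0 i) s 1) DA) _.
    by rewrite scaler0 addr0.
  have DM := is_derive_mulmx_row k (fun k => Hphi.2 k s s01) Dlc.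
  have Dsm := is_deriveM (is_derive_id s 1) DM.
  have := is_deriveB (is_deriveB Dphi' (Hphi.2 k s s01)) Dsm.
  have -> : (fun t => P t 0 k) = (fun t => phi' t 0 k) - (fun t => phi t 0 k)
     - id * (fun t => (phi t *m lc v (p0 + t *: u)) 0 k).
    by apply/funext => t; rewrite !fctE /P; do 5 rewrite mxE.
  move=> /is_derive_eq; apply.
  rewrite /d; move: (phi' s *m _) (phi s *m lc u _) (phi s *m lc v _) (phi s *m D _) => a b e f.
  move: (b *m lc v _) => g; rewrite !mxE /GRing.scale /=; ring.
- have Hdef := @defect_bound p0 r K K0 rU AK dAK d2AK u v (le_trans (ltW ur) r1)
    (fun s s01 => conj (ray_ball ur s01) (ray_ball uvr s01)) s s01.
  move: Hdef; rewrite -/(D (p0 + s *: u)); set E := (X in `|X|) => Hdef.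
  (* The derivative of [P] is [P] times the matrix of the new ray plus [phi] times the defect: the
     shape required by [gronwall_half]. *)
  have -> : d s = P s *m lc (u + v) (p0 + s *: (u + v)) + phi s *m E.
    rewrite /d /P /E !(mulmxBl, mulmxBr, mulmxDl, mulmxDr) -!scalemxAl -!scalemxAr !mulmxA.
    rewrite scalerDr.
    move: (phi' s *m _) (phi s *m lc u _) (phi s *m lc v _) (phi s *m D _) (phi s *m lc (u + v) _) => a b e f a'.
    move: (b *m _) (e *m _) => g h; apply/rowP => l; rewrite !mxE; ring.
  rewrite mxE; apply: le_trans (ler_normD _ _) _; apply: lerD.
    by apply: mulmx_half => k'; exact: half_bound (ray_ball uvr s01).
  apply: le_trans (ler_entry_norm _ _ _) _; apply: le_trans (norm_mulmx _ _) _.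
  apply: ler_pM => //; apply: ler_wpM2l => //.
  exact: solves_bounded Hphi _ s01.
- by rewrite !mulr_ge0 // exprn_ge0.
- by rewrite /P scale0r subr0 Hphi.1 Hphi'.1 subrr.
Qed.

(** [Psi p] is the value at time 1 of the solution along the segment from [p0] to [p]. *)
Lemma ray_frobenius c : exists Psi : 'rV[R]_n -> 'rV[R]_N,
  Psi p0 = c /\ forall p, ball p0 r p -> forall k,
    differentiable (fun q => Psi q 0 k) p /\
    forall i, pd i (fun q => Psi q 0 k) p = (Psi p *m A i p) 0 k.
Proof.
pose phi u := xget (fun=> 0) [set phi | solves c u phi].
have phiP u : `|u| < r -> solves c u (phi u).
  by move=> /(solves_exists c); exact: (@xgetPex _ _ [set phi | solves c u phi]).
exists (fun p => phi (p - p0) 1); split.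
  (* Along the zero ray the equation reads phi' = 0, so the final value is the initial one. *)
  rewrite subrr; have n0 : `|0 : 'rV[R]_n| < r by rewrite normr0.
  have [phi0 Hphi] := phiP 0 n0.
  apply/rowP => k; rewrite -phi0; apply/eqP; rewrite -subr_eq0; apply/eqP.
  have [|xi _ ->] := mean_value01 (Hphi k) (s := 1); first by rewrite ler01 lexx.
  suff -> : lc 0 (p0 + xi *: 0) = 0 by rewrite mulmx0 mxE mul0r.
  by rewrite /lc big1 // => i _; rewrite mxE scale0r.
move=> p Hp k; set u := p - p0.
have pu : p0 + u = p by rewrite addrC subrK.
have ur : `|u| < r by rewrite -ball_norm.
have [] := @quadratic_differentiable R n (fun q => phi (q - p0) 1 0 k) p
   (fun i => (phi u 1 *m A i p) 0 k) (2 * (N%:R * (2 * `|c|) * defect_const K)).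
  have nV : \forall v \near (0 : 'rV[R]_n), ball p0 r (v + p).
    by have := near_open (ball_open p0 r) Hp; rewrite (near_shift 0 p) /= subr0.
  apply: filterS nV => v; rewrite ball_norm.
  have -> : v + p - p0 = u + v by rewrite /u -addrA [LHS]addrC.
  move=> uvr; have := ray_estimate ur uvr (phiP _ ur) (phiP _ uvr).
  rewrite pu => /(le_trans (ler_coord_norm _ k)).
  have -> : \sum_i v 0 i * (phi u 1 *m A i p) 0 k = (phi u 1 *m lc v p) 0 k.
    rewrite mulmx_sumr summxE; apply: eq_bigr => i _.
    by rewrite -scalemxAr [RHS]mxE.
  by rewrite !mxE -!mulrA.
move=> df D; split=> // i; rewrite /pd D (bigD1 i) //= big1 ?addr0 => [|j ji].
  by rewrite !mxE !eqxx mul1r.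
by rewrite !mxE eqxx (negbTE ji) mul0r.
Qed.

End Ray.

(** The radius is chosen before the initial value, so that several solutions can share one ball. *)
Theorem linear_frobenius p0 : U p0 ->
  exists2 r : R, 0 < r & ball p0 r `<=` U /\
    forall c : 'rV[R]_N, exists Psi : 'rV[R]_n -> 'rV[R]_N,
      Psi p0 = c /\ forall p, ball p0 r p -> forall k,
        differentiable (fun q => Psi q 0 k) p /\
        forall i, pd i (fun q => Psi q 0 k) p = (Psi p *m A i p) 0 k.
Proof.
move=> Up0.
have [K1 K10 n1] := @near_bounded_family R n _ (fun (x : 'I_n * 'I_N * 'I_N) q => A x.1.1 q x.1.2 x.2) p0
  (fun x => Ck_continuous (cA 0 x.1.1 x.1.2 x.2) Up0).
have [K2 K20 n2] := @near_bounded_family R n _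
  (fun (x : 'I_n * 'I_N * 'I_N * 'I_n) => pd x.2 (fun q => A x.1.1.1 q x.1.1.2 x.1.2)) p0
  (fun x => Ck_continuous (Ck_pd x.2 (ltnSn 0) (cA 1 x.1.1.1 x.1.1.2 x.1.2)) Up0).
have [K3 K30 n3] := @near_bounded_family R n _
  (fun (x : 'I_n * 'I_N * 'I_N * 'I_n * 'I_n) => pd x.2 (pd x.1.2 (fun q => A x.1.1.1.1 q x.1.1.1.2 x.1.1.2))) p0
  (fun x => Ck_continuous (Ck_pd x.2 (ltnSn 0) (Ck_pd x.1.2 (ltnSn 1) (cA 2 x.1.1.1.1 x.1.1.1.2 x.1.1.2))) Up0).
have [r0 r00 Hr0] := near_ball (filterI (near_open U_open Up0) (filterI n1 (filterI n2 n3))).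
pose K := K1 + K2 + K3.
have K0 : 0 <= K by rewrite !addr_ge0.
have L0 : 0 <= N%:R * (n%:R * K) by rewrite !mulr_ge0.
(* The second bound yields both r <= 1 and N n K r <= 1/2, the smallness that [linear_ode] needs. *)
pose r := Num.min r0 (2 * (1 + N%:R * (n%:R * K)))^-1.
have rpos : 0 < r by rewrite lt_min r00 invr_gt0 mulr_gt0 // ltr_pwDl.
have r1 : r <= 1.
  have h : r <= (2 * (1 + N%:R * (n%:R * K)))^-1 by rewrite ge_min lexx orbT.
  apply: le_trans h _; rewrite invf_le1 ?mulr_gt0 ?ltr_pwDl //.
  by move: L0; move: (_ * _) => x; lra.
have rK : N%:R * (n%:R * K * r) <= 2^-1.
  have h : r <= (2 * (1 + N%:R * (n%:R * K)))^-1 by by rewrite ge_min lexx orbT.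
  rewrite mulrA; apply: le_trans (ler_wpM2l L0 h) _.
  rewrite ler_pdivrMr ?mulr_gt0 ?ltr_pwDl //; move: L0; move: (_ * _) => x; lra.
have rr0 q : ball p0 r q -> ball p0 r0 q.
  by rewrite !ball_norm => /lt_le_trans; apply; by rewrite ge_min lexx.
have rU q : ball p0 r q -> U q by move=> /rr0 /Hr0 [].
exists r => //; split=> // c.
apply: (@ray_frobenius p0 r K) => //.
- move=> i q /rr0 /Hr0 [_ [h _]]; apply: norm_mx_le => // a b.
  by apply: le_trans (h (i, a, b)) _; rewrite /K -addrA lerDl addr_ge0.
- move=> i k q /rr0 /Hr0 [_ [_ [h _]]]; apply: norm_mx_le => // a b.
  by rewrite mxE; apply: le_trans (h (i, a, b, k)) _; rewrite /K addrAC lerDr addr_ge0.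
- move=> i a b j k q /rr0 /Hr0 [_ [_ [_ h]]].
  by apply: le_trans (h (i, a, b, j, k)) _; rewrite /K lerDr addr_ge0.
Qed.

End Frobenius.

(** * Moving frames *)

Section Covectors.
Context {R : realType} {n : nat}.
Implicit Types (p u v : 'rV[R]_n).

Definition covec (t : 'I_n -> 'rV[R]_n -> R) : field1 R n :=
  fun p v => \sum_j t j p * v 0 j.

Lemma covecD t p u v : covec t p (u + v) = covec t p u + covec t p v.
Proof. by rewrite -big_split; apply: eq_bigr => j _; rewrite mxE mulrDr. Qed.

Lemma covecZ t p (c : R) v : covec t p (c *: v) = c * covec t p v.
Proof. by rewrite mulr_sumr; apply: eq_bigr => j _; rewrite mxE mulrCA. Qed.

Lemma covecN t p v : covec t p (- v) = - covec t p v.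
Proof. by rewrite -scaleN1r covecZ mulN1r. Qed.

Lemma covec0 t p : covec t p 0 = 0.
Proof. by rewrite /covec big1 // => j _; rewrite mxE mulr0. Qed.

Lemma covec_bvec t p j : covec t p (bvec j) = t j p.
Proof.
rewrite /covec (bigD1 j) //= big1 ?addr0 => [|i ij]; rewrite mxE eqxx /=.
  by rewrite eqxx mulr1.
by rewrite (negbTE ij) mulr0.
Qed.

Lemma is_derive_covec t (Y : vfield R n) p u : (forall j, differentiable (t j) p) ->
  (forall j, differentiable (fun q => Y q 0 j) p) ->
  is_derive p u (fun q => covec t q (Y q))
    (\sum_j ('D_u (t j) p * Y p 0 j + t j p * 'D_u (fun q => Y q 0 j) p)).
Proof.
move=> dt dY.
have -> : (fun q => covec t q (Y q)) = \sum_(j < n) (fun q => t j q * Y q 0 j).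
  by apply/funext => q; rewrite fct_sumE.
apply: is_derive_sum => j.
have D1 := @derivableP _ _ _ _ _ u (diff_derivable (v := u) (dt j)).
have D2 := @derivableP _ _ _ _ _ u (diff_derivable (v := u) (dY j)).
apply: is_derive_eq (is_deriveM D1 D2) _.
by rewrite addrC [X in X + _]mulrC.
Qed.

Lemma derive_covec t p u v : (forall j, differentiable (t j) p) ->
  'D_u (fun q => covec t q v) p = \sum_j 'D_u (t j) p * v 0 j.
Proof.
move=> dt; have dv j : differentiable (fun q : 'rV[R]_n => (cst v q : 'rV[R]_n) 0 j) p.
  exact: differentiable_cst.
have /@derive_val -> := is_derive_covec u dt dv.
by apply: eq_bigr => j _; rewrite derive_cst mulr0 addr0.
Qed.

Lemma Ck_covec (U : set 'rV[R]_n) k t v : open U -> (forall j, Ck U k (t j)) ->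
  Ck U k (fun q => covec t q v).
Proof.
by move=> Uo ct; apply: (Ck_sum Uo) => j; apply: (CkM Uo) => //; exact: Ck_cst.
Qed.

Lemma Ck_derive (U : set 'rV[R]_n) k f v : open U -> Ck U k.+1 f ->
  Ck U k (fun q => 'D_v f q).
Proof.
move=> Uo cf; apply: (Ck_eq Uo _ (Ck_sum Uo (index_enum 'I_n)
  (fun i => CkM Uo (Ck_cst Uo k (v 0 i)) (Ck_pd i (ltnSn k) cf)))) => q Uq.
by rewrite derive_pd //; exact: Ck_differentiable cf Uq.
Qed.

Lemma derive_comm (U : set 'rV[R]_n) f u v p : open U -> Ck U 2 f -> U p ->
  'D_u (fun q => 'D_v f q) p = 'D_v (fun q => 'D_u f q) p.
Proof.
move=> Uo cf Up.
have D w1 w2 : 'D_w1 (fun q => 'D_w2 f q) p =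
    \sum_j \sum_i w1 0 j * w2 0 i * pd j (pd i f) p.
  rewrite derive_pd; last exact: Ck_differentiable (Ck_derive w2 Uo cf) Up.
  apply: eq_bigr => j _.
  have dpd i : differentiable (pd i f) p.
    exact: Ck_differentiable (Ck_pd i (ltnSn 1) cf) Up.
  have E q : U q -> 'D_w2 f q = (\sum_(i < n) (fun q => w2 0 i * pd i f q)) q.
    move=> Uq; rewrite fct_sumE derive_pd //; exact: Ck_differentiable cf Uq.
  have H : is_derive p (bvec j) (\sum_(i < n) (fun q => w2 0 i * pd i f q))
     (\sum_(i < n) w2 0 i * pd j (pd i f) p).
    apply: is_derive_sum => i.
    have Dp := @derivableP _ _ _ _ _ (bvec j) (diff_derivable (v := bvec j) (dpd i)).
    apply: is_derive_eq (is_deriveM (is_derive_cst (w2 0 i) p (bvec j)) Dp) _.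
    by rewrite scaler0 addr0.
  rewrite {1}/pd (eq_on_derive Uo _ E Up) (derive_val (is_derive := H)) mulr_sumr.
  by apply: eq_bigr => i _; rewrite mulrA.
rewrite !D exchange_big; apply: eq_bigr => j _; apply: eq_bigr => i _.
rewrite [u 0 i * v 0 j]mulrC; apply: (congr1 ( *%R (v 0 j * u 0 i))).
apply: (@pd_comm R n f j i).
- apply: filterS (near_open Uo Up) => q Uq.
  split; first exact: Ck_differentiable cf Uq.
    exact: Ck_differentiable (Ck_pd j (ltnSn 1) cf) Uq.
  exact: Ck_differentiable (Ck_pd i (ltnSn 1) cf) Uq.
- exact: Ck_continuous (Ck_pd i (ltnSn 0) (Ck_pd j (ltnSn 1) cf)) Up.
- exact: Ck_continuous (Ck_pd j (ltnSn 0) (Ck_pd i (ltnSn 1) cf)) Up.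
Qed.

End Covectors.

Section Forms2.
Context {R : realType} {n : nat}.
Implicit Types (w : form2 R n) (s t : form1 R n) (u v : 'rV[R]_n).

Lemma form2_lin w (c : R) u v z : is_form2 w ->
  w (c *: u + v) z = c * w u z + w v z /\ w z (c *: u + v) = c * w z u + w z v.
Proof. by case=> _ wl wr; split; [exact: wl|exact: wr]. Qed.

Lemma form2_0 w z : is_form2 w -> w 0 z = 0 /\ w z 0 = 0.
Proof.
move=> Hw; have [] := form2_lin 1 0 0 z Hw.
rewrite scale1r addr0 !mul1r => E1 E2; split; apply/eqP.
  by move/eqP: E1; rewrite eq_sym -subr_eq0 addrK.
by move/eqP: E2; rewrite eq_sym -subr_eq0 addrK.
Qed.

Lemma form2_opp w u v : is_form2 w -> w u v = - w v u.
Proof.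
move=> Hw; have [w0 _ _] := Hw.
have := w0 (1 *: u + v).
rewrite (form2_lin 1 u v _ Hw).1 !(form2_lin 1 u v _ Hw).2 !w0 mulr0 add0r addr0 !mul1r.
by move=> /eqP; rewrite addr_eq0 => /eqP.
Qed.

Lemma form2_suml (I : Type) (r : seq I) (c : I -> R) (V : I -> 'rV[R]_n) w z : is_form2 w ->
  w (\sum_(i <- r) c i *: V i) z = \sum_(i <- r) c i * w (V i) z.
Proof.
move=> Hw; elim: r => [|i r IH]; first by rewrite !big_nil (form2_0 z Hw).1.
by rewrite !big_cons (form2_lin _ _ _ _ Hw).1 IH.
Qed.

Lemma form2_sumr (I : Type) (r : seq I) (c : I -> R) (V : I -> 'rV[R]_n) w z : is_form2 w ->
  w z (\sum_(i <- r) c i *: V i) = \sum_(i <- r) c i * w z (V i).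
Proof.
move=> Hw; rewrite form2_opp // form2_suml // -sumrN; apply: eq_bigr => i _.
by rewrite -mulrN -form2_opp.
Qed.

(** Identities between two-forms can thus be checked on pairs of coordinate vectors, where they
    become identities between scalars. *)
Lemma form2_ext w w' : is_form2 w -> is_form2 w' ->
  (forall i j : 'I_n, (i < j)%N -> w (bvec i) (bvec j) = w' (bvec i) (bvec j)) ->
  forall u v, w u v = w' u v.
Proof.
move=> Hw Hw' ww' u v; rewrite (rV_eq_sum u) (rV_eq_sum v).
rewrite (form2_suml _ _ _ _ Hw) (form2_suml _ _ _ _ Hw'); apply: eq_bigr => i _; congr (_ * _).
rewrite (form2_sumr _ _ _ _ Hw) (form2_sumr _ _ _ _ Hw'); apply: eq_bigr => j _; congr (_ * _).
have [ij|ji|/val_inj ->] := ltngtP i j; first exact: ww'.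
  by rewrite form2_opp // ww' // [RHS]form2_opp.
by have [-> _ _] := Hw; have [-> _ _] := Hw'.
Qed.

Lemma is_form2_wedge11 s t :
  (forall (c : R) u v, s (c *: u + v) = c * s u + s v) ->
  (forall (c : R) u v, t (c *: u + v) = c * t u + t v) -> is_form2 (wedge11 s t).
Proof.
move=> sl tl; rewrite /wedge11; split=> [u|c u v z|c u v z]; rewrite ?sl ?tl; first by rewrite subrr.
  by move: (s _) (s _) (s _) (t _) (t _) (t _) => *; ring.
by move: (s _) (s _) (s _) (t _) (t _) (t _) => *; ring.
Qed.

Lemma is_form2_add w w' : is_form2 w -> is_form2 w' -> is_form2 (fun u v => w u v + w' u v).
Proof.
move=> [w0 wl wr] [w0' wl' wr']; split=> [u|d u v z|d u v z].
- by rewrite w0 w0' addr0.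
- by rewrite wl wl' mulrDr addrACA.
- by rewrite wr wr' mulrDr addrACA.
Qed.

Lemma is_form2_scale w (c : R) : is_form2 w -> is_form2 (fun u v => c * w u v).
Proof.
move=> [w0 wl wr]; split=> [u|d u v z|d u v z].
- by rewrite w0 mulr0.
- by rewrite wl mulrDr mulrCA.
- by rewrite wr mulrDr mulrCA.
Qed.

Lemma is_form2_opp w : is_form2 w -> is_form2 (fun u v => - w u v).
Proof.
move=> [w0 wl wr]; split=> [u|d u v z|d u v z].
- by rewrite w0 oppr0.
- by rewrite wl opprD mulrN.
- by rewrite wr opprD mulrN.
Qed.

End Forms2.

(** * Cartan's structure equations for a general coframe *)

Section MovingFrame.
Context {R : realType} {n : nat}.
Variables (M : set 'rV[R]_n) (t : 'I_n -> 'I_n -> 'rV[R]_n -> R).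
Variables (E : 'I_n -> vfield R n) (w : 'I_n -> 'I_n -> 'I_n -> 'rV[R]_n -> R).
Hypothesis M_open : open M.
Hypothesis ct : forall m k j, Ck M m (t k j).
Hypothesis cw : forall m k l j, Ck M m (w k l j).

Let th k := covec (t k).
Let om k l := covec (w k l).

Definition frame_metric : field2 R n := fun p u v => \sum_k covec (t k) p u * covec (t k) p v.

Let g := frame_metric.

Hypothesis E_dual : forall p i j, M p -> th i p (E j p) = (i == j)%:R.
Hypothesis om_skew : forall k l p v, M p -> om k l p v = - om l k p v.
Hypothesis structure1 : forall k (i j : 'I_n) p, (i < j)%N -> M p ->
  pd i (t k j) p - pd j (t k i) p
  + \sum_l (w k l i p * t l j p - w k l j p * t l i p) = 0.

Let T p : 'M[R]_n := \matrix_(k, j) t k j p.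
Let Emx p : 'M[R]_n := \matrix_(j, i) E i p 0 j.

Let TE p : M p -> T p *m Emx p = 1%:M.
Proof.
move=> Mp; apply/matrixP => k i; rewrite !mxE -(E_dual _ _ Mp).
by apply: eq_bigr => j _; rewrite !mxE.
Qed.

Let ET p : M p -> Emx p *m T p = 1%:M.
Proof. by move=> Mp; exact: mulmx1C (TE Mp). Qed.

Lemma frame_expansion p v : M p -> v = \sum_k th k p v *: E k p.
Proof.
move=> Mp; apply/rowP => j; have := ET Mp => /(congr1 (fun X : 'M[R]_n => (X *m trmx v) j 0)).
rewrite mul1mx [RHS]mxE => <-; rewrite summxE -mulmxA mxE; apply: eq_bigr => k _.
rewrite !mxE mulrC; congr (_ * _); apply: eq_bigr => i _.
by rewrite !mxE.
Qed.

Lemma frame_metric_E p v k : M p -> g p v (E k p) = th k p v.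
Proof.
move=> Mp; rewrite /g /frame_metric (bigD1 k) //= big1 ?addr0 => [|l lk].
  by rewrite [X in _ * X](E_dual _ _ Mp) eqxx mulr1.
by rewrite [X in _ * X](E_dual _ _ Mp) (negbTE lk) mulr0.
Qed.

Lemma frame_ext p u v : M p -> (forall k, th k p u = th k p v) -> u = v.
Proof.
by move=> Mp uv; rewrite (frame_expansion u Mp) (frame_expansion v Mp);
  apply: eq_bigr => k _; rewrite uv.
Qed.

(** The frame is given only as the dual of the coframe; its regularity is that of an inverse
    matrix. *)
Lemma Ck_frame m k j : Ck M m (fun q => E k q 0 j).
Proof.
apply: (Ck_eq M_open (f := fun q => invmx (T q) j k)) => [q Mq|].
  have uT : T q \in unitmx by have [] := mulmx1_unit (TE Mq).
  have -> : invmx (T q) = Emx q by rewrite -[LHS]mulmx1 -(TE Mq) mulmxA mulVmx // mul1mx.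
  by rewrite mxE.
apply: (Ck_invmx M_open) => [a b|p Mp].
  by apply: (Ck_eq M_open _ (ct m a b)) => q _; rewrite mxE.
by have [] := mulmx1_unit (TE Mp).
Qed.

Let dt p k j : M p -> differentiable (t k j) p.
Proof. by move=> Mp; exact: Ck_differentiable (ct 0 k j) Mp. Qed.

(* theta_k (nabla_(d_i) d_j) *)
Let G p k i j := pd i (t k j) p + \sum_l w k l i p * t l j p.

(** Absence of torsion, read off from the first structure equation. *)
Let G_sym p k i j : M p -> G p k i j = G p k j i.
Proof.
move=> Mp; wlog ij : i j / (i < j)%N => [IH|].
  have [/IH //|/IH -> //|/val_inj -> //] := ltngtP i j.
have := structure1 k ij Mp; rewrite sumrB /G.
move: (pd i _ _) (pd j _ _) (\sum_l _) (\sum_l _) => x y z s E1.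
by apply/eqP; rewrite -subr_eq0 -E1; apply/eqP; ring.
Qed.

Let metric_bvec p a b : g p (bvec a) (bvec b) = \sum_k t k a p * t k b p.
Proof. by apply: eq_bigr => k _; rewrite !covec_bvec. Qed.

(** Compatibility with the metric: the connection terms contained in [G] cancel in pairs because the
    connection matrix is skew. *)
Let pd_metric p i j l : M p ->
  pd i (fun q => g q (bvec j) (bvec l)) p = \sum_k (G p k i j * t k l p + t k j p * G p k i l).
Proof.
move=> Mp.
have -> : (fun q => g q (bvec j) (bvec l)) = \sum_(k < n) (fun q => t k j q * t k l q).
  by apply/funext => q; rewrite metric_bvec fct_sumE.
have H : is_derive p (bvec i) (\sum_(k < n) (fun q => t k j q * t k l q))
    (\sum_(k < n) (t k j p * pd i (t k l) p + t k l p * pd i (t k j) p)).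
  apply: is_derive_sum => k.
  have D1 := @derivableP _ _ _ _ _ (bvec i) (diff_derivable (v := bvec i) (dt k j Mp)).
  have D2 := @derivableP _ _ _ _ _ (bvec i) (diff_derivable (v := bvec i) (dt k l Mp)).
  exact: is_deriveM D1 D2.
rewrite /pd (derive_val (is_derive := H)).
have skew : \sum_k ((\sum_m w k m i p * t m j p) * t k l p
    + t k j p * (\sum_m w k m i p * t m l p)) = 0.
  rewrite big_split /=.
  under eq_bigr do rewrite mulr_suml.
  under [X in _ + X]eq_bigr do rewrite mulr_sumr.
  rewrite exchange_big -big_split big1 //= => k _.
  rewrite -big_split big1 //= => m _.
  have := om_skew m k (bvec i) Mp; rewrite /om !covec_bvec => ->.
  by move: (w k m i p) (t k j p) (t m l p) => *; ring.
apply: etrans (esym (addr0 _)) _; rewrite -[X in _ + X]skew. rewrite -big_split; apply: eq_bigr => k _ /=.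
rewrite /G; move: (pd i (t k l) p) (pd i (t k j) p) (\sum_m _) (\sum_m _) (t k j p) (t k l p).
by move=> *; ring.
Qed.

(** Koszul's argument: symmetry of [G] and metric compatibility collapse the three derivatives of
    the metric to twice the sum over m of [t m l p * G p m i j]. The Gram matrix is the transpose of
    [T] times [T], so multiplying by [T] removes its inverse. *)
Lemma christoffel_frame p k i j : M p ->
  \sum_a t k a p * christoffel g p a i j = G p k i j.
Proof.
move=> Mp.
have gramE : gram g p = (T p)^T *m T p.
  by apply/matrixP => a b; rewrite !mxE metric_bvec; apply: eq_bigr => l _; rewrite !mxE.
have uT : T p \in unitmx by have [] := mulmx1_unit (TE Mp).
have chE a : christoffel g p a i j = \sum_l invmx (gram g p) a l * \sum_m t m l p * G p m i j.
  rewrite /christoffel mulr_sumr; apply: eq_bigr => l _.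
  rewrite mulrCA; congr (_ * _); rewrite !pd_metric // -!big_split -sumrB mulr_sumr.
  apply: eq_bigr => m _ /=.
  rewrite (G_sym m j i) // (G_sym m l i) // (G_sym m l j) //.
  move: (G p m i j) (G p m i l) (G p m j l) (t m l p) (t m j p) (t m i p) => *; by field.
have -> : \sum_a t k a p * christoffel g p a i j
    = (T p *m (invmx (gram g p) *m ((T p)^T *m \col_m G p m i j))) k 0.
  rewrite mxE; apply: eq_bigr => a _; rewrite chE !mxE; congr (_ * _).
  by apply: eq_bigr => l _; rewrite !mxE; congr (_ * _); apply: eq_bigr => m _; rewrite !mxE.
have -> : invmx (gram g p) = invmx (T p) *m invmx (T p)^T.
  have uTT : (T p)^T \in unitmx by rewrite unitmx_tr.
  apply: (can_inj (mulKmx (_ : gram g p \in unitmx))).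
    by rewrite gramE unitmx_mul uTT.
  by rewrite mulmxV ?gramE ?unitmx_mul ?uTT // -mulmxA mulKVmx // mulmxV.
by rewrite -!mulmxA mulKmx ?unitmx_tr // mulKVmx // mxE.
Qed.

(** Identifies [om] as the Levi-Civita connection forms, so that covariant derivatives can be
    computed in the frame. *)
Lemma nabla_frame (X Y : vfield R n) p k : M p ->
  (forall j, differentiable (fun q => Y q 0 j) p) ->
  th k p (nabla g X Y p) =
    'D_(X p) (fun q => th k q (Y q)) p + \sum_l om k l p (X p) * th l p (Y p).
Proof.
move=> Mp dY.
have dtk j : differentiable (t k j) p by exact: dt.
rewrite (derive_val (is_derive := is_derive_covec (X p) dtk dY)).
rewrite {1}/th /covec.
have -> : \sum_j t k j p * nabla g X Y p 0 j =
   \sum_j t k j p * 'D_(X p) (fun q => Y q 0 j) p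
   + \sum_i \sum_j G p k i j * X p 0 i * Y p 0 j.
  under eq_bigr do rewrite mxE mulrDr.
  rewrite big_split; congr (_ + _).
  under eq_bigr do rewrite mulr_sumr.
  rewrite exchange_big; apply: eq_bigr => i _.
  under eq_bigr do rewrite mulr_sumr.
  rewrite exchange_big; apply: eq_bigr => j _.
  rewrite -(christoffel_frame k i j Mp) !mulr_suml; apply: eq_bigr => a _.
  by rewrite !mulrA.
rewrite big_split /= [LHS]addrC [RHS]addrAC; congr (_ + _).
have -> : \sum_j 'D_(X p) (t k j) p * Y p 0 j = \sum_i \sum_j pd i (t k j) p * X p 0 i * Y p 0 j.
  rewrite exchange_big; apply: eq_bigr => j _; rewrite derive_pd // mulr_suml.
  by apply: eq_bigr => i _; rewrite [X p 0 i * _]mulrC.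
have -> : \sum_l om k l p (X p) * th l p (Y p)
    = \sum_i \sum_j (\sum_l w k l i p * t l j p) * X p 0 i * Y p 0 j.
  rewrite /om /th /covec.
  under eq_bigr do rewrite mulr_suml.
  rewrite exchange_big; apply: eq_bigr => i _.
  under eq_bigr do rewrite mulr_sumr.
  rewrite exchange_big; apply: eq_bigr => j _.
  rewrite !mulr_suml; apply: eq_bigr => l _; rewrite -!mulrA; congr (_ * _).
  by rewrite mulrCA.
rewrite -big_split; apply: eq_bigr => i _; rewrite -big_split; apply: eq_bigr => j _ /=.
by rewrite /G !mulrDl.
Qed.

(** The two-form d omega + omega /\ omega, where d is evaluated on constant vector fields. *)
Definition curvature_form k m (p u v : 'rV[R]_n) : R :=
  'D_u (fun q => covec (w k m) q v) p - 'D_v (fun q => covec (w k m) q u) p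
  + \sum_l (covec (w k l) p u * covec (w l m) p v - covec (w k l) p v * covec (w l m) p u).

Lemma is_form2_curvature_form k m p : M p -> is_form2 (curvature_form k m p).
Proof.
move=> Mp; have dw k' l j : differentiable (w k' l j) p by exact: Ck_differentiable (cw 0 k' l j) Mp.
have D c1 c2 : 'D_c1 (fun q => covec (w k m) q c2) p = \sum_j \sum_i c1 0 i * (pd i (w k m j) p * c2 0 j).
  rewrite derive_covec //; apply: eq_bigr => j _; rewrite derive_pd // mulr_suml.
  by apply: eq_bigr => i _; rewrite mulrA.
have Dl (c : R) c1 c2 c3 : 'D_(c *: c1 + c2) (fun q => covec (w k m) q c3) p =
    c * 'D_c1 (fun q => covec (w k m) q c3) p + 'D_c2 (fun q => covec (w k m) q c3) p.
  rewrite !D mulr_sumr -big_split; apply: eq_bigr => j _.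
  rewrite mulr_sumr -big_split; apply: eq_bigr => i _ /=.
  by rewrite !mxE; move: (pd _ _ _) => *; ring.
have Dr (c : R) c1 c2 c3 : 'D_c3 (fun q => covec (w k m) q (c *: c1 + c2)) p =
    c * 'D_c3 (fun q => covec (w k m) q c1) p + 'D_c3 (fun q => covec (w k m) q c2) p.
  rewrite !D mulr_sumr -big_split; apply: eq_bigr => j _.
  rewrite mulr_sumr -big_split; apply: eq_bigr => i _ /=.
  by rewrite !mxE; move: (pd _ _ _) => *; ring.
rewrite /curvature_form; split=> [u|c u v z|c u v z].
- by rewrite subrr add0r big1 // => l _; rewrite subrr.
- rewrite Dl Dr; under eq_bigr do rewrite !covecD !covecZ.
  have -> : \sum_l ((c * covec (w k l) p u + covec (w k l) p v) * covec (w l m) p z -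
      covec (w k l) p z * (c * covec (w l m) p u + covec (w l m) p v)) =
    c * (\sum_l (covec (w k l) p u * covec (w l m) p z - covec (w k l) p z * covec (w l m) p u))
    + \sum_l (covec (w k l) p v * covec (w l m) p z - covec (w k l) p z * covec (w l m) p v).
    rewrite mulr_sumr -big_split; apply: eq_bigr => l _ /=.
    by move: (covec _ _ _) (covec _ _ _) (covec _ _ _) (covec _ _ _) (covec _ _ _) (covec _ _ _) => *; ring.
  move: ('D_u _ _) ('D_v _ _) ('D_z _ _) ('D_z _ _) (\sum_l _) (\sum_l _) => *; ring.
- rewrite Dl Dr; under eq_bigr do rewrite !covecD !covecZ.
  have -> : \sum_l (covec (w k l) p z * (c * covec (w l m) p u + covec (w l m) p v) -
      (c * covec (w k l) p u + covec (w k l) p v) * covec (w l m) p z) =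
    c * (\sum_l (covec (w k l) p z * covec (w l m) p u - covec (w k l) p u * covec (w l m) p z))
    + \sum_l (covec (w k l) p z * covec (w l m) p v - covec (w k l) p v * covec (w l m) p z).
    rewrite mulr_sumr -big_split; apply: eq_bigr => l _ /=.
    by move: (covec _ _ _) (covec _ _ _) (covec _ _ _) (covec _ _ _) (covec _ _ _) (covec _ _ _) => *; ring.
  move: ('D_u _ _) ('D_v _ _) ('D_z _ _) ('D_z _ _) (\sum_l _) (\sum_l _) => *; ring.
Qed.

(** Needed to apply [nabla_frame] a second time, to a field that is itself a covariant
    derivative. *)
Let nabla_cst_diff v z p : M p ->
  forall j, differentiable (fun q => nabla g (cst v) (cst z) q 0 j) p.
Proof.
move=> Mp j.
pose f q := \sum_k ('D_v (fun q => th k q z) q + \sum_l om k l q v * th l q z) * E k q 0 j.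
have cf : Ck M 0 f.
  apply: (Ck_sum M_open) => k; apply: (CkM M_open); last exact: Ck_frame.
  apply: (CkD M_open).
    by apply: Ck_derive => //; apply: Ck_covec.
  apply: (Ck_sum M_open) => l; by apply: (CkM M_open); apply: Ck_covec.
apply: (eq_on_differentiable M_open _ Mp) (Ck_differentiable cf Mp) => q Mq.
rewrite [in RHS](frame_expansion (nabla g (cst v) (cst z) q) Mq) summxE.
apply: eq_bigr => k _; rewrite mxE nabla_frame // => i; exact: differentiable_cst.
Qed.

(** The second structure equation. After two uses of [nabla_frame] the second derivatives of [th]
    cancel by symmetry and the first derivatives cancel in pairs; the curvature form is what
    remains. *)
Lemma riem_frame p u v z y : M p ->
  riem g p u v z y = \sum_k (\sum_m curvature_form k m p u v * th m p z) * th k p y.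
Proof.
move=> Mp; apply: eq_bigr => k _; congr (_ * _).
have dc (c : 'rV[R]_n) j : differentiable (fun q : 'rV[R]_n => (cst c q : 'rV[R]_n) 0 j) p.
  exact: differentiable_cst.
have Mnear := near_open M_open Mp.
rewrite /curvature covecD covecN covecD covecN -/(th k).
have -> : nabla g (lie_bracket (cst u) (cst v)) (cst z) p = 0.
  have L0 : lie_bracket (cst u) (cst v) p = 0 :> 'rV[R]_n.
    by apply/rowP => j; rewrite !mxE !derive_cst subr0.
  apply/rowP => j; rewrite !mxE L0 derive0 add0r big1 // => i _.
  by rewrite big1 // => i' _; rewrite mxE mulr0 mul0r.
rewrite -/(th k) [th k p 0]covec0 subr0 !nabla_frame //; try exact: nabla_cst_diff.
have cth l q : Ck M 2 (fun p => th l p q) by apply: Ck_covec.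
have com l m q : Ck M 2 (fun p => om l m p q) by apply: Ck_covec.
have D c1 c2 : 'D_c1 (fun q => th k q (nabla g (cst c2) (cst z) q)) p =
   'D_c1 (fun q => 'D_c2 (fun q => th k q z) q) p
   + \sum_l ('D_c1 (fun q => om k l q c2) p * th l p z + om k l p c2 * 'D_c1 (fun q => th l q z) p).
  have -> : 'D_c1 (fun q => th k q (nabla g (cst c2) (cst z) q)) p =
      'D_c1 ((fun q => 'D_c2 (fun q => th k q z) q) + \sum_(l < n) (fun q => om k l q c2 * th l q z)) p.
    apply: (eq_on_derive M_open) => // q Mq; rewrite fctE fct_sumE nabla_frame // => j.
    exact: differentiable_cst.
  have d1 : differentiable (fun q => 'D_c2 (fun q => th k q z) q) p.
    exact: Ck_differentiable (Ck_derive c2 M_open (cth k z)) Mp.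
  have D1 := @derivableP _ _ _ _ _ c1 (diff_derivable (v := c1) d1).
  have H : is_derive p c1 (\sum_(l < n) (fun q => om k l q c2 * th l q z))
      (\sum_(l < n) (om k l p c2 * 'D_c1 (fun q => th l q z) p + th l p z * 'D_c1 (fun q => om k l q c2) p)).
    apply: is_derive_sum => l.
    have D2 := @derivableP _ _ _ _ _ c1 (diff_derivable (v := c1) (Ck_differentiable (com k l c2) Mp)).
    have D3 := @derivableP _ _ _ _ _ c1 (diff_derivable (v := c1) (Ck_differentiable (cth l z) Mp)).
    exact: is_deriveM D2 D3.
  rewrite (derive_val (is_derive := is_deriveD D1 H)); congr (_ + _).
  by apply: eq_bigr => l _; rewrite addrC [th l p z * _]mulrC.
rewrite !D (derive_comm v u M_open (cth k z) Mp).
have S c1 c2 : \sum_l om k l p c1 * th l p (nabla g (cst c2) (cst z) p) =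
    \sum_l om k l p c1 * 'D_c2 (fun q => th l q z) p
    + \sum_m (\sum_l om k l p c1 * om l m p c2) * th m p z.
  under eq_bigr do rewrite nabla_frame // mulrDr.
  rewrite big_split; congr (_ + _).
  under eq_bigr do rewrite mulr_sumr.
  rewrite exchange_big; apply: eq_bigr => m _.
  by rewrite mulr_suml; apply: eq_bigr => l _; rewrite mulrA.
rewrite !S.
have cancel (x y1 y2 z1 z2 t1 t2 : R) : x + y1 + (z1 + t1) - (x + y2 + (z2 + t2))
  = y1 + z1 + t1 - (y2 + z2 + t2) by ring.
rewrite {}cancel -!big_split -sumrB; apply: eq_bigr => m _ /=.
rewrite /curvature_form sumrB.
rewrite -/(om k m) -/(th m).
move: ('D_u (fun q => om k m q v) p) ('D_v (fun q => om k m q u) p) (\sum_l _) (\sum_l _).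
move: ('D_u (fun q => th m q z) p) ('D_v (fun q => th m q z) p) (th m p z) (om k m p u) (om k m p v).
by move=> *; ring.
Qed.

End MovingFrame.

(** * Coframe and connection forms of the metric *)

Section Ordinals4.

Lemma ord4_ind (P : 'I_4 -> Prop) : P o1 -> P o2 -> P o3 -> P o4 -> forall i, P i.
Proof.
move=> P1 P2 P3 P4 [[|[|[|[|//]]]] Hi].
- by have -> : Ordinal Hi = o1 by exact: val_inj.
- by have -> : Ordinal Hi = o2 by exact: val_inj.
- by have -> : Ordinal Hi = o3 by exact: val_inj.
- by have -> : Ordinal Hi = o4 by exact: val_inj.
Qed.

Lemma sum4 (V : nmodType) (F : 'I_4 -> V) : \sum_i F i = F o1 + F o2 + F o3 + F o4.
Proof.
rewrite !big_ord_recl big_ord0 addr0 !addrA.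
by congr (_ + _ + _ + _); congr F; exact: val_inj.
Qed.

Lemma sum2 (V : nmodType) (F : 'I_2 -> V) :
  \sum_i F i = F (@Ordinal 2 0 isT) + F (@Ordinal 2 1 isT).
Proof.
rewrite !big_ord_recl big_ord0 addr0.
by congr (_ + _); congr F; exact: val_inj.
Qed.

End Ordinals4.

Section Hyperbolic.
Context {R : realType}.
Implicit Types x : R.

Lemma cosh_gt0 x : 0 < cosh x.
Proof. by rewrite /cosh divr_gt0 // addr_gt0 // expR_gt0. Qed.

Lemma cosh_neq0 x : cosh x != 0.
Proof. by rewrite gt_eqF // cosh_gt0. Qed.

Lemma cosh_sq x : cosh x ^+ 2 = 1 + sinh x ^+ 2.
Proof.
rewrite /cosh /sinh expRN; have := expR_gt0 x; rewrite lt0r => /andP[].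
by move: (expR x) => y y0 _; field.
Qed.

Lemma cosh_double x : cosh (2 * x) = 1 + 2 * sinh x ^+ 2.
Proof.
rewrite /cosh /sinh (_ : 2 * x = x + x) ?mulr_natl ?mulr2n // !expRN expRD.
have := expR_gt0 x; rewrite lt0r => /andP[].
by move: (expR x) => y y0 _; field.
Qed.

Lemma sinh_double x : sinh (2 * x) = 2 * sinh x * cosh x.
Proof.
rewrite /cosh /sinh (_ : 2 * x = x + x) ?mulr_natl ?mulr2n // !expRN expRD.
have := expR_gt0 x; rewrite lt0r => /andP[].
by move: (expR x) => y y0 _; field.
Qed.

Lemma sinh_neq0 x : x != 0 -> sinh x != 0.
Proof.
apply: contra_neq => /eqP; rewrite /sinh mulf_eq0 invr_eq0 pnatr_eq0 orbF subr_eq0.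
by move=> /eqP /expR_inj; lra.
Qed.

Lemma is_derive_expRN x : is_derive x 1 (fun y : R => expR (- y)) (- expR (- x)).
Proof.
have D : is_derive x 1 (fun y : R => - y) (-1) := is_deriveN (is_derive_id x 1).
apply: is_derive_eq (@is_derive1_comp R expR (fun y => - y) x _ _ (is_derive_expR (- x)) D) _.
by rewrite mulrN1.
Qed.

Lemma is_derive_cosh x : is_derive x 1 (@cosh R) (sinh x).
Proof.
have D := is_deriveM (is_deriveD (is_derive_expR x) (is_derive_expRN x)) (is_derive_cst (2^-1 : R) x 1).
by apply: is_derive_eq D _; rewrite scaler0 add0r /sinh [LHS]mulrC.
Qed.

Lemma is_derive_sinh x : is_derive x 1 (@sinh R) (cosh x).
Proof.
have D := is_deriveM (is_deriveB (is_derive_expR x) (is_derive_expRN x)) (is_derive_cst (2^-1 : R) x 1).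
by apply: is_derive_eq D _; rewrite scaler0 add0r opprK /cosh [LHS]mulrC.
Qed.

End Hyperbolic.

(* Pointwise forms of the derivation rules, to which [apply] unifies. *)
Section PointwiseRules.
Context {R : realType} {V : normedModType R}.
Implicit Types (f g : V -> R) (p v : V).

Lemma pder_add f g p v df dg : is_derive p v f df -> is_derive p v g dg ->
  is_derive p v (fun q => f q + g q) (df + dg).
Proof. exact: is_deriveD. Qed.

Lemma pder_opp f p v df : is_derive p v f df -> is_derive p v (fun q => - f q) (- df).
Proof. exact: is_deriveN. Qed.

Lemma pder_mul f g p v df dg : is_derive p v f df -> is_derive p v g dg ->
  is_derive p v (fun q => f q * g q) (f p * dg + g p * df).
Proof. exact: is_deriveM. Qed.

Lemma pder_sqr f p v df : is_derive p v f df ->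
  is_derive p v (fun q => f q ^+ 2) (2 * f p * df).
Proof.
move=> D; apply: is_derive_eq (is_deriveM D D) _.
by rewrite -mulrDl mulr_natl mulr2n.
Qed.

Lemma pder_cst (c : R) p v : is_derive p v (fun=> c) 0.
Proof. exact: is_derive_cst. Qed.

End PointwiseRules.

Section Metric.
Context {R : realType}.
Variables (a : R) (U : set 'rV[R]_2) (h H : 'rV[R]_2 -> R).
Hypotheses (a_neq0 : a != 0) (U_open : open U) (h_smooth : smooth_on U h) (H_smooth : smooth_on U H).
Hypotheses (h_gt0 : forall q, U q -> 0 < h q) (H_gt0 : forall q, U q -> 0 < H q).
Hypothesis H_eq : forall q, U q ->
  laplacian (lnf H) q = - 2 * a ^+ 2 * h q ^+ 2 + 4 * a ^+ 2 * H q ^+ 2.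

Let M := domM U.

Let differentiable_xy (p : 'rV[R]_4) k : differentiable (fun q => xy q 0 k) p.
Proof.
have -> : (fun q : 'rV[R]_4 => xy q 0 k) = (fun q => q 0 (nth o1 [:: o1; o2] k)).
  by apply/funext => q; rewrite mxE; case: k => [[|[|]]].
exact: differentiable_coord.
Qed.

Lemma domM_open : open M.
Proof.
rewrite openE => p [Uxy zp]; rewrite /interior.
have cxy : {for p, continuous (@xy R)}.
  by apply/differentiable_continuous/differentiable_rowfun => k.
have n1 : \forall q \near p, U (xy q) by apply: (cxy U); exact: open_nbhs_nbhs.
have cz : {for p, continuous (@zc R)}.
  by apply: differentiable_continuous; exact: differentiable_coord.
have n2 : \forall q \near p, zc q < 0.
  have := cz [set x | x < 0]; apply; apply: open_nbhs_nbhs; split => //; exact: open_lt.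
exact: filterI n1 n2.
Qed.

Lemma Ck_xy k f : Ck U k f -> Ck M k (fun p => f (xy p)).
Proof.
move=> cf; apply: (Ck_comp (W := U) domM_open) => //; first by move=> p [].
move=> i; apply: (Ck_eq domM_open _ (Ck_coord domM_open k (nth o1 [:: o1; o2] i))) => q _.
by rewrite mxE; case: i => [[|[|]]].
Qed.

Lemma is_derive_xy f (p u : 'rV[R]_4) : differentiable f (xy p) ->
  is_derive p u (fun q => f (xy q)) (dx2 f (xy p) * u 0 o1 + dy2 f (xy p) * u 0 o2).
Proof.
move=> df; have [d1 d2] := derive_comp_rowfun u (differentiable_xy p) df.
apply: DeriveDef; first exact: diff_derivable.
rewrite d2 sum2 /dx2 /dy2.
have D k : 'D_u (fun q => xy q 0 k) p = u 0 (nth o1 [:: o1; o2] k).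
  have -> : (fun q : 'rV[R]_4 => xy q 0 k) = (fun q => q 0 (nth o1 [:: o1; o2] k)).
    by apply/funext => q; rewrite mxE; case: k => [[|[|]]].
  have /matrixP/(_ 0 (nth o1 [:: o1; o2] k)) := derive_mx (@derivable_id R 'rV[R]_4 p u).
  by rewrite derive_id [X in _ = X -> _]mxE => ->.
by rewrite !D /= [X in X + _]mulrC [X in _ + X]mulrC.
Qed.

Lemma is_derive_coord n (i : 'I_n) (p u : 'rV[R]_n) :
  is_derive p u (fun q : 'rV[R]_n => q 0 i) (u 0 i).
Proof.
apply: DeriveDef; first exact/diff_derivable/differentiable_coord.
have /matrixP/(_ 0 i) := derive_mx (@derivable_id R 'rV[R]_n p u).
by rewrite derive_id [X in _ = X -> _]mxE => ->.
Qed.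

End Metric.

Section Ck_hyperbolic.
Context {R : realType} {n : nat} (V : set 'rV[R]_n) (V_open : open V).

Lemma Ck_cosh k f : Ck V k f -> Ck V k (fun p => cosh (f p)).
Proof.
move=> cf; apply: (CkM V_open); last exact: Ck_cst.
by apply: (CkD V_open); apply: Ck_expR => //; exact: CkN.
Qed.

Lemma Ck_sinh k f : Ck V k f -> Ck V k (fun p => sinh (f p)).
Proof.
move=> cf; apply: (CkM V_open); last exact: Ck_cst.
by apply: (CkB V_open); apply: Ck_expR => //; exact: CkN.
Qed.

End Ck_hyperbolic.

Section ConnectionForms.
Context {R : realType}.
Variables (a : R) (h H : 'rV[R]_2 -> R).
Implicit Types (p u : 'rV[R]_4).

(** In these terms theta_3 = sinh(2az) [dt_form] - cosh(2az) H [rot_form], and the t-derivative of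
    [rot_form] is -2a H^-1 times the horizontal part H (sin(2at) dx + cos(2at) dy) subtracted from
    dz in theta_4. *)
Definition dt_form p u : R := u 0 o4 - l2 a H (xy p) * u 0 o1 - n2 a H (xy p) * u 0 o2.

Definition rot_form p u : R := cos (2 * a * tc p) * u 0 o1 - sin (2 * a * tc p) * u 0 o2.

(** The rotation omega_21. Its first two terms are the connection form of the surface metric h^2
    (dx^2 + dy^2); the others come from the fibre directions. *)
Definition psi_form p u : R :=
  - dy2 (lnf h) (xy p) * u 0 o1 + dx2 (lnf h) (xy p) * u 0 o2
  + 2 * a * sinh (a * zc p) ^+ 2 * dt_form p u
  - a * sinh (2 * a * zc p) * H (xy p) * rot_form p u.

Definition chi_form p u : R :=
  2 * a * cosh (2 * a * zc p) * dt_form p u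
  - 2 * a * sinh (2 * a * zc p) * H (xy p) * rot_form p u.

(* [a tanh(az)] times [theta1], resp. [theta2] *)
Definition mix_form (i : 'I_4) p u : R := a * sinh (a * zc p) * h (xy p) * u 0 i.

(** Entry (k, l) is omega_kl, in the convention that nabla E_l is the sum over k of omega_kl E_k. *)
Definition conn (k l : 'I_4) p u : R :=
  nth 0 (nth [::] [::
    [:: 0; - psi_form p u; - mix_form o2 p u; mix_form o1 p u];
    [:: psi_form p u; 0; mix_form o1 p u; mix_form o2 p u];
    [:: mix_form o2 p u; - mix_form o1 p u; 0; chi_form p u];
    [:: - mix_form o1 p u; - mix_form o2 p u; - chi_form p u; 0]] k) l.

Definition conn_coeffs (k l j : 'I_4) p : R := conn k l p (bvec j).

Definition coframe_coeffs (k j : 'I_4) p : R := coframe a h H k p (bvec j).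

Lemma coframe_covec k p u : coframe a h H k p u = covec (coframe_coeffs k) p u.
Proof.
rewrite /covec sum4 /coframe_coeffs; elim/ord4_ind: k; rewrite /coframe /=.
- by rewrite /theta1 !mxE /=; move: (cosh _) (h _) => *; ring.
- by rewrite /theta2 !mxE /=; move: (cosh _) (h _) => *; ring.
- rewrite /theta3 !mxE /=; move: (cosh _) (sinh _) (cos _) (sin _) (l2 _ _ _) (n2 _ _ _) (H _).
  by move=> *; ring.
- by rewrite /theta4 !mxE /=; move: (cos _) (sin _) (H _) => *; ring.
Qed.

Lemma conn_covec k l p u : conn k l p u = covec (conn_coeffs k l) p u.
Proof.
have Dt : dt_form p u = \sum_j dt_form p (bvec j) * u 0 j.
  by rewrite sum4 /dt_form !mxE /=; move: (l2 _ _ _) (n2 _ _ _) => *; ring.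
have Dr : rot_form p u = \sum_j rot_form p (bvec j) * u 0 j.
  by rewrite sum4 /rot_form !mxE /=; move: (cos _) (sin _) => *; ring.
have Dpsi : psi_form p u = \sum_j psi_form p (bvec j) * u 0 j.
  rewrite {1}/psi_form Dt Dr !sum4 /psi_form !mxE /=.
  move: (dt_form p _) (dt_form p _) (dt_form p _) (dt_form p _) (rot_form p _) (rot_form p _) (rot_form p _) (rot_form p _).
  by move: (dy2 _ _) (dx2 _ _) (sinh _) (sinh _) (H _) => *; ring.
have Dchi : chi_form p u = \sum_j chi_form p (bvec j) * u 0 j.
  rewrite {1}/chi_form Dt Dr !sum4 /chi_form.
  move: (dt_form p _) (dt_form p _) (dt_form p _) (dt_form p _) (rot_form p _) (rot_form p _) (rot_form p _) (rot_form p _).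
  by move: (cosh _) (sinh _) (H _) => *; ring.
have Dmix i : mix_form i p u = \sum_j mix_form i p (bvec j) * u 0 j.
  by rewrite sum4; elim/ord4_ind: i; rewrite /mix_form !mxE /=; move: (sinh _) (h _) => *; ring.
have neg (f : 'I_4 -> R) : - (\sum_j f j * u 0 j) = \sum_j - f j * u 0 j.
  by rewrite -sumrN; apply: eq_bigr => j _; rewrite mulNr.
have zero : 0 = \sum_(j < 4) (0 : R) * u 0 j by rewrite big1 // => j _; rewrite mul0r.
rewrite /covec /conn_coeffs; elim/ord4_ind: k; elim/ord4_ind: l; rewrite /conn /=;
  rewrite ?Dpsi ?Dchi ?Dmix ?neg //.
Qed.

Lemma metric_frame : metric a h H = frame_metric coframe_coeffs.
Proof.
apply/funext => p; apply/funext => u; apply/funext => v.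
by apply: eq_bigr => k _; rewrite !coframe_covec.
Qed.

End ConnectionForms.

(** * Smoothness and derivatives of the coframe and connection forms *)

Section Curvature.
Context {R : realType}.
Variables (a : R) (U : set 'rV[R]_2) (h H : 'rV[R]_2 -> R).
Hypotheses (a_neq0 : a != 0) (U_open : open U) (h_smooth : smooth_on U h) (H_smooth : smooth_on U H).
Hypotheses (h_gt0 : forall q, U q -> 0 < h q) (H_gt0 : forall q, U q -> 0 < H q).
Hypothesis H_eq : forall q, U q ->
  laplacian (lnf H) q = - 2 * a ^+ 2 * h q ^+ 2 + 4 * a ^+ 2 * H q ^+ 2.

Let M := domM U.
Let M_open : open M := domM_open U_open.

Let ch k : Ck U k h. Proof. exact: (smooth_onP _ _).1. Qed.
Let cH k : Ck U k H. Proof. exact: (smooth_onP _ _).1. Qed.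

Lemma Ck_lnf k f : (forall m, Ck U m f) -> (forall q, U q -> 0 < f q) -> Ck U k (lnf f).
Proof. by move=> cf f0; exact: Ck_ln. Qed.

Lemma Ck_dx2 k f : Ck U k.+1 f -> Ck U k (dx2 f).
Proof. exact: Ck_pd. Qed.

Lemma Ck_dy2 k f : Ck U k.+1 f -> Ck U k (dy2 f).
Proof. exact: Ck_pd. Qed.

Let clnh k : Ck U k (lnf h) := Ck_lnf k ch h_gt0.
Let clnH k : Ck U k (lnf H) := Ck_lnf k cH H_gt0.

Lemma Ck_l2 k : Ck U k (l2 a H).
Proof. by apply: (CkM U_open); [exact: Ck_cst|exact: Ck_dy2]. Qed.

Lemma Ck_n2 k : Ck U k (n2 a H).
Proof. by apply: (CkM U_open); [exact: Ck_cst|exact: Ck_dx2]. Qed.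

Ltac Ckt := repeat match goal with
  | |- Ck _ _ (fun q => _ + _) => apply: (CkD M_open)
  | |- Ck _ _ (fun q => - _) => apply: (CkN M_open)
  | |- Ck _ _ (fun q => cosh _ ) => apply: (Ck_cosh M_open)
  | |- Ck _ _ (fun q => sinh _ ) => apply: (Ck_sinh M_open)
  | |- Ck _ _ (fun q => cos _ ) => apply: (proj1 (Ck_trig M_open _))
  | |- Ck _ _ (fun q => sin _ ) => apply: (proj2 (Ck_trig M_open _))
  | |- Ck _ _ (fun q => _ ^+ 2) => apply: (CkX M_open)
  | |- Ck _ _ (fun q => _ * _) => apply: (CkM M_open)
  | |- Ck _ _ (@zc _) => exact: (Ck_coord M_open _ o3)
  | |- Ck _ _ (@tc _) => exact: (Ck_coord M_open _ o4)
  | |- Ck _ _ (fun q => h (xy q)) => exact: (Ck_xy U_open (ch _))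
  | |- Ck _ _ (fun q => H (xy q)) => exact: (Ck_xy U_open (cH _))
  | |- Ck _ _ (fun q => l2 _ _ (xy q)) => exact: (Ck_xy U_open (Ck_l2 _))
  | |- Ck _ _ (fun q => n2 _ _ (xy q)) => exact: (Ck_xy U_open (Ck_n2 _))
  | |- Ck _ _ (fun q => dx2 (lnf h) (xy q)) => exact: (Ck_xy U_open (Ck_dx2 (clnh _)))
  | |- Ck _ _ (fun q => dy2 (lnf h) (xy q)) => exact: (Ck_xy U_open (Ck_dy2 (clnh _)))
  | |- Ck _ _ (fun q => _) => exact: Ck_cst
  end.

Lemma Ck_coframe_coeffs m k j : Ck M m (coframe_coeffs a h H k j).
Proof.
rewrite /coframe_coeffs; elim/ord4_ind: k; rewrite /coframe /= /theta1 /theta2 /theta3 /theta4; Ckt.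
Qed.

Lemma Ck_conn_coeffs m k l j : Ck M m (conn_coeffs a h H k l j).
Proof.
rewrite /conn_coeffs; elim/ord4_ind: k; elim/ord4_ind: l;
  rewrite /conn /= /psi_form /chi_form /mix_form /dt_form /rot_form; Ckt.
Qed.

Section AtPoint.
Variables (p : 'rV[R]_4) (Mp : M p).
Implicit Types u v : 'rV[R]_4.

Let Up : U (xy p). Proof. by case: Mp. Qed.

Local Notation ca := (cosh (a * zc p)).
Local Notation sa := (sinh (a * zc p)).
Local Notation Ca := (cosh (2 * a * zc p)).
Local Notation Sa := (sinh (2 * a * zc p)).
Local Notation kt := (cos (2 * a * tc p)).
Local Notation st := (sin (2 * a * tc p)).
Local Notation hp := (h (xy p)).
Local Notation Hp := (H (xy p)).
Local Notation lx := (dx2 (lnf h) (xy p)).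
Local Notation ly := (dy2 (lnf h) (xy p)).
Local Notation lp := (l2 a H (xy p)).
Local Notation np := (n2 a H (xy p)).

(** Differentials are expressed through logarithmic derivatives, with d ln H = 2a (n2 dx - l2 dy).
    No quotient by h or H then enters the structure equations, and [ring] can decide them. *)
Definition dh u : R := hp * (lx * u 0 o1 + ly * u 0 o2).
Definition dH u : R := Hp * (2 * a * np * u 0 o1 - 2 * a * lp * u 0 o2).
Definition d2 (f : 'rV[R]_2 -> R) u : R := dx2 f (xy p) * u 0 o1 + dy2 f (xy p) * u 0 o2.

Let is_derive_lnf f i : (forall q, U q -> 0 < f q) -> Ck U 0 f ->
  pd i (lnf f) (xy p) = (f (xy p))^-1 * pd i f (xy p).
Proof.
move=> f0 cf; rewrite /pd.
by have [_ ->] := derive_comp1 (bvec i) (is_derive1_ln (f0 _ Up)) (Ck_differentiable cf Up).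
Qed.

Lemma pder_h u : is_derive p u (fun q => h (xy q)) (dh u).
Proof.
apply: is_derive_eq (is_derive_xy u (Ck_differentiable (ch 0) Up)) _.
have h0 : hp != 0 by rewrite gt_eqF // h_gt0.
rewrite /dh /dx2 /dy2 !(is_derive_lnf _ h_gt0 (ch 0)).
by move: (pd _ _ _) (pd _ _ _) (h _) h0 => x y z z0; field.
Qed.

Lemma pder_H u : is_derive p u (fun q => H (xy q)) (dH u).
Proof.
apply: is_derive_eq (is_derive_xy u (Ck_differentiable (cH 0) Up)) _.
have h0 : Hp != 0 by rewrite gt_eqF // H_gt0.
rewrite /dH /l2 /n2 /dx2 /dy2 !(is_derive_lnf _ H_gt0 (cH 0)).
by move: (pd _ _ _) (pd _ _ _) (H _) h0 => x y z z0; field; rewrite z0 a_neq0.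
Qed.

Lemma pder_xy f u : Ck U 0 f -> is_derive p u (fun q => f (xy q)) (d2 f u).
Proof. by move=> cf; exact: is_derive_xy (Ck_differentiable cf Up). Qed.

Let is_derive_scale (c : R) (i : 'I_4) u :
  is_derive p u (fun q : 'rV[R]_4 => c * q 0 i) (c * u 0 i).
Proof.
apply: is_derive_eq (pder_mul (pder_cst c p u) (is_derive_coord i p u)) _.
by rewrite mulr0 addr0.
Qed.

Let pder_comp (phi dphi : R -> R) (c : R) (i : 'I_4) u :
  (forall x : R, is_derive x 1 phi (dphi x)) ->
  is_derive p u (fun q : 'rV[R]_4 => phi (c * q 0 i)) (dphi (c * p 0 i) * (c * u 0 i)).
Proof.
move=> Hphi; exact: is_derive_comp1 (Hphi _) (is_derive_scale c i u).
Qed.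

Lemma pder_cosh c u : is_derive p u (fun q => cosh (c * zc q)) (sinh (c * zc p) * (c * u 0 o3)).
Proof. exact: pder_comp (@is_derive_cosh R). Qed.

Lemma pder_sinh c u : is_derive p u (fun q => sinh (c * zc q)) (cosh (c * zc p) * (c * u 0 o3)).
Proof. exact: pder_comp (@is_derive_sinh R). Qed.

Lemma pder_cos c u : is_derive p u (fun q => cos (c * tc q)) (- sin (c * tc p) * (c * u 0 o4)).
Proof. exact: (@pder_comp cos (fun x => - sin x) c o4 u (@is_derive_cos R)). Qed.

Lemma pder_sin c u : is_derive p u (fun q => sin (c * tc q)) (cos (c * tc p) * (c * u 0 o4)).
Proof. exact: pder_comp (@is_derive_sin R). Qed.

Ltac pder := repeat match goal with
  | |- is_derive _ _ (fun q => _ + _) _ => apply: pder_add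
  | |- is_derive _ _ (fun q => - _) _ => apply: pder_opp
  | |- is_derive _ _ (fun q => cosh _ ) _ => exact: pder_cosh
  | |- is_derive _ _ (fun q => sinh _ ) _ => exact: pder_sinh
  | |- is_derive _ _ (fun q => cos _ ) _ => exact: pder_cos
  | |- is_derive _ _ (fun q => sin _ ) _ => exact: pder_sin
  | |- is_derive _ _ (fun q => _ ^+ 2) _ => apply: pder_sqr
  | |- is_derive _ _ (fun q => _ * _) _ => apply: pder_mul
  | |- is_derive _ _ (fun q => h (xy q)) _ => exact: pder_h
  | |- is_derive _ _ (fun q => H (xy q)) _ => exact: pder_H
  | |- is_derive _ _ (fun q => l2 _ _ (xy q)) _ => exact: (pder_xy _ (Ck_l2 0))
  | |- is_derive _ _ (fun q => n2 _ _ (xy q)) _ => exact: (pder_xy _ (Ck_n2 0))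
  | |- is_derive _ _ (fun q => dx2 (lnf h) (xy q)) _ => exact: (pder_xy _ (Ck_dx2 (clnh 1)))
  | |- is_derive _ _ (fun q => dy2 (lnf h) (xy q)) _ => exact: (pder_xy _ (Ck_dy2 (clnh 1)))
  | |- is_derive _ _ (fun q => _) _ => exact: pder_cst
  end.

(** These are derivatives along u with v held constant; exterior derivatives are obtained later by
    antisymmetrizing. *)
Definition dtheta1 u v : R := (a * sa * u 0 o3 * hp + ca * dh u) * v 0 o1.
Definition dtheta2 u v : R := (a * sa * u 0 o3 * hp + ca * dh u) * v 0 o2.
Definition dtheta3 u v : R :=
  2 * a * Ca * u 0 o3 * v 0 o4
  - (- 2 * a * st * u 0 o4 * Ca * Hp + kt * 2 * a * Sa * u 0 o3 * Hp + kt * Ca * dH u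
     + 2 * a * Ca * u 0 o3 * lp + Sa * d2 (l2 a H) u) * v 0 o1
  - (- 2 * a * kt * u 0 o4 * Ca * Hp - st * 2 * a * Sa * u 0 o3 * Hp - st * Ca * dH u
     + 2 * a * Ca * u 0 o3 * np + Sa * d2 (n2 a H) u) * v 0 o2.
Definition dtheta4 u v : R :=
  - (2 * a * kt * u 0 o4 * Hp + st * dH u) * v 0 o1
  - (- 2 * a * st * u 0 o4 * Hp + kt * dH u) * v 0 o2.

Definition ddt u v : R := - d2 (l2 a H) u * v 0 o1 - d2 (n2 a H) u * v 0 o2.
Definition drot u v : R := - 2 * a * st * u 0 o4 * v 0 o1 - 2 * a * kt * u 0 o4 * v 0 o2.
Definition dpsi u v : R :=
  - d2 (dy2 (lnf h)) u * v 0 o1 + d2 (dx2 (lnf h)) u * v 0 o2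
  + 4 * a ^+ 2 * sa * ca * u 0 o3 * dt_form a H p v + 2 * a * sa ^+ 2 * ddt u v
  - a * (2 * a * Ca * u 0 o3 * Hp * rot_form a p v + Sa * dH u * rot_form a p v + Sa * Hp * drot u v).
Definition dchi u v : R :=
  4 * a ^+ 2 * Sa * u 0 o3 * dt_form a H p v + 2 * a * Ca * ddt u v
  - 2 * a * (2 * a * Ca * u 0 o3 * Hp * rot_form a p v + Sa * dH u * rot_form a p v + Sa * Hp * drot u v).
Definition dmix (i : 'I_4) u v : R := a * (a * ca * u 0 o3 * hp + sa * dh u) * v 0 i.

Ltac gen_atoms :=
  rewrite ?(dh, dH, d2);
  repeat match goal with
  | |- context [cosh ?x] => generalize (cosh x); intro
  | |- context [sinh ?x] => generalize (sinh x); intro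
  | |- context [cos ?x] => generalize (cos x); intro
  | |- context [sin ?x] => generalize (sin x); intro
  | |- context [d2 ?f ?x] => generalize (d2 f x); intro
  | |- context [dh ?x] => generalize (dh x); intro
  | |- context [dH ?x] => generalize (dH x); intro
  | |- context [l2 ?x ?y ?z] => generalize (l2 x y z); intro
  | |- context [n2 ?x ?y ?z] => generalize (n2 x y z); intro
  | |- context [dx2 ?f ?x] => generalize (dx2 f x); intro
  | |- context [dy2 ?f ?x] => generalize (dy2 f x); intro
  | |- context [h ?x] => generalize (h x); intro
  | |- context [H ?x] => generalize (H x); intro
  | |- context [fun_of_matrix ?u ?i ?j] => generalize (fun_of_matrix u i j); intro
  end.

Lemma pder_theta1 u v : is_derive p u (fun q => theta1 a h q v) (dtheta1 u v).
Proof.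
by rewrite /theta1; apply: is_derive_eq; [pder|rewrite /dtheta1; gen_atoms; ring].
Qed.

Lemma pder_theta2 u v : is_derive p u (fun q => theta2 a h q v) (dtheta2 u v).
Proof.
by rewrite /theta2; apply: is_derive_eq; [pder|rewrite /dtheta2; gen_atoms; ring].
Qed.

Lemma pder_theta3 u v : is_derive p u (fun q => theta3 a H q v) (dtheta3 u v).
Proof.
by rewrite /theta3; apply: is_derive_eq; [pder|rewrite /dtheta3; gen_atoms; ring].
Qed.

Lemma pder_theta4 u v : is_derive p u (fun q => theta4 a H q v) (dtheta4 u v).
Proof.
by rewrite /theta4; apply: is_derive_eq; [pder|rewrite /dtheta4; gen_atoms; ring].
Qed.

Lemma pder_psi u v : is_derive p u (fun q => psi_form a h H q v) (dpsi u v).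
Proof.
rewrite /psi_form /dt_form /rot_form; apply: is_derive_eq; [pder|].
by rewrite /dpsi /ddt /drot /dt_form /rot_form; gen_atoms; ring.
Qed.

Lemma pder_chi u v : is_derive p u (fun q => chi_form a H q v) (dchi u v).
Proof.
rewrite /chi_form /dt_form /rot_form; apply: is_derive_eq; [pder|].
by rewrite /dchi /ddt /drot /dt_form /rot_form; gen_atoms; ring.
Qed.

Lemma pder_mix i u v : is_derive p u (fun q => mix_form a h i q v) (dmix i u v).
Proof.
by rewrite /mix_form; apply: is_derive_eq; [pder|rewrite /dmix; gen_atoms; ring].
Qed.

End AtPoint.

End Curvature.

(** * Verification of the two structure equations *)

Section Structure.
Context {R : realType}.
Variables (a : R) (U : set 'rV[R]_2) (h H : 'rV[R]_2 -> R).
Hypotheses (a_neq0 : a != 0) (U_open : open U) (h_smooth : smooth_on U h) (H_smooth : smooth_on U H).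
Hypotheses (h_gt0 : forall q, U q -> 0 < h q) (H_gt0 : forall q, U q -> 0 < H q).
Hypothesis H_eq : forall q, U q ->
  laplacian (lnf H) q = - 2 * a ^+ 2 * h q ^+ 2 + 4 * a ^+ 2 * H q ^+ 2.

Variables (p : 'rV[R]_4) (Mp : domM U p).
Implicit Types u v : 'rV[R]_4.

Let Up : U (xy p). Proof. by case: Mp. Qed.

(** The equation for the Laplacian of ln H, rewritten as the value of d(l2 dx + n2 dy). In this
    shape it serves both structure equations. *)
Lemma l2_n2_eq : dy2 (l2 a H) (xy p) = dx2 (n2 a H) (xy p) + a * h (xy p) ^+ 2 - 2 * a * H (xy p) ^+ 2.
Proof.
have cH k : Ck U k H := (smooth_onP _ _).1 H_smooth k.
have clnH k : Ck U k (lnf H) := Ck_lnf U_open k cH H_gt0.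
have D (c : R) f i : Ck U 0 f -> pd i (fun q => c * f q) (xy p) = c * pd i f (xy p).
  move=> cf; have Df := @derivableP _ _ _ _ _ (bvec i) (diff_derivable (v := bvec i) (Ck_differentiable cf Up)).
  rewrite /pd (derive_val (is_derive := pder_mul (pder_cst c (xy p) (bvec i)) Df)).
  by rewrite mulr0 addr0.
have Dl : dy2 (l2 a H) (xy p) = - (1 / (2 * a)) * dy2 (dy2 (lnf H)) (xy p).
  exact: D (Ck_dy2 (clnH 1)).
have Dn : dx2 (n2 a H) (xy p) = 1 / (2 * a) * dx2 (dx2 (lnf H)) (xy p).
  exact: D (Ck_dx2 (clnH 1)).
have := H_eq Up; rewrite Dl Dn /laplacian.
move: (dx2 _ _) (dy2 _ _) (h _) (H _) => x y z w E.
have -> : y = - 2 * a ^+ 2 * z ^+ 2 + 4 * a ^+ 2 * w ^+ 2 - x by rewrite -E addrC addKr.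
by field.
Qed.

Definition dcoframe (k : 'I_4) u v : R :=
  [:: dtheta1 a h p u v; dtheta2 a h p u v; dtheta3 a H p u v; dtheta4 a H p u v]`_k.

Lemma derive_coframe k u v :
  'D_u (fun q => covec (coframe_coeffs a h H k) q v) p = dcoframe k u v.
Proof.
have -> : (fun q => covec (coframe_coeffs a h H k) q v) = (fun q => coframe a h H k q v).
  by apply/funext => q; rewrite coframe_covec.
elim/ord4_ind: k; rewrite /coframe /dcoframe /=.
- by apply: (@derive_val _ _ _ _ _ _ _ _); eapply pder_theta1; eassumption.
- by apply: (@derive_val _ _ _ _ _ _ _ _); eapply pder_theta2; eassumption.
- by apply: (@derive_val _ _ _ _ _ _ _ _); eapply pder_theta3; eassumption.
- by apply: (@derive_val _ _ _ _ _ _ _ _); eapply pder_theta4; eassumption.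
Qed.

Definition dconn (k l : 'I_4) u v : R :=
  let psi := dpsi a h H p u v in let chi := dchi a H p u v in
  let x := dmix a h p o1 u v in let y := dmix a h p o2 u v in
  nth 0 (nth [::] [:: [:: 0; - psi; - y; x]; [:: psi; 0; x; y];
                      [:: y; - x; 0; chi]; [:: - x; - y; - chi; 0]] k) l.

Lemma derive_conn k l u v :
  'D_u (fun q => covec (conn_coeffs a h H k l) q v) p = dconn k l u v.
Proof.
have -> : (fun q => covec (conn_coeffs a h H k l) q v) = (fun q => conn a h H k l q v).
  by apply/funext => q; rewrite conn_covec.
have Dpsi : is_derive p u (fun q => psi_form a h H q v) (dpsi a h H p u v).
  by eapply pder_psi; eassumption.
have Dchi : is_derive p u (fun q => chi_form a H q v) (dchi a H p u v).
  by eapply pder_chi; eassumption.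
have Dmix i : is_derive p u (fun q => mix_form a h i q v) (dmix a h p i u v).
  by eapply pder_mix; eassumption.
elim/ord4_ind: k; elim/ord4_ind: l; rewrite /conn /dconn /=; apply: (@derive_val _ _ _ _ _ _ _ _);
  first [exact: pder_cst|exact: Dpsi|exact: Dchi|exact: Dmix
   |exact: pder_opp Dpsi|exact: pder_opp Dchi|exact: pder_opp (Dmix _)].
Qed.

Let C1 : cosh (a * zc p) ^+ 2 = 1 + sinh (a * zc p) ^+ 2 := cosh_sq _.
Let C2 : cosh (2 * a * zc p) = 1 + 2 * sinh (a * zc p) ^+ 2.
Proof. by rewrite -mulrA cosh_double. Qed.
Let C3 : sinh (2 * a * zc p) = 2 * sinh (a * zc p) * cosh (a * zc p).
Proof. by rewrite -mulrA sinh_double. Qed.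
Let C4 : sin (2 * a * tc p) ^+ 2 = 1 - cos (2 * a * tc p) ^+ 2.
Proof. by apply/eqP; rewrite eq_sym subr_eq addrC cos2Dsin2. Qed.

Ltac gen_atoms :=
  repeat match goal with
  | |- context [cosh ?x] => generalize (cosh x); intro
  | |- context [sinh ?x] => generalize (sinh x); intro
  | |- context [cos ?x] => generalize (cos x); intro
  | |- context [sin ?x] => generalize (sin x); intro
  | |- context [l2 ?x ?y ?z] => generalize (l2 x y z); intro
  | |- context [n2 ?x ?y ?z] => generalize (n2 x y z); intro
  | |- context [dx2 ?f ?x] => generalize (dx2 f x); intro
  | |- context [dy2 ?f ?x] => generalize (dy2 f x); intro
  | |- context [h ?x] => generalize (h x); intro
  | |- context [H ?x] => generalize (H x); intro
  | |- context [fun_of_matrix ?u ?i ?j] => generalize (fun_of_matrix u i j); intro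
  end.

Lemma conn_skew k l q v : conn a h H k l q v = - conn a h H l k q v.
Proof.
by elim/ord4_ind: k; elim/ord4_ind: l; rewrite /conn /= ?opprK ?oppr0.
Qed.

(** With the doubled hyperbolic angles expanded, the entries are polynomials; the relations for
    cosh^2, sin^2 and the y-derivative of [l2] are handed to [ring]. *)
Lemma cartan_structure k (i j : 'I_4) : (i < j)%N ->
  pd i (coframe_coeffs a h H k j) p - pd j (coframe_coeffs a h H k i) p
  + \sum_l (conn_coeffs a h H k l i p * coframe_coeffs a h H l j p
            - conn_coeffs a h H k l j p * coframe_coeffs a h H l i p) = 0.
Proof.
have C5 := l2_n2_eq.
have D i' j' : pd i' (coframe_coeffs a h H k j') p = dcoframe k (bvec i') (bvec j').
  rewrite -derive_coframe; congr ('D_ _ _ _); apply/funext => q.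
  by rewrite covec_bvec.
rewrite !D sum4 /conn_coeffs /coframe_coeffs {D}.
elim/ord4_ind: k; rewrite /coframe /conn /dcoframe /=
  ?(mul0r, mulr0, subr0, add0r, addr0) /dtheta1 /dtheta2 /dtheta3 /dtheta4 /dH /dh /d2
  /theta1 /theta2 /theta3 /theta4 /psi_form /chi_form /mix_form /dt_form /rot_form C2 C3;
  elim/ord4_ind: i; elim/ord4_ind: j => // _; rewrite !mxE /=;
  move: C1 C4 C5; gen_atoms => h1 h2 h3; ring: h1 h2 h3.
Qed.

Let W i j u v : R := wedge11 (coframe a h H i p) (coframe a h H j p) u v.

Variable mu : R.
Hypothesis Hmu : mu * (h (xy p) ^+ 2 * cosh (a * zc p) ^+ 2) =
  4 * a ^+ 2 * h (xy p) ^+ 2 - 2 * a ^+ 2 * H (xy p) ^+ 2 - laplacian (lnf h) (xy p).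

(** Since theta_1 /\ theta_2 = h^2 cosh(az)^2 dx /\ dy, this product cancels the denominator of mu
    and keeps the curvature identity free of division. *)
Let muW u v : mu * W o1 o2 u v =
  (4 * a ^+ 2 * h (xy p) ^+ 2 - 2 * a ^+ 2 * H (xy p) ^+ 2
   - (dx2 (dx2 (lnf h)) (xy p) + dy2 (dy2 (lnf h)) (xy p))) * (u 0 o1 * v 0 o2 - v 0 o1 * u 0 o2).
Proof.
rewrite -[_ + dy2 _ _]/(laplacian (lnf h) (xy p)) -Hmu /W /wedge11 /coframe /= /theta1 /theta2.
by gen_atoms; ring.
Qed.

(** Both sides are two-forms, so coordinate pairs suffice. Second derivatives of ln h enter only
    through d psi, which is why mu appears in a single entry. *)
Lemma conn_curvature_lt (k m : 'I_4) u v : (k < m)%N ->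
  curvature_form (conn_coeffs a h H) k m p u v =
  nth 0 (nth [::] [::
    [:: 0; mu * W o1 o2 u v - 4 * a ^+ 2 * W o1 o2 u v - 2 * a ^+ 2 * W o4 o3 u v;
        a ^+ 2 * (W o2 o4 u v - W o1 o3 u v); - a ^+ 2 * (W o1 o4 u v + W o2 o3 u v)];
    [:: 0; 0; - a ^+ 2 * (W o1 o4 u v + W o2 o3 u v); - a ^+ 2 * (W o2 o4 u v - W o1 o3 u v)];
    [:: 0; 0; 0; 4 * a ^+ 2 * W o4 o3 u v + 2 * a ^+ 2 * W o1 o2 u v]] k) m.
Proof.
have lin l (c : R) x y : coframe a h H l p (c *: x + y) = c * coframe a h H l p x + coframe a h H l p y.
  by rewrite !coframe_covec covecD covecZ.
have WF i j : is_form2 (W i j) by exact: is_form2_wedge11 (lin i) (lin j).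
have cw k' l' m' j' : Ck (domM U) k' (conn_coeffs a h H l' m' j') by exact: Ck_conn_coeffs.
have CF := is_form2_curvature_form (M := domM U) cw k m Mp.
move=> km; move: u v; apply: form2_ext => //.
  move: km; elim/ord4_ind: k {CF}; elim/ord4_ind: m => //= _;
    by repeat first [exact: WF|apply: is_form2_add|apply: is_form2_opp|apply: is_form2_scale].
have C5 := l2_n2_eq.
move=> i j ij; rewrite muW /curvature_form !derive_conn sum4 -!conn_covec.
move: km ij.
elim/ord4_ind: k {CF}; elim/ord4_ind: m => //= _;
  rewrite /W /wedge11 /coframe /conn /dconn /=
  ?(mul0r, mulr0, subr0, add0r, addr0) /dpsi /dchi /dmix /ddt /drot /dH /dh /d2
  /theta1 /theta2 /theta3 /theta4 /psi_form /chi_form /mix_form /dt_form /rot_form C2 C3;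
  elim/ord4_ind: i; elim/ord4_ind: j => // _; rewrite !mxE /=;
  move: C1 C4 C5; gen_atoms => h1 h2 h3; ring: h1 h2 h3.
Qed.

End Structure.

(** * Curvature *)

Section ModelCurvature.
Context {R : realType}.
Variables (a mu : R).
Implicit Types x y z t : 'I_4 -> R.

Definition minor x y (i j : 'I_4) : R := x i * y j - y i * x j.

(* The curvature of the complex hyperbolic plane of holomorphic curvature [- 4 a^2],
   plus [mu] times the square of [theta1 /\ theta2], in an orthonormal frame. *)
Definition model_riem x y z t : R :=
  (mu * minor x y o1 o2 - 4 * a ^+ 2 * minor x y o1 o2 - 2 * a ^+ 2 * minor x y o4 o3) * minor t z o1 o2
  + a ^+ 2 * (minor x y o2 o4 - minor x y o1 o3) * minor t z o1 o3
  - a ^+ 2 * (minor x y o1 o4 + minor x y o2 o3) * minor t z o1 o4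
  - a ^+ 2 * (minor x y o1 o4 + minor x y o2 o3) * minor t z o2 o3
  - a ^+ 2 * (minor x y o2 o4 - minor x y o1 o3) * minor t z o2 o4
  + (4 * a ^+ 2 * minor x y o4 o3 + 2 * a ^+ 2 * minor x y o1 o2) * minor t z o3 o4.

Definition basis4 (j : 'I_4) : 'I_4 -> R := fun k => (k == j)%:R.

Definition model_ricci x y : R :=
  mu * (x o1 * y o1 + x o2 * y o2) - 6 * a ^+ 2 * \sum_k x k * y k.

Definition model_weyl x y z t : R :=
  let dot x y := \sum_k x k * y k in
  model_riem x y z t
  - 2^-1 * (model_ricci y z * dot x t + model_ricci x t * dot y z
            - model_ricci x z * dot y t - model_ricci y t * dot x z)
  + (2 * mu - 24 * a ^+ 2) / 6 * (dot y z * dot x t - dot x z * dot y t).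

Lemma model_riem_trace x y : \sum_i model_riem (basis4 i) x y (basis4 i) = model_ricci x y.
Proof.
rewrite /model_ricci !sum4 /model_riem /minor /basis4 /=.
move: (x o1) (x o2) (x o3) (x o4) (y o1) (y o2) (y o3) (y o4) => *; ring.
Qed.

(** A, B, C are the coordinates of an anti-self-dual form in the basis theta_12 + theta_34, theta_13
    - theta_24, theta_14 + theta_23, in which the operator is diagonal. *)
Lemma model_weyl_asd (A B C : R) (x y : 'I_4 -> R) (w : 'I_4 -> 'I_4 -> R) :
  (forall i j, w i j = A * (minor (basis4 i) (basis4 j) o1 o2 + minor (basis4 i) (basis4 j) o3 o4)
   + B * (minor (basis4 i) (basis4 j) o1 o3 - minor (basis4 i) (basis4 j) o2 o4)
   + C * (minor (basis4 i) (basis4 j) o1 o4 + minor (basis4 i) (basis4 j) o2 o3)) ->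
  2^-1 * \sum_i \sum_j model_weyl x y (basis4 j) (basis4 i) * w i j
  = mu / 3 * A * (minor x y o1 o2 + minor x y o3 o4)
    - mu / 6 * B * (minor x y o1 o3 - minor x y o2 o4)
    - mu / 6 * C * (minor x y o1 o4 + minor x y o2 o3).
Proof.
move=> Hw; rewrite !sum4 !Hw /model_weyl /model_ricci !sum4 /model_riem /minor /basis4 /=.
move: (x o1) (x o2) (x o3) (x o4) (y o1) (y o2) (y o3) (y o4) => *.
by field.
Qed.

End ModelCurvature.

(** * Levi-Civita connection and curvature in the frame E *)

Section Consequences.
Context {R : realType}.
Variables (a : R) (U : set 'rV[R]_2) (h H : 'rV[R]_2 -> R) (E : 'I_4 -> vfield R 4).
Hypotheses (a_neq0 : a != 0) (U_open : open U) (h_smooth : smooth_on U h) (H_smooth : smooth_on U H).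
Hypotheses (h_gt0 : forall q, U q -> 0 < h q) (H_gt0 : forall q, U q -> 0 < H q).
Hypothesis H_eq : forall q, U q ->
  laplacian (lnf H) q = - 2 * a ^+ 2 * h q ^+ 2 + 4 * a ^+ 2 * H q ^+ 2.
Hypothesis E_dual : dual_frame (domM U) (coframe a h H) E.

Let M := domM U.
Let g := metric a h H.
Let th k p u := coframe a h H k p u.
Implicit Types (p u v : 'rV[R]_4).

Let M_open : open M := domM_open U_open.

Let ct m k j : Ck M m (coframe_coeffs a h H k j).
Proof. exact: Ck_coframe_coeffs. Qed.

Let cw m k l j : Ck M m (conn_coeffs a h H k l j).
Proof. exact: Ck_conn_coeffs. Qed.

Let dual p i j : M p -> covec (coframe_coeffs a h H i) p (E j p) = (i == j)%:R.
Proof. by move=> Mp; rewrite -coframe_covec; exact: E_dual. Qed.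

Let skew k l p v : M p -> covec (conn_coeffs a h H k l) p v = - covec (conn_coeffs a h H l k) p v.
Proof. by move=> _; rewrite -!conn_covec; exact: conn_skew. Qed.

Let struct k (i j : 'I_4) p : (i < j)%N -> M p ->
  pd i (coframe_coeffs a h H k j) p - pd j (coframe_coeffs a h H k i) p
  + \sum_l (conn_coeffs a h H k l i p * coframe_coeffs a h H l j p
            - conn_coeffs a h H k l j p * coframe_coeffs a h H l i p) = 0.
Proof. by move=> ij Mp; eapply cartan_structure; eassumption. Qed.

Definition frame_mu p : R :=
  (4 * a ^+ 2 * h (xy p) ^+ 2 - 2 * a ^+ 2 * H (xy p) ^+ 2 - laplacian (lnf h) (xy p))
  / (h (xy p) ^+ 2 * cosh (a * zc p) ^+ 2).

Let den_neq0 p : M p -> h (xy p) ^+ 2 * cosh (a * zc p) ^+ 2 != 0.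
Proof.
by move=> [/h_gt0 hp _]; rewrite mulf_neq0 // expf_neq0 // ?cosh_neq0 // gt_eqF.
Qed.

Let Hmu p : M p -> frame_mu p * (h (xy p) ^+ 2 * cosh (a * zc p) ^+ 2) =
  4 * a ^+ 2 * h (xy p) ^+ 2 - 2 * a ^+ 2 * H (xy p) ^+ 2 - laplacian (lnf h) (xy p).
Proof. by move=> Mp; rewrite /frame_mu divfK // den_neq0. Qed.

Lemma theta_dual p j : M p -> (fun k => th k p (E j p)) = basis4 j.
Proof. by move=> Mp; apply/funext => k; exact: E_dual. Qed.

Lemma metric_sum p u v : g p u v = \sum_k th k p u * th k p v.
Proof. by []. Qed.

Lemma metric_E p v k : M p -> g p v (E k p) = th k p v.
Proof.
move=> Mp; rewrite /g metric_frame /th coframe_covec.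
exact: (frame_metric_E (M := M) dual).
Qed.

Lemma theta_expansion p v : M p -> v = \sum_k th k p v *: E k p.
Proof.
move=> Mp; rewrite {1}(frame_expansion (M := M) dual v Mp).
by apply: eq_bigr => k _; rewrite /th coframe_covec.
Qed.

Lemma theta_ext p u v : M p -> (forall k, th k p u = th k p v) -> u = v.
Proof.
move=> Mp uv; apply: (frame_ext (M := M) dual Mp) => k.
by rewrite -!coframe_covec; exact: uv.
Qed.

Lemma nabla_theta (X Y : vfield R 4) p k : M p ->
  (forall j, differentiable (fun q => Y q 0 j) p) ->
  th k p (nabla g X Y p) =
    'D_(X p) (fun q => th k q (Y q)) p + \sum_l conn a h H k l p (X p) * th l p (Y p).
Proof.
move=> Mp dY; rewrite /th coframe_covec /g metric_frame.
rewrite (nabla_frame ct dual skew struct X k Mp dY).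
congr (_ + _); last by apply: eq_bigr => l _; rewrite -conn_covec coframe_covec.
have -> // : (fun q => th k q (Y q)) = (fun q => covec (coframe_coeffs a h H k) q (Y q)).
by apply/funext => q; rewrite /th coframe_covec.
Qed.

(** The table of curvature forms covers k < m only; skewness of the connection matrix supplies the
    rest. *)
Let curv_skew k m p u v : M p ->
  curvature_form (conn_coeffs a h H) k m p u v = - curvature_form (conn_coeffs a h H) m k p u v.
Proof.
move=> Mp; rewrite /curvature_form.
have D c1 c2 : 'D_c1 (fun q => covec (conn_coeffs a h H k m) q c2) p
   = - 'D_c1 (fun q => covec (conn_coeffs a h H m k) q c2) p.
  rewrite -deriveN; last first.
    by apply: diff_derivable; exact: Ck_differentiable (Ck_covec c2 M_open (cw 0 m k)) Mp.
  have -> // : (fun q => covec (conn_coeffs a h H k m) q c2) = - (fun q => covec (conn_coeffs a h H m k) q c2).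
  by apply/funext => q; rewrite fctE -!conn_covec conn_skew.
rewrite !D !sumrB.
have S c1 c2 : \sum_l covec (conn_coeffs a h H k l) p c1 * covec (conn_coeffs a h H l m) p c2
  = \sum_l covec (conn_coeffs a h H m l) p c2 * covec (conn_coeffs a h H l k) p c1.
  by apply: eq_bigr => l _; rewrite (skew k l) // (skew l m) // mulrNN mulrC.
rewrite (S u v) (S v u).
by move: ('D_u _ _) ('D_v _ _) (\sum_l _) (\sum_l _) => *; ring.
Qed.

Lemma riem_model p u v z y : M p ->
  riem g p u v z y = model_riem a (frame_mu p) (fun k => th k p u) (fun k => th k p v) (fun k => th k p z) (fun k => th k p y).
Proof.
move=> Mp; rewrite /g metric_frame (riem_frame M_open ct cw dual skew struct) //.
have C (k m : 'I_4) : (k < m)%N -> _ := @conn_curvature_lt R a U h H a_neq0 U_open h_smooth H_smooth h_gt0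
  H_gt0 H_eq p Mp (frame_mu p) (Hmu Mp) k m u v.
have C0 k : curvature_form (conn_coeffs a h H) k k p u v = 0.
  by have := curv_skew k k u v Mp => /eqP; rewrite -addr_eq0 -mulr2n mulrn_eq0 => /eqP.
rewrite !sum4 !C0 (curv_skew o2 o1) // (curv_skew o3 o1) // (curv_skew o3 o2) //.
rewrite (curv_skew o4 o1) // (curv_skew o4 o2) // (curv_skew o4 o3) // !C //=.
rewrite /wedge11 /model_riem /minor -!coframe_covec.
rewrite /th.
repeat match goal with |- context [coframe ?x ?y ?z ?k ?q ?w] => generalize (coframe x y z k q w); intro end.
by generalize (frame_mu p); intro; ring.
Qed.

Lemma ricci_model p u v : M p ->
  ricci g E p u v = model_ricci a (frame_mu p) (fun k => th k p u) (fun k => th k p v).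
Proof.
move=> Mp; rewrite -model_riem_trace; apply: eq_bigr => i _.
by rewrite riem_model // theta_dual.
Qed.

Lemma scalar_curv_model p : M p -> scalar_curv g E p = 2 * frame_mu p - 24 * a ^+ 2.
Proof.
move=> Mp; rewrite /scalar_curv sum4 !ricci_model // !theta_dual // /model_ricci !sum4 /basis4 /=.
by generalize (frame_mu p); intro; ring.
Qed.

(** theta_k (E_j) is constant, so the derivative term drops out of [nabla_theta]. *)
Lemma conn_coef_frame p k i j : M p -> conn_coef g E p k i j = conn a h H k j p (E i p).
Proof.
move=> Mp; rewrite /conn_coef metric_E // nabla_theta //; last first.
  by move=> l; exact: Ck_differentiable (Ck_frame M_open ct dual 0 j l) Mp.
have -> : 'D_(E i p) (fun q => th k q (E j q)) p = 0.
  rewrite (eq_on_derive (g := fun=> (k == j)%:R) M_open) ?derive_cst //.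
  by move=> q Mq; exact: E_dual.
rewrite add0r (bigD1 j) //= big1 ?addr0 => [|l lj]; rewrite [X in _ * X]E_dual //.
  by rewrite eqxx mulr1.
by rewrite (negbTE lj) mulr0.
Qed.

Lemma nabla_cst_sym p u v : nabla g (cst u) (cst v) p = nabla g (cst v) (cst u) p.
Proof.
have gC q x y : g q x y = g q y x by apply: eq_bigr => k _; rewrite mulrC.
have sym (i j : 'I_4) : (fun q => g q (bvec i) (bvec j)) = (fun q => g q (bvec j) (bvec i)).
  by apply/funext => q; exact: gC.
have chC k i j : christoffel g p k i j = christoffel g p k j i.
  apply: (congr1 ( *%R 2^-1)); apply: eq_bigr => l _; apply: (congr1 ( *%R _)).
  by rewrite [in X in pd l X]sym; apply: (congr1 (fun x => x - _)); exact: addrC.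
apply/rowP => k; rewrite !mxE !derive_cst !add0r exchange_big; apply: eq_bigr => i _.
by apply: eq_bigr => j _; rewrite [in LHS]chC mulrAC.
Qed.

Lemma differentiable_theta k v p : M p -> differentiable (fun q => th k q v) p.
Proof.
move=> Mp; have -> : (fun q => th k q v) = (fun q => covec (coframe_coeffs a h H k) q v).
  by apply/funext => q; rewrite /th coframe_covec.
exact: Ck_differentiable (Ck_covec v M_open (ct 0 k)) Mp.
Qed.

(** The first structure equation in arbitrary directions, obtained by applying theta_k to the
    symmetry of [nabla] on constant fields. *)
Lemma structure_theta k p u v : M p ->
  'D_v (fun q => th k q u) p = 'D_u (fun q => th k q v) p
  + \sum_l (conn a h H k l p u * th l p v - conn a h H k l p v * th l p u).
Proof.
move=> Mp; have := congr1 (th k p) (nabla_cst_sym p u v).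
rewrite !nabla_theta //; try by move=> j; exact: differentiable_cst.
rewrite sumrB; move: ('D_u _ _) ('D_v _ _) (\sum_l _) (\sum_l _) => x y z t E1.
lra.
Qed.

Lemma mix_form_theta p u : mix_form a h o1 p u = a * tanh (a * zc p) * th o1 p u /\
  mix_form a h o2 p u = a * tanh (a * zc p) * th o2 p u.
Proof.
rewrite /mix_form /th /coframe /= /theta1 /theta2 /tanh; split;
  by have := cosh_neq0 (a * zc p); generalize (cosh (a * zc p)) (sinh (a * zc p)) (h (xy p)) => *; field.
Qed.

(** The rotations psi and chi preserve theta_1 /\ theta_2 and theta_3 /\ theta_4 and cancel in d
    Omega. Only the mixed connection forms, multiples of a tanh(az), survive and produce the Lee
    form. *)
Lemma lee_formP (J : endfield R 4) :
  (forall p u v, M p -> kahler_form g J p u v = Omega a h H p u v) ->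
  is_lee_form M g J (lee_theta a H).
Proof.
move=> J_form p u v z Mp.
have DOm c1 c2 c3 : 'D_c1 (fun q => kahler_form g J q c2 c3) p =
    ('D_c1 (fun q => th o1 q c2) p * th o2 p c3 + th o1 p c2 * 'D_c1 (fun q => th o2 q c3) p)
    - ('D_c1 (fun q => th o1 q c3) p * th o2 p c2 + th o1 p c3 * 'D_c1 (fun q => th o2 q c2) p)
    + (('D_c1 (fun q => th o3 q c2) p * th o4 p c3 + th o3 p c2 * 'D_c1 (fun q => th o4 q c3) p)
    - ('D_c1 (fun q => th o3 q c3) p * th o4 p c2 + th o3 p c3 * 'D_c1 (fun q => th o4 q c2) p)).
  rewrite (eq_on_derive (g := fun q => (th o1 q c2 * th o2 q c3 - th o1 q c3 * th o2 q c2)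
    + (th o3 q c2 * th o4 q c3 - th o3 q c3 * th o4 q c2)) M_open) //; last by move=> q; exact: J_form.
  have D k c : is_derive p c1 (fun q => th k q c) ('D_c1 (fun q => th k q c) p).
    exact/derivableP/diff_derivable/differentiable_theta.
  rewrite (derive_val (is_derive := pder_add
    (pder_add (pder_mul (D o1 c2) (D o2 c3)) (pder_opp (pder_mul (D o1 c3) (D o2 c2))))
    (pder_add (pder_mul (D o3 c2) (D o4 c3)) (pder_opp (pder_mul (D o3 c3) (D o4 c2)))))).
  by generalize ('D_c1 (fun q => th o1 q c2) p) ('D_c1 (fun q => th o1 q c3) p)
    ('D_c1 (fun q => th o2 q c2) p) ('D_c1 (fun q => th o2 q c3) p)
    ('D_c1 (fun q => th o3 q c2) p) ('D_c1 (fun q => th o3 q c3) p)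
    ('D_c1 (fun q => th o4 q c2) p) ('D_c1 (fun q => th o4 q c3) p)
    (th o1 p c2) (th o1 p c3) (th o2 p c2) (th o2 p c3) (th o3 p c2) (th o3 p c3) (th o4 p c2) (th o4 p c3);
    intros; ring.
rewrite /ext_d2 !DOm /wedge12 !J_form //.
have S k c1 c2 := structure_theta k c1 c2 Mp.
have mix1 w := (mix_form_theta p w).1; have mix2 w := (mix_form_theta p w).2.
rewrite !(S _ u v) !(S _ u z) !(S _ v z) !sum4 /conn /= !mix1 !mix2.
rewrite /lee_theta /alpha /Omega /wedge11.
rewrite -[theta4 a H p u]/(th o4 p u) -[theta4 a H p v]/(th o4 p v) -[theta4 a H p z]/(th o4 p z).
rewrite -[theta3 a H p u]/(th o3 p u) -[theta3 a H p v]/(th o3 p v) -[theta3 a H p z]/(th o3 p z).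
rewrite -[theta2 a h p u]/(th o2 p u) -[theta2 a h p v]/(th o2 p v) -[theta2 a h p z]/(th o2 p z).
rewrite -[theta1 a h p u]/(th o1 p u) -[theta1 a h p v]/(th o1 p v) -[theta1 a h p z]/(th o1 p z).
repeat match goal with |- context [derive ?f ?q ?w] => generalize (derive f q w); intro end.
generalize (th o1 p u) (th o2 p u) (th o3 p u) (th o4 p u) (th o1 p v) (th o2 p v) (th o3 p v) (th o4 p v)
  (th o1 p z) (th o2 p z) (th o3 p z) (th o4 p z) (tanh (a * zc p))
  (psi_form a h H p u) (psi_form a h H p v) (psi_form a h H p z)
  (chi_form a H p u) (chi_form a H p v) (chi_form a H p z); intros.
ring.
Qed.

End Consequences.

Section AntiSelfDual.
Context {R : realType}.

(* The anti-self-dual two-forms for the orientation [theta1 theta2 theta4 theta3]. *)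
Definition asd_form (A B C : R) (x y : 'I_4 -> R) : R :=
  A * (minor x y o1 o2 + minor x y o3 o4) + B * (minor x y o1 o3 - minor x y o2 o4)
  + C * (minor x y o1 o4 + minor x y o2 o3).

End AntiSelfDual.

Lemma is_derive_tanh {R : realType} (x : R) : is_derive x 1 (@tanh R) (1 / cosh x ^+ 2).
Proof.
have c0 := cosh_neq0 x.
have D := is_deriveM (is_derive_sinh x) (is_deriveV c0 (is_derive_cosh x)).
apply: is_derive_eq D _; rewrite /GRing.scale /=.
have := cosh_sq x; move: c0; generalize (cosh x) (sinh x) => c s c0 cs.
have s2 : s ^+ 2 = c ^+ 2 - 1 by rewrite cs; ring.
by field: s2.
Qed.

(** * Connection coefficients, conformal scalar curvature, Weyl tensor, sectional curvatures *)

Section Parts.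
Context {R : realType}.
Variables (a : R) (U : set 'rV[R]_2) (h H : 'rV[R]_2 -> R) (E : 'I_4 -> vfield R 4).
Hypotheses (a_neq0 : a != 0) (U_open : open U) (h_smooth : smooth_on U h) (H_smooth : smooth_on U H).
Hypotheses (h_gt0 : forall q, U q -> 0 < h q) (H_gt0 : forall q, U q -> 0 < H q).
Hypothesis H_eq : forall q, U q ->
  laplacian (lnf H) q = - 2 * a ^+ 2 * h q ^+ 2 + 4 * a ^+ 2 * H q ^+ 2.
Hypothesis E_dual : dual_frame (domM U) (coframe a h H) E.

Let M := domM U.
Let g := metric a h H.
Let th k p u := coframe a h H k p u.
Implicit Types (p u v : 'rV[R]_4).

Let M_open : open M := domM_open U_open.
Let conn_frame := conn_coef_frame a_neq0 U_open h_smooth H_smooth h_gt0 H_gt0 H_eq E_dual.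
Let riemE := riem_model a_neq0 U_open h_smooth H_smooth h_gt0 H_gt0 H_eq E_dual.
Let ricciE := ricci_model a_neq0 U_open h_smooth H_smooth h_gt0 H_gt0 H_eq E_dual.
Let scalE := scalar_curv_model a_neq0 U_open h_smooth H_smooth h_gt0 H_gt0 H_eq E_dual.

Lemma sinh_az_neq0 p : M p -> sinh (a * zc p) != 0.
Proof. by move=> [_ zp]; apply/sinh_neq0/mulf_neq0 => //; rewrite lt_eqF. Qed.

(** theta_1 and theta_2 are multiples of dx and dy, so duality determines these coordinates first;
    [frame_component3] and [frame_dt] then solve for the remaining directions. *)
Lemma frame_component12 p j (i : 'I_4) : M p -> i = o1 \/ i = o2 ->
  E j p 0 i = (i == j)%:R / (cosh (a * zc p) * h (xy p)).
Proof.
move=> Mp ij; have hp : h (xy p) != 0 by rewrite gt_eqF // h_gt0 //; case: Mp.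
have := E_dual i j Mp; case: ij => ->; rewrite /coframe /= /theta1 /theta2 => <-;
  by have := cosh_neq0 (a * zc p); generalize (cosh (a * zc p)) (E j p) => c v c0; field; rewrite hp.
Qed.

Lemma frame_component3 p j : M p ->
  E j p 0 o3 = (o4 == j)%:R + sin (2 * a * tc p) * H (xy p) * E j p 0 o1
    + cos (2 * a * tc p) * H (xy p) * E j p 0 o2.
Proof.
move=> Mp; have := E_dual o4 j Mp; rewrite /coframe /= /theta4 => <-.
by generalize (E j p) (sin (2 * a * tc p)) (cos (2 * a * tc p)) (H (xy p)) => *; ring.
Qed.

(** Solves the duality relation of theta_3; z < 0 is what makes sinh(2az) invertible. *)
Lemma frame_dt p j : M p ->
  dt_form a H p (E j p) = ((o3 == j)%:R + (cos (2 * a * tc p) * E j p 0 o1 - sin (2 * a * tc p) * E j p 0 o2)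
     * (1 + 2 * sinh (a * zc p) ^+ 2) * H (xy p)) / (2 * sinh (a * zc p) * cosh (a * zc p)).
Proof.
move=> Mp; have := E_dual o3 j Mp; rewrite /coframe /= /theta3 => <-.
have := sinh_az_neq0 Mp; have := cosh_neq0 (a * zc p).
rewrite -[2 * a * zc p]mulrA cosh_double sinh_double /dt_form.
generalize (E j p) (sin (2 * a * tc p)) (cos (2 * a * tc p)) (H (xy p)) (cosh (a * zc p)) (sinh (a * zc p)).
by generalize (l2 a H (xy p)) (n2 a H (xy p)) => *; field; apply/andP.
Qed.

Lemma derive_lnf (f : 'rV[R]_2 -> R) q (v : 'rV[R]_2) :
  differentiable f q -> 0 < f q -> 'D_v (lnf f) q = 'D_v f q / f q.
Proof.
move=> df fq.
have D := is_derive_comp1 (is_derive1_ln fq) (derivableP (diff_derivable (v := v) df)).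
by rewrite mulrC -(derive_val (is_derive := D)).
Qed.

Lemma gamma_perp p : M p ->
  conn_coef g E p o2 o1 o1
    = - (a * sinh (a * zc p) * cos (2 * a * tc p) * H (xy p) / (cosh (a * zc p) ^+ 2 * h (xy p)))
      - dy2 h (xy p) / (cosh (a * zc p) * h (xy p) ^+ 2) /\
  conn_coef g E p o1 o2 o2
    = - (a * sinh (a * zc p) * sin (2 * a * tc p) * H (xy p) / (cosh (a * zc p) ^+ 2 * h (xy p)))
      - dx2 h (xy p) / (cosh (a * zc p) * h (xy p) ^+ 2).
Proof.
move=> Mp; have Up : U (xy p) by case: Mp.
have hp := h_gt0 Up; have hp0 : h (xy p) != 0 by rewrite gt_eqF.
have dh : differentiable h (xy p) by exact: (h_smooth [::]) Up.
rewrite !conn_frame // /conn /= /psi_form !frame_dt // /rot_form -[2 * a * zc p]mulrA sinh_double.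
rewrite !(frame_component12 _ Mp (or_introl erefl)) !(frame_component12 _ Mp (or_intror erefl)) /=.
have -> : dy2 (lnf h) (xy p) = dy2 h (xy p) / h (xy p) by exact: derive_lnf.
have -> : dx2 (lnf h) (xy p) = dx2 h (xy p) / h (xy p) by exact: derive_lnf.
have := cosh_sq (a * zc p); have := sinh_az_neq0 Mp; have := cosh_neq0 (a * zc p); move: hp0.
generalize (dy2 h (xy p)) (dx2 h (xy p)) (h (xy p)) (H (xy p)) (cosh (a * zc p)) (sinh (a * zc p)).
generalize (sin (2 * a * tc p)) (cos (2 * a * tc p)) => k1 k2 h1 h2 h0 H0 c s hp0 c0 s0 cs.
have s2 : s ^+ 2 = c ^+ 2 - 1 by rewrite cs; ring.
by split; field: s2; rewrite hp0 c0 s0.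
Qed.

Lemma is_derive_alpha p u :
  is_derive p u (alpha a) (- 2 * a ^+ 2 * u 0 o3 / cosh (a * zc p) ^+ 2).
Proof.
have D : is_derive p u (fun q : 'rV[R]_4 => a * zc q) (a * u 0 o3).
  by apply: is_derive_eq (pder_mul (pder_cst a p u) (is_derive_coord o3 p u)) _; rewrite mulr0 addr0.
have D2 := pder_mul (pder_cst (- 2 * a) p u) (is_derive_comp1 (is_derive_tanh (a * zc p)) D).
apply: is_derive_eq D2 _; rewrite mulr0 addr0.
by have := cosh_neq0 (a * zc p); generalize (cosh (a * zc p)) (u 0 o3) => c w c0; field.
Qed.

(** The claim amounts to |theta|^2 + delta theta = -4 a^2, which offsets the constant -24 a^2 of the
    scalar curvature. *)
Lemma conformal_scalarE p : M p ->
  conformal_scalar_curv g E (lee_theta a H) p = 2 * frame_mu a h H p.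
Proof.
move=> Mp; rewrite /conformal_scalar_curv scalE // /sqnorm1 /codiff.
have th4 q j : M q -> theta4 a H q (E j q) = (o4 == j)%:R by move=> Mq; exact: (E_dual o4 j Mq).
(* On the frame the Lee form is -alpha on E_4 and zero elsewhere, so its covariant derivative is the
   derivative of -alpha plus a connection term omega_4j. *)
have F j : nabla_form g (E j) (lee_theta a H) (E j) p =
   (o4 == j)%:R * (2 * a ^+ 2 * E j p 0 o3 / cosh (a * zc p) ^+ 2) + alpha a p * conn a h H o4 j p (E j p).
  rewrite /nabla_form /lee_theta mulNr opprK; congr (_ + _).
    have D := is_derive_alpha p (E j p).
    rewrite (eq_on_derive (g := fun q => (- (o4 == j)%:R) * alpha a q) M_open) //.
      rewrite (derive_val (is_derive := pder_mul (pder_cst _ p (E j p)) D)) mulr0 addr0.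
      by generalize (cosh (a * zc p)) (E j p 0 o3) => *; rewrite -mulrA; ring.
    by move=> q Mq; rewrite th4 // mulrC mulrN mulNr mulrC.
  rewrite -conn_frame // /conn_coef (metric_E E_dual) //.
have mix1 w := (mix_form_theta a h H p w).1; have mix2 w := (mix_form_theta a h H p w).2.
rewrite !sum4 !F /=.
rewrite /conn /= /chi_form /rot_form !frame_dt // !mix1 !mix2.
rewrite !frame_component3 // !E_dual //.
rewrite !(frame_component12 _ Mp (or_introl erefl)) !(frame_component12 _ Mp (or_intror erefl)) /=.
rewrite /lee_theta !th4 //= /alpha /tanh -[2 * a * zc p]mulrA cosh_double sinh_double.
rewrite !mul0r !mulr0 !addr0 !subr0 !add0r.
have := cosh_sq (a * zc p); have := sinh_az_neq0 Mp; have := cosh_neq0 (a * zc p).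
generalize (frame_mu a h H p) (cosh (a * zc p)) (sinh (a * zc p)) => m c s c0 s0 cs.
have s2 : s ^+ 2 = c ^+ 2 - 1 by rewrite cs; ring.
by field: s2; rewrite c0 s0.
Qed.

Lemma form2_frame (w : form2 R 4) p u v : M p -> is_form2 w ->
  let m := minor (fun k => th k p u) (fun k => th k p v) in
  let W i j := w (E i p) (E j p) in
  w u v = m o1 o2 * W o1 o2 + m o1 o3 * W o1 o3 + m o1 o4 * W o1 o4
    + m o2 o3 * W o2 o3 + m o2 o4 * W o2 o4 + m o3 o4 * W o3 o4.
Proof.
move=> Mp fw m W; have W0 i : W i i = 0 by have [w0 _ _] := fw; exact: w0.
have WN i j : W j i = - W i j by exact: form2_opp.
have -> : w u v = \sum_i th i p u * \sum_j th j p v * W i j.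
  rewrite {1}(theta_expansion E_dual u Mp) (form2_suml _ _ _ _ fw).
  apply: eq_bigr => i _; rewrite {1}(theta_expansion E_dual v Mp) (form2_sumr _ _ _ _ fw).
  by [].
rewrite !sum4 !W0 (WN o1 o2) (WN o1 o3) (WN o1 o4) (WN o2 o3) (WN o2 o4) (WN o3 o4) /m /minor.
generalize (W o1 o2) (W o1 o3) (W o1 o4) (W o2 o3) (W o2 o4) (W o3 o4).
by generalize (th o1 p u) (th o2 p u) (th o3 p u) (th o4 p u) (th o1 p v) (th o2 p v) (th o3 p v) (th o4 p v) => *; ring.
Qed.

Let e p i := E i p.

(** The volume form attached to [OmegaBar] is theta_1 /\ theta_2 /\ theta_4 /\ theta_3, whence the
    overall minus sign. *)
Lemma hodge_frame (w : form2 R 4) p u v : M p -> is_form2 w ->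
  let m := minor (fun k => th k p u) (fun k => th k p v) in
  let W i j := w (E i p) (E j p) in
  hodge (e p) (kahler_vol (OmegaBar a h H p)) w u v =
  - (m o1 o2 * W o3 o4 - m o1 o3 * W o2 o4 + m o1 o4 * W o2 o3
    + m o2 o3 * W o1 o4 - m o2 o4 * W o1 o3 + m o3 o4 * W o1 o2).
Proof.
move=> Mp fw m W; have W0 i : W i i = 0 by have [w0 _ _] := fw; exact: w0.
have WN i j : W j i = - W i j by exact: form2_opp.
have OB s t : OmegaBar a h H p s t = minor (fun k => th k p s) (fun k => th k p t) o1 o2
   + minor (fun k => th k p s) (fun k => th k p t) o4 o3 by [].
rewrite /hodge /kahler_vol /wedge22 /e !sum4 -/(W _ _) !OB !(theta_dual E_dual) //.
rewrite -!/(W _ _) !W0 (WN o1 o2) (WN o1 o3) (WN o1 o4) (WN o2 o3) (WN o2 o4) (WN o3 o4) /m /minor /basis4 /=.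
generalize (W o1 o2) (W o1 o3) (W o1 o4) (W o2 o3) (W o2 o4) (W o3 o4).
generalize (th o1 p u) (th o2 p u) (th o3 p u) (th o4 p u) (th o1 p v) (th o2 p v) (th o3 p v) (th o4 p v) => *.
by field.
Qed.

Lemma is_form2_asd_form A B C p :
  is_form2 (fun u v => asd_form A B C (fun k => th k p u) (fun k => th k p v)).
Proof.
have thl k c u v : th k p (c *: u + v) = c * th k p u + th k p v.
  by rewrite /th !coframe_covec covecD covecZ.
by split=> *; rewrite /asd_form /minor ?thl; ring.
Qed.

Lemma is_asd_asd_form A B C p : M p ->
  is_asd (e p) (kahler_vol (OmegaBar a h H p))
    (fun u v => asd_form A B C (fun k => th k p u) (fun k => th k p v)).
Proof.
move=> Mp; have F := is_form2_asd_form A B C p; split=> // u v.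
rewrite (hodge_frame u v Mp F) /= !(theta_dual E_dual) // /asd_form /minor /basis4 /=.
by generalize (th o1 p u) (th o2 p u) (th o3 p u) (th o4 p u) (th o1 p v) (th o2 p v) (th o3 p v) (th o4 p v) => *; ring.
Qed.

(** Anti-self-duality forces w_34 = w_12, w_24 = -w_13 and w_23 = w_14, so three components
    determine the form. *)
Lemma asdP (w : form2 R 4) p : M p -> is_asd (e p) (kahler_vol (OmegaBar a h H p)) w ->
  w = fun u v => asd_form (w (E o1 p) (E o2 p)) (w (E o1 p) (E o3 p)) (w (E o1 p) (E o4 p))
    (fun k => th k p u) (fun k => th k p v).
Proof.
move=> Mp [fw hw]; apply/funext => u; apply/funext => v.
have W12 := hw (E o1 p) (E o2 p); have W13 := hw (E o1 p) (E o3 p); have W14 := hw (E o1 p) (E o4 p).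
move: W12 W13 W14; rewrite !hodge_frame // !(theta_dual E_dual) // /minor /basis4 /= => W12 W13 W14.
rewrite (form2_frame u v Mp fw) /= /asd_form.
have -> : w (E o3 p) (E o4 p) = w (E o1 p) (E o2 p) by lra.
have -> : w (E o2 p) (E o4 p) = - w (E o1 p) (E o3 p) by lra.
have -> : w (E o2 p) (E o3 p) = w (E o1 p) (E o4 p) by lra.
by generalize (w (E o1 p) (E o2 p)) (w (E o1 p) (E o3 p)) (w (E o1 p) (E o4 p))
  (minor (th^~ p^~ u) (th^~ p^~ v)) => *; ring.
Qed.

Lemma asd_part_id (w : form2 R 4) p : is_asd (e p) (kahler_vol (OmegaBar a h H p)) w ->
  asd_part (e p) (kahler_vol (OmegaBar a h H p)) w = w.
Proof.
move=> [_ hw]; apply/funext => u; apply/funext => v; rewrite /asd_part hw.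
by generalize (w u v) => *; field.
Qed.

(** The Weyl operator preserves the anti-self-dual forms, so both projections in [weyl_minus] act as
    the identity. *)
Lemma weyl_minus_asd_form A B C p u v : M p ->
  weyl_minus g E (kahler_vol (OmegaBar a h H p)) p
    (fun u v => asd_form A B C (fun k => th k p u) (fun k => th k p v)) u v
  = asd_form (frame_mu a h H p / 3 * A) (- (frame_mu a h H p / 6) * B) (- (frame_mu a h H p / 6) * C)
      (fun k => th k p u) (fun k => th k p v).
Proof.
move=> Mp; rewrite /weyl_minus -/(e p) (asd_part_id (is_asd_asd_form A B C Mp)).
set w := (fun u v => asd_form A B C _ _).
have -> : weyl_op g E p w = fun u v =>
  asd_form (frame_mu a h H p / 3 * A) (- (frame_mu a h H p / 6) * B) (- (frame_mu a h H p / 6) * C)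
      (fun k => th k p u) (fun k => th k p v).
  apply/funext => s; apply/funext => t; rewrite /weyl_op.
  transitivity (2^-1 * \sum_i \sum_j model_weyl a (frame_mu a h H p) (fun k => th k p s) (fun k => th k p t)
      (basis4 j) (basis4 i) * w (E i p) (E j p)).
    apply: (congr1 ( *%R _)); apply: eq_bigr => i _; apply: eq_bigr => j _; apply: (congr1 ( *%R^~ _)).
    by rewrite -!(theta_dual E_dual _ Mp) /weyl /g riemE // !ricciE // scalE.
  rewrite (@model_weyl_asd _ a (frame_mu a h H p) A B C) => [|i j].
    rewrite /asd_form; generalize (frame_mu a h H p) (minor (th^~ p^~ s) (th^~ p^~ t)) => *; ring.
  by rewrite /w /asd_form !(theta_dual E_dual).
by rewrite asd_part_id //; exact: is_asd_asd_form.
Qed.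

(** Orthogonality to Omega kills the first component, and the operator is scalar on the remaining
    plane, so any basis of LM diagonalizes it. *)
Lemma weyl_minus_LM (w : form2 R 4) p u v : M p ->
  in_LM (e p) (kahler_vol (OmegaBar a h H p)) (Omega a h H p) w ->
  weyl_minus g E (kahler_vol (OmegaBar a h H p)) p w u v = - (frame_mu a h H p / 6) * w u v.
Proof.
move=> Mp [wasd wOm]; have := asdP Mp wasd.
have w12 : w (E o1 p) (E o2 p) = 0.
  have Omp s t : Omega a h H p s t = minor (fun k => th k p s) (fun k => th k p t) o1 o2
     + minor (fun k => th k p s) (fun k => th k p t) o3 o4 by [].
  move: wOm; rewrite /inner2 !sum4 /e !Omp !(theta_dual E_dual) // (asdP Mp wasd) /asd_form.
  rewrite !(theta_dual E_dual) // /minor /basis4 /=.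
  by generalize (w (E o1 p) (E o2 p)) (w (E o1 p) (E o3 p)) (w (E o1 p) (E o4 p)) => *; lra.
rewrite w12; move: (w (E o1 p) (E o3 p)) (w (E o1 p) (E o4 p)) => B C ->.
rewrite weyl_minus_asd_form // /asd_form mulr0.
generalize (frame_mu a h H p) (minor (th^~ p^~ u) (th^~ p^~ v)) => *; ring.
Qed.

Lemma weyl_minus_Omega p : M p ->
  is_asd (e p) (kahler_vol (OmegaBar a h H p)) (Omega a h H p) /\
  forall u v, weyl_minus g E (kahler_vol (OmegaBar a h H p)) p (Omega a h H p) u v
    = frame_mu a h H p / 3 * Omega a h H p u v.
Proof.
move=> Mp.
have -> : Omega a h H p = fun u v => asd_form 1 0 0 (fun k => th k p u) (fun k => th k p v).
  apply/funext => u; apply/funext => v; rewrite /asd_form !mul0r mul1r !addr0.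
  by [].
split; first exact: is_asd_asd_form.
move=> u v; rewrite weyl_minus_asd_form // /asd_form.
generalize (frame_mu a h H p) (minor (th^~ p^~ u) (th^~ p^~ v)) => *; ring.
Qed.

Lemma sectional_perp p : M p -> sectional g p (E o1 p) (E o2 p) = frame_mu a h H p - 4 * a ^+ 2.
Proof.
move=> Mp; rewrite /sectional riemE // !(theta_dual E_dual) // /model_riem /minor /basis4 /=.
by generalize (frame_mu a h H p) => *; ring.
Qed.

Lemma sectional_fibre p : M p -> sectional g p (E o3 p) (E o4 p) = - 4 * a ^+ 2.
Proof.
move=> Mp; rewrite /sectional riemE // !(theta_dual E_dual) // /model_riem /minor /basis4 /=.
by generalize (frame_mu a h H p) => *; ring.
Qed.

End Parts.

(** * The Kaehler structure *)

Section Kahler.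
Context {R : realType}.
Variables (a : R) (U : set 'rV[R]_2) (h H : 'rV[R]_2 -> R) (E : 'I_4 -> vfield R 4).
Hypotheses (a_neq0 : a != 0) (U_open : open U) (h_smooth : smooth_on U h) (H_smooth : smooth_on U H).
Hypotheses (h_gt0 : forall q, U q -> 0 < h q) (H_gt0 : forall q, U q -> 0 < H q).
Hypothesis H_eq : forall q, U q ->
  laplacian (lnf H) q = - 2 * a ^+ 2 * h q ^+ 2 + 4 * a ^+ 2 * H q ^+ 2.
Hypothesis E_dual : dual_frame (domM U) (coframe a h H) E.
Variable J : endfield R 4.
Hypothesis J_form : forall p u v, domM U p ->
  kahler_form (metric a h H) J p u v = OmegaBar a h H p u v.

Let M := domM U.
Let g := metric a h H.
Let th k p u := coframe a h H k p u.
Implicit Types (p u v : 'rV[R]_4).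

Let M_open : open M := domM_open U_open.
Let riemE := riem_model a_neq0 U_open h_smooth H_smooth h_gt0 H_gt0 H_eq E_dual.
Let thD := differentiable_theta a U_open h_smooth H_smooth H_gt0.

Let thl k p c u v : th k p (c *: u + v) = c * th k p u + th k p v.
Proof. by rewrite /th !coframe_covec covecD covecZ. Qed.

Let thN k p u : th k p (- u) = - th k p u.
Proof. by rewrite /th !coframe_covec -scaleN1r covecZ mulN1r. Qed.

(* [J] permutes the coframe up to signs. *)
Let perm (k : 'I_4) : 'I_4 := nth o1 [:: o2; o1; o4; o3] k.
Let eps (k : 'I_4) : R := nth 0 [:: -1; 1; 1; -1] k.

(** [J] is known only through its Kaehler form; pairing [J p u] with E_k recovers its frame
    coordinates. *)
Lemma kahler_theta k p u : M p -> th k p (J p u) = eps k * th (perm k) p u.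
Proof.
move=> Mp; have := J_form u (E k p) Mp; rewrite /kahler_form (metric_E E_dual) // => E0.
rewrite [LHS]E0; clear E0.
have OB s t : OmegaBar a h H p s t = minor (fun k => th k p s) (fun k => th k p t) o1 o2
   + minor (fun k => th k p s) (fun k => th k p t) o4 o3 by [].
rewrite OB !(theta_dual E_dual) // /minor /basis4 /eps /perm.
elim/ord4_ind: k => /=;
  by generalize (th o1 p u) (th o2 p u) (th o3 p u) (th o4 p u) => *; ring.
Qed.

Lemma kahler_hermitian : almost_hermitian M g J.
Proof.
move=> p Mp; split=> [c u v|u|u v].
- by apply: (theta_ext E_dual Mp) => k; rewrite -!/(th _ _ _) thl !kahler_theta // thl; ring.
- apply: (theta_ext E_dual Mp) => k; rewrite -!/(th _ _ _) thN !kahler_theta // /eps /perm.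
  by elim/ord4_ind: k => /=; ring.
- rewrite /g !metric_sum !sum4 -!/(th _ _ _) !kahler_theta // /eps /perm /=.
  generalize (th o1 p u) (th o2 p u) (th o3 p u) (th o4 p u).
  by generalize (th o1 p v) (th o2 p v) (th o3 p v) (th o4 p v) => *; ring.
Qed.

(** Regularity of [J] is deduced from its expression in the frame. *)
Let differentiable_J v p j : M p -> differentiable (fun q => J q v 0 j) p.
Proof.
move=> Mp; pose f q := \sum_k eps k * th (perm k) q v * E k q 0 j.
have fE q : M q -> f q = J q v 0 j.
  move=> Mq; rewrite [in RHS](theta_expansion E_dual (J q v) Mq) summxE; apply: eq_bigr => k _.
  by rewrite mxE -/(th k q (J q v)) kahler_theta.
apply: (eq_on_differentiable M_open fE Mp).
suff Cf : Ck M 0 f by exact: Ck_differentiable Cf Mp.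
apply: (Ck_sum M_open) => k; apply: (CkM M_open); first apply: (CkM M_open); first exact: Ck_cst.
  have -> : (fun q => th (perm k) q v) = (fun q => covec (coframe_coeffs a h H (perm k)) q v).
    by apply/funext => q; rewrite /th coframe_covec.
  exact: (Ck_covec v M_open (Ck_coframe_coeffs a U_open h_smooth H_smooth H_gt0 0 _)).
have dual q i l : M q -> covec (coframe_coeffs a h H i) q (E l q) = (i == l)%:R.
  by move=> Mq; rewrite -coframe_covec; exact: E_dual.
exact: (Ck_frame M_open (Ck_coframe_coeffs a U_open h_smooth H_smooth H_gt0) dual).
Qed.

(** In the frame [J] is a constant matrix, and parallelism says that the connection matrix commutes
    with it. This is the content of omega_14 = omega_23 and omega_24 = - omega_13. *)
Lemma kahler_parallel p u v : M p ->
  nabla g (cst u) (fun q => J q v) p = J p (nabla g (cst u) (cst v) p).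
Proof.
move=> Mp; have nE := nabla_theta a_neq0 U_open h_smooth H_smooth h_gt0 H_gt0 H_eq E_dual.
apply: (theta_ext E_dual Mp) => k.
rewrite nE //; last by move=> j; exact: differentiable_J.
rewrite -[RHS]/(th k p _) kahler_theta // /th nE //; last by move=> j; exact: differentiable_cst.
have -> : 'D_(cst u p) (fun q => coframe a h H k q (J q v)) p =
    eps k * 'D_u (fun q => th (perm k) q v) p.
  rewrite (eq_on_derive (g := fun q => eps k * th (perm k) q v) M_open) //; last first.
    by move=> q Mq; exact: kahler_theta.
  have D := derivableP (diff_derivable (v := u) (thD (perm k) v Mp)).
  by rewrite (derive_val (is_derive := pder_mul (pder_cst (eps k) p u) D)) mulr0 addr0.
under eq_bigr do rewrite -/(th _ _ _) kahler_theta //.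
rewrite mulrDr; congr (_ + _).
have m1 := (mix_form_theta a h H p u).1; have m2 := (mix_form_theta a h H p u).2.
rewrite !sum4 /conn /eps /perm; elim/ord4_ind: k => /=; rewrite -?/(th _ _ _) ?m1 ?m2;
 generalize (th o1 p u) (th o2 p u) (tanh (a * zc p));
 generalize (th o1 p v) (th o2 p v) (th o3 p v) (th o4 p v) (psi_form a h H p u) (chi_form a H p u) => *; ring.
Qed.

(** For mu = 0 the quantity is -4 a^2 |u|^4. *)
Lemma space_form_curvature p u : M p -> frame_mu a h H p = 0 -> g p u u = 1 ->
  riem g p u (J p u) (J p u) u = - 4 * a ^+ 2.
Proof.
move=> Mp mu0; rewrite riemE // /g metric_sum !sum4 mu0.
have -> : (fun k => coframe a h H k p (J p u)) = (fun k => eps k * th (perm k) p u).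
  by apply/funext => k; exact: kahler_theta.
rewrite /model_riem /minor /eps /perm /= -!/(th _ _ _).
generalize (th o1 p u) (th o2 p u) (th o3 p u) (th o4 p u) => x1 x2 x3 x4 n1.
transitivity (- 4 * a ^+ 2 * (x1 * x1 + x2 * x2 + x3 * x3 + x4 * x4) ^+ 2); first by ring.
by rewrite n1; ring.
Qed.

Lemma frame_mu_eq0 p : M p -> frame_mu a h H p = 0 <->
  laplacian (lnf h) (xy p) = 4 * a ^+ 2 * h (xy p) ^+ 2 - 2 * a ^+ 2 * H (xy p) ^+ 2.
Proof.
move=> [Up _]; have hp := h_gt0 Up; rewrite /frame_mu; split=> [/eqP|->]; last first.
  by rewrite subrr mul0r.
rewrite mulf_eq0 invr_eq0 mulf_eq0 !expf_eq0 /= (negbTE (cosh_neq0 _)) (gt_eqF hp) !orbF subr_eq0.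
by move/eqP.
Qed.

Lemma space_formP : is_space_form M g J <->
  forall q, U q -> laplacian (lnf h) q = 4 * a ^+ 2 * h q ^+ 2 - 2 * a ^+ 2 * H q ^+ 2.
Proof.
split=> [[_ [c Hc]] q Uq|lap].
  (* A point above q, at z = -1. There E_1 and E_3 span complex lines of curvatures mu - 4 a^2 and
     -4 a^2, so constancy forces mu = 0. *)
  pose p : 'rV[R]_4 := \row_k [:: q 0 0; q 0 1; -1; 0]`_k.
  have pq : xy p = q by apply/rowP => k; rewrite !mxE; case: k => [[|[|//]]] i; congr (q _ _); exact: val_inj.
  have Mp : M p by split; [rewrite pq|rewrite /zc mxE /=; lra].
  have gE k : g p (E k p) (E k p) = 1 by rewrite /g (metric_E E_dual) // [LHS]E_dual // eqxx.
  have JE k : (fun l => coframe a h H l p (J p (E k p))) = (fun l => eps l * (perm l == k)%:R).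
    by apply/funext => l; rewrite -/(th l p _) kahler_theta // [th _ _ _]E_dual.
  have := Hc p (E o1 p) Mp (gE o1); have := Hc p (E o3 p) Mp (gE o3).
  rewrite !riemE // !JE !(theta_dual E_dual) // /model_riem /minor /basis4 /eps /perm /= => E3 E1.
  have /(frame_mu_eq0 Mp) : frame_mu a h H p = 0.
    by move: E1 E3; generalize (frame_mu a h H p) => mu; lra.
  by rewrite pq.
split; first by split; [exact: kahler_hermitian|exact: kahler_parallel].
exists (- 4 * a ^+ 2) => p u Mp; apply: space_form_curvature => //.
by apply/frame_mu_eq0 => //; apply: lap; case: Mp.
Qed.

End Kahler.

(** * The developing map into the complex ball *)

Section MatrixFrobenius.
Context {R : realType}.

Lemma is_derive_mulmx (V : normedModType R) m n l (X : V -> 'M[R]_(m, n)) (Y : V -> 'M[R]_(n, l))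
    (dX : 'M[R]_(m, n)) (dY : 'M[R]_(n, l)) (p v : V) :
  (forall a b, is_derive p v (fun q => X q a b) (dX a b)) ->
  (forall a b, is_derive p v (fun q => Y q a b) (dY a b)) ->
  forall a b, is_derive p v (fun q => (X q *m Y q) a b) ((dX *m Y p + X p *m dY) a b).
Proof.
move=> DX DY a b.
have -> : (fun q => (X q *m Y q) a b) = \sum_(k < n) (fun q => X q a k * Y q k b).
  by apply/funext => q; rewrite fct_sumE mxE.
have -> : (dX *m Y p + X p *m dY) a b = \sum_(k < n) (X p a k * dY k b + Y p k b * dX a k).
  rewrite !mxE -big_split; apply: eq_bigr => k _ /=.
  by rewrite addrC [dX a k * _]mulrC.
by apply: is_derive_sum => k; exact: pder_mul.
Qed.

Lemma constant_on_ball n (p0 : 'rV[R]_n) (r : R) f : 0 < r ->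
  (forall p, ball p0 r p -> differentiable f p) ->
  (forall p i, ball p0 r p -> pd i f p = 0) ->
  forall p, ball p0 r p -> f p = f p0.
Proof.
move=> r0 df pf p bp; have b0 : ball p0 r p0 by exact: ballxx.
have bs t : 0 <= t <= 1 -> ball p0 r (p0 + t *: (p - p0)).
  by apply: ball_segment => //; rewrite addrC subrK.
have [t t01] := mean_value_segment (f := f) (p := p0) (v := p - p0) (fun t t01 => df _ (bs t t01)).
rewrite [p0 + _]addrC subrK derive_pd; last exact: df (bs t t01).
rewrite big1 => [/eqP|i _]; first by rewrite subr_eq0 => /eqP.
by rewrite pf ?mulr0 //; exact: bs.
Qed.

Section Flat.
Context {n N : nat}.
Variables (U : set 'rV[R]_n) (A : 'I_n -> 'rV[R]_n -> 'M[R]_N).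
Hypotheses (U_open : open U) (cA : forall m i a b, Ck U m (fun q => A i q a b)).

(** Each row of [X] solves the system with its own initial value; the common radius lets the rows be
    assembled. *)
Lemma matrix_frobenius m p0 :
  (forall p i j, U p ->
    \matrix_(a, b) pd j (fun q => A i q a b) p + A j p *m A i p =
    \matrix_(a, b) pd i (fun q => A j q a b) p + A i p *m A j p) -> U p0 ->
  exists2 r : R, 0 < r & ball p0 r `<=` U /\ forall C : 'M[R]_(m, N),
    exists2 X : 'rV[R]_n -> 'M[R]_(m, N), X p0 = C &
      (forall k a b, Ck (ball p0 r) k (fun q => X q a b)) /\
      forall p i a b, ball p0 r p -> pd i (fun q => X q a b) p = (X p *m A i p) a b.
Proof.
move=> flat Up0; have [r r0 [rU sol]] := linear_frobenius U_open cA flat Up0.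
exists r => //; split=> // C; have /choice [f Hf] := fun j => sol (row j C).
pose X q : 'M[R]_(m, N) := \matrix_(j, k) f j q 0 k.
have XE a b : (fun q => X q a b) = (fun q => f a q 0 b) by apply/funext => q; rewrite mxE.
have pX p i a b : ball p0 r p -> pd i (fun q => X q a b) p = (X p *m A i p) a b.
  move=> bp; rewrite XE ((Hf a).2 p bp b).2 !mxE.
  by apply: eq_bigr => k _; rewrite mxE.
have bo : open (ball p0 r) by exact: ball_open.
exists X; first by apply/matrixP => a b; rewrite mxE (Hf a).1 mxE.
split=> // k; elim/ltn_ind: k => k IH a b; apply: Ck_intro => [p bp|l i lk].
  by rewrite XE; exact: ((Hf a).2 p bp b).1.
apply: (Ck_eq bo _ (Ck_sum bo (index_enum 'I_N)
  (fun c => CkM bo (IH l lk a c) (Ck_sub rU (cA l i c b))))) => q bq.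
by rewrite pX // mxE.
Qed.

(** The derivative of X W X^T is X (A W + W A^T) X^T, which vanishes. *)
Lemma parallel_form_constant m p0 r (X : 'rV[R]_n -> 'M[R]_(m, N)) (W : 'M[R]_N) : 0 < r ->
  (forall a b, Ck (ball p0 r) 0 (fun q => X q a b)) ->
  (forall p i a b, ball p0 r p -> pd i (fun q => X q a b) p = (X p *m A i p) a b) ->
  (forall p i, ball p0 r p -> A i p *m W + W *m (A i p)^T = 0) ->
  forall p, ball p0 r p -> X p *m W *m (X p)^T = X p0 *m W *m (X p0)^T.
Proof.
move=> r0 cX pX AW p bp; have bo : open (ball p0 r) by exact: ball_open.
apply/matrixP => a b.
have D q i c d : ball p0 r q -> is_derive q (bvec i) (fun x => X x c d) ((X q *m A i q) c d).
  by move=> bq; apply: DeriveDef; [exact/diff_derivable/(Ck_differentiable (cX c d))|exact: pX].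
have DW q i c d : ball p0 r q -> is_derive q (bvec i) (fun x => (W *m (X x)^T) c d) ((W *m (X q *m A i q)^T) c d).
  move=> bq; have -> : W *m (X q *m A i q)^T = 0 *m (X q)^T + W *m (X q *m A i q)^T by rewrite mul0mx add0r.
  apply: (is_derive_mulmx (X := fun=> W)) => [e f|e f]; first by rewrite mxE; exact: pder_cst.
  rewrite mxE; have -> : (fun x => (X x)^T e f) = (fun x => X x f e) by apply/funext => x; rewrite mxE.
  exact: D.
rewrite -!mulmxA.
apply: (constant_on_ball (f := fun q => (X q *m (W *m (X q)^T)) a b) r0) => // [q bq|q i bq].
  have XE : (fun x => (X x *m (W *m (X x)^T)) a b) = (fun x => \sum_c X x a c * \sum_d W c d * X x b d).
    by apply/funext => x; rewrite mxE; apply: eq_bigr => c _; rewrite mxE; congr (_ * _);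
      apply: eq_bigr => d _; rewrite mxE.
  rewrite XE; suff cf : Ck (ball p0 r) 0 (fun x => \sum_c X x a c * \sum_d W c d * X x b d).
    exact: Ck_differentiable cf bq.
  apply: (Ck_sum bo) => c; apply: (CkM bo) => //; apply: (Ck_sum bo) => d.
  by apply: (CkM bo) => //; exact: Ck_cst.
rewrite /pd (derive_val (is_derive := is_derive_mulmx (fun c d => D q i c d bq) (fun c d => DW q i c d bq) a b)).
by rewrite trmx_mul -!mulmxA -mulmxDr !mulmxA -mulmxDl AW // mul0mx mulmx0 mxE.
Qed.

End Flat.

(** Parallel transport controls the Gram matrix of the rows of P + i Q, whereas the frame vectors
    are its columns. In the real block form the row relation gives a right inverse, and a right
    inverse of a square matrix is also a left inverse. *)
Lemma unitary_transpose N (P Q eta : 'M[R]_N) : eta *m eta = 1%:M ->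
  P *m eta *m P^T + Q *m eta *m Q^T = eta -> P *m eta *m Q^T = Q *m eta *m P^T ->
  P^T *m eta *m P + Q^T *m eta *m Q = eta /\ P^T *m eta *m Q = Q^T *m eta *m P.
Proof.
move=> ee K K'.
pose F := block_mx P Q (- Q) P.
pose G := block_mx (eta *m P^T *m eta) (- (eta *m Q^T *m eta)) (eta *m Q^T *m eta) (eta *m P^T *m eta).
have FG : F *m G = 1%:M.
  rewrite /F /G mulmx_block !mulmxN !mulNmx !mulmxA -!mulmxDl K K' addNr.
  by rewrite opprK addrC -mulmxDl K ee -scalar_mx_block.
have := mulmx1C FG; rewrite /F /G mulmx_block !mulmxN !mulNmx opprK !(scalar_mx_block) => /eq_block_mx[E1 E2 _ _].
split.
  rewrite -[RHS]mulmx1 -E1 mulmxDr !mulmxA !ee.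
  by rewrite !mul1mx.
apply/eqP; rewrite -subr_eq0; apply/eqP.
by rewrite -(mulmx0 _ eta) -E2 mulmxDr mulmxN !mulmxA !ee !mul1mx.
Qed.

(* The complex matrix-valued one-form [B + i C], in the real form [[B, C], [-C, B]]. *)
Section Unitary.
Context {n N : nat}.
Variables (U : set 'rV[R]_n) (B C : 'I_n -> 'rV[R]_n -> 'M[R]_N) (eta : 'M[R]_N).
Hypotheses (U_open : open U) (eta_sq : eta *m eta = 1%:M).
Hypotheses (cB : forall m i a b, Ck U m (fun q => B i q a b))
  (cC : forall m i a b, Ck U m (fun q => C i q a b)).
Hypotheses (B_skew : forall i p, U p -> B i p *m eta + eta *m (B i p)^T = 0)
  (C_herm : forall i p, U p -> C i p *m eta = eta *m (C i p)^T).

Let d (F : 'I_n -> 'rV[R]_n -> 'M[R]_N) i j p := \matrix_(a, b) pd j (fun q => F i q a b) p : 'M[R]_N.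

Hypothesis flat_re : forall p i j, U p ->
  d B i j p + (B j p *m B i p - C j p *m C i p) = d B j i p + (B i p *m B j p - C i p *m C j p).
Hypothesis flat_im : forall p i j, U p ->
  d C i j p + (B j p *m C i p + C j p *m B i p) = d C j i p + (B i p *m C j p + C i p *m B j p).

Let A i q := block_mx (B i q) (C i q) (- C i q) (B i q).

Let cA m i a b : Ck U m (fun q => A i q a b).
Proof.
case: (split_ordP a) => j ->; case: (split_ordP b) => k ->.
- by have -> : (fun q => A i q (lshift N j) (lshift N k)) = (fun q => B i q j k)
    by apply/funext => q; rewrite /A block_mxEul.
- by have -> : (fun q => A i q (lshift N j) (rshift N k)) = (fun q => C i q j k)
    by apply/funext => q; rewrite /A block_mxEur.
- have -> : (fun q => A i q (rshift N j) (lshift N k)) = (fun q => - C i q j k)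
    by apply/funext => q; rewrite /A block_mxEdl mxE.
  exact: CkN.
- by have -> : (fun q => A i q (rshift N j) (rshift N k)) = (fun q => B i q j k)
    by apply/funext => q; rewrite /A block_mxEdr.
Qed.

Let dA i j p : U p -> \matrix_(a, b) pd j (fun q => A i q a b) p =
  block_mx (d B i j p) (d C i j p) (- d C i j p) (d B i j p).
Proof.
move=> Up; apply/matrixP => a b; rewrite mxE.
case: (split_ordP a) => k ->; case: (split_ordP b) => l ->.
- rewrite block_mxEul mxE; have -> // : (fun q => A i q (lshift N k) (lshift N l)) = (fun q => B i q k l).
  by apply/funext => q; rewrite /A block_mxEul.
- rewrite block_mxEur mxE; have -> // : (fun q => A i q (lshift N k) (rshift N l)) = (fun q => C i q k l).
  by apply/funext => q; rewrite /A block_mxEur.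
- rewrite block_mxEdl !mxE; have -> : (fun q => A i q (rshift N k) (lshift N l)) = (fun q => - C i q k l).
    by apply/funext => q; rewrite /A block_mxEdl mxE.
  have D := derivableP (diff_derivable (v := bvec j) (Ck_differentiable (cC 0 i k l) Up)).
  by rewrite /pd (derive_val (is_derive := pder_opp D)).
- rewrite block_mxEdr mxE; have -> // : (fun q => A i q (rshift N k) (rshift N l)) = (fun q => B i q k l).
  by apply/funext => q; rewrite /A block_mxEdr.
Qed.

Lemma unitary_frobenius p0 : U p0 ->
  exists2 r : R, 0 < r & ball p0 r `<=` U /\ exists P Q : 'rV[R]_n -> 'M[R]_N,
    [/\ forall k a b, Ck (ball p0 r) k (fun q => P q a b) /\ Ck (ball p0 r) k (fun q => Q q a b),
        forall p i a b, ball p0 r p ->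
          pd i (fun q => P q a b) p = (P p *m B i p - Q p *m C i p) a b /\
          pd i (fun q => Q q a b) p = (P p *m C i p + Q p *m B i p) a b &
        forall p, ball p0 r p ->
          (P p)^T *m eta *m P p + (Q p)^T *m eta *m Q p = eta /\
          (P p)^T *m eta *m Q p = (Q p)^T *m eta *m P p].
Proof.
move=> Up0; have flat p i j : U p ->
    \matrix_(a, b) pd j (fun q => A i q a b) p + A j p *m A i p =
    \matrix_(a, b) pd i (fun q => A j q a b) p + A i p *m A j p.
  move=> Up; have Fr := flat_re i j Up; have Fi := flat_im i j Up.
  rewrite !dA // /A !mulmx_block !add_block_mx !mulNmx !mulmxN; congr block_mx => //.
  - by rewrite -opprD -[X in _ = _ + X]opprD -!opprD [C j p *m _ + _]addrC Fi [X in _ + X]addrC.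
  - by rewrite [X in _ + X = _]addrC Fr [X in _ + X]addrC.
have [r r0 [rU sol]] := matrix_frobenius U_open cA N flat Up0.
exists r => //; split=> //; have [X X0 [cX pX]] := sol (row_mx 1%:M 0).
exists (fun q => lsubmx (X q)), (fun q => rsubmx (X q)).
have XA p i : X p *m A i p = row_mx (lsubmx (X p) *m B i p - rsubmx (X p) *m C i p)
   (lsubmx (X p) *m C i p + rsubmx (X p) *m B i p).
  by rewrite -{1}(hsubmxK (X p)) mul_row_block mulmxN.
have LE a b : (fun q => lsubmx (X q) a b) = (fun q => X q a (lshift N b)).
  by apply/funext => q; rewrite mxE.
have RE a b : (fun q => rsubmx (X q) a b) = (fun q => X q a (rshift N b)).
  by apply/funext => q; rewrite mxE.
split=> [k a b|p i a b bp|p bp]; first by rewrite LE RE.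
  by rewrite LE RE !pX // XA row_mxEl row_mxEr.
(* [W] and [W'] represent the real and imaginary parts of the Hermitian form with matrix eta. *)
pose W : 'M[R]_(N + N) := block_mx eta 0 0 eta.
pose W' : 'M[R]_(N + N) := block_mx 0 eta (- eta) 0.
have AW q i : ball p0 r q -> A i q *m W + W *m (A i q)^T = 0.
  move=> /rU Uq; rewrite /A /W tr_block_mx !mulmx_block add_block_mx !mulmx0 !mul0mx !addr0 !add0r.
  rewrite B_skew // linearN /= mulmxN mulNmx C_herm // subrr addNr; exact: block_mx0.
have AW' q i : ball p0 r q -> A i q *m W' + W' *m (A i q)^T = 0.
  move=> /rU Uq; rewrite /A /W' tr_block_mx !mulmx_block add_block_mx !mulmx0 !mul0mx !addr0 !add0r.
  have tN : (- C i q)^T = - (C i q)^T by rewrite linearN.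
  rewrite !tN !mulmxN !mulNmx C_herm // opprK addNr -opprD B_skew // oppr0.
  exact: block_mx0.
have K := parallel_form_constant r0 (cX 0) pX AW bp.
have K' := parallel_form_constant r0 (cX 0) pX AW' bp.
move: K K'; rewrite X0 -(hsubmxK (X p)); set P := lsubmx _; set Q := rsubmx _.
rewrite /W /W' !mul_row_block !tr_row_mx !mul_row_col !mulmx0 !addr0 !add0r !mulmxN.
rewrite row_mxKl row_mxKr trmx1 trmx0 !mul1mx !mulmx1 !mul0mx !mulmx0 !mulNmx oppr0 !addr0.
move=> K /eqP; rewrite addrC subr_eq0 => /eqP K'.
exact: unitary_transpose.
Qed.

End Unitary.
End MatrixFrobenius.

(** * The flat su(2,1)-valued one-form on U *)

Section FlatConnection.
Context {R : realType}.
Variables (a : R) (U : set 'rV[R]_2) (h H : 'rV[R]_2 -> R).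
Hypotheses (U_open : open U) (h_smooth : smooth_on U h) (H_smooth : smooth_on U H).
Hypotheses (h_gt0 : forall q, U q -> 0 < h q) (H_gt0 : forall q, U q -> 0 < H q).

Let ex (i : 'I_2) : R := (i == 0)%:R.
Let ey (i : 'I_2) : R := (i != 0)%:R.

Definition mx3 (s : seq (seq R)) : 'M[R]_3 := \matrix_(j, k) nth 0 (nth [::] s j) k.

Definition eta3 : 'M[R]_3 := mx3 [:: [:: -1; 0; 0]; [:: 0; 1; 0]; [:: 0; 0; 1]].

(** Components of f_y dx - f_x dy, minus the Hodge star of df. Its exterior derivative is minus the
    Laplacian of f times dx /\ dy, which is how the Laplace equations enter. *)
Definition star (f : 'rV[R]_2 -> R) (i : 'I_2) q : R := if i == 0 then dy2 f q else - dx2 f q.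

(** Put zeta = x + i y. The off-diagonal entries of [conn_re] + i [conn_im] are a h d zeta in place
    (1, 0), a H d zeta in place (0, 2), and their conjugates in the transposed places. They
    determine only differences of diagonal entries; the thirds in [conn_im] normalize the trace to
    zero. *)
Definition conn_re (i : 'I_2) q : 'M[R]_3 :=
  (a * ex i * h q) *: mx3 [:: [:: 0; 1; 0]; [:: 1; 0; 0]; [:: 0; 0; 0]]
  + (a * ex i * H q) *: mx3 [:: [:: 0; 0; 1]; [:: 0; 0; 0]; [:: 1; 0; 0]].

Definition conn_im (i : 'I_2) q : 'M[R]_3 :=
  (a * ey i * h q) *: mx3 [:: [:: 0; -1; 0]; [:: 1; 0; 0]; [:: 0; 0; 0]]
  + (a * ey i * H q) *: mx3 [:: [:: 0; 0; 1]; [:: 0; 0; 0]; [:: -1; 0; 0]]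
  + (star (lnf h) i q / 3) *: mx3 [:: [:: 1; 0; 0]; [:: 0; -2; 0]; [:: 0; 0; 1]]
  + (star (lnf H) i q / 3) *: mx3 [:: [:: -1; 0; 0]; [:: 0; -1; 0]; [:: 0; 0; 2]].

Lemma eta3_sq : eta3 *m eta3 = 1%:M.
Proof.
apply/matrixP => i j; rewrite !mxE !big_ord_recl big_ord0 !mxE.
by case: i => [[|[|[|//]]] ?]; case: j => [[|[|[|//]]] ?] /=; ring.
Qed.

Lemma conn_re_skew i q : conn_re i q *m eta3 + eta3 *m (conn_re i q)^T = 0.
Proof.
apply/matrixP => j k; rewrite !mxE !big_ord_recl !big_ord0 !mxE.
by generalize (a * ex i * h q) (a * ex i * H q) => x y;
  case: j => [[|[|[|//]]] ?]; case: k => [[|[|[|//]]] ?] /=; ring.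
Qed.

Lemma conn_im_herm i q : conn_im i q *m eta3 = eta3 *m (conn_im i q)^T.
Proof.
apply/matrixP => j k; rewrite !mxE !big_ord_recl !big_ord0 !mxE.
by generalize (a * ey i * h q) (a * ey i * H q) (star (lnf h) i q / 3) (star (lnf H) i q / 3) => x y z t;
  case: j => [[|[|[|//]]] ?]; case: k => [[|[|[|//]]] ?] /=; ring.
Qed.

Let ch m : Ck U m h. Proof. exact: (smooth_onP _ _).1 h_smooth m. Qed.
Let cH m : Ck U m H. Proof. exact: (smooth_onP _ _).1 H_smooth m. Qed.

Lemma Ck_star f m i : (forall k, Ck U k f) -> Ck U m (star f i).
Proof.
move=> cf; rewrite /star; case: (i == 0); first exact: (Ck_pd _ (ltnSn m) (cf m.+1)).
by apply: (CkN U_open); exact: (Ck_pd _ (ltnSn m) (cf m.+1)).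
Qed.

Let cl m f : (forall k, Ck U k f) -> (forall q, U q -> 0 < f q) -> Ck U m (lnf f).
Proof. by move=> cf f0; exact: (Ck_lnf U_open m cf f0). Qed.

Let reE i j k : (fun q => conn_re i q j k) = fun q =>
  a * ex i * h q * mx3 [:: [:: 0; 1; 0]; [:: 1; 0; 0]; [:: 0; 0; 0]] j k
  + a * ex i * H q * mx3 [:: [:: 0; 0; 1]; [:: 0; 0; 0]; [:: 1; 0; 0]] j k.
Proof. by apply/funext => q; rewrite /conn_re !mxE. Qed.

Let imE i j k : (fun q => conn_im i q j k) = fun q =>
  a * ey i * h q * mx3 [:: [:: 0; -1; 0]; [:: 1; 0; 0]; [:: 0; 0; 0]] j k
  + a * ey i * H q * mx3 [:: [:: 0; 0; 1]; [:: 0; 0; 0]; [:: -1; 0; 0]] j k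
  + star (lnf h) i q * 3^-1 * mx3 [:: [:: 1; 0; 0]; [:: 0; -2; 0]; [:: 0; 0; 1]] j k
  + star (lnf H) i q * 3^-1 * mx3 [:: [:: -1; 0; 0]; [:: 0; -1; 0]; [:: 0; 0; 2]] j k.
Proof. by apply/funext => q; rewrite /conn_im !mxE. Qed.

Lemma Ck_conn_re m i j k : Ck U m (fun q => conn_re i q j k).
Proof.
rewrite reE; apply: (CkD U_open); (apply: (CkM U_open); last exact: Ck_cst);
  by apply: (CkM U_open); [exact: Ck_cst|].
Qed.

Lemma Ck_conn_im m i j k : Ck U m (fun q => conn_im i q j k).
Proof.
rewrite imE; apply: (CkD U_open); [apply: (CkD U_open); [apply: (CkD U_open)|]|];
  (apply: (CkM U_open); last exact: Ck_cst);
  (apply: (CkM U_open); try exact: Ck_cst) => //;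
  by apply: Ck_star => l; apply: cl.
Qed.

Let pd_star f i j p : (forall k, Ck U k f) -> U p ->
  is_derive p (bvec j) (star f i) (pd j (star f i) p).
Proof.
move=> cf Up; apply: derivableP; apply: diff_derivable.
exact: Ck_differentiable (Ck_star 0 i cf) Up.
Qed.

Let pd_f f i p : (forall k, Ck U k f) -> (forall q, U q -> 0 < f q) -> U p ->
  is_derive p (bvec i) f (f p * pd i (lnf f) p).
Proof.
move=> cf f0 Up; have df := Ck_differentiable (cf 0%N) Up.
apply: is_derive_eq (derivableP (diff_derivable (v := bvec i) df)) _.
by rewrite /pd derive_lnf ?f0 // mulrC divfK // gt_eqF // f0.
Qed.

Lemma pd_conn_re i j p (lh lH : R) : U p -> pd j (lnf h) p = lh -> pd j (lnf H) p = lH ->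
  \matrix_(k, l) pd j (fun q => conn_re i q k l) p =
  (a * ex i * (h p * lh)) *: mx3 [:: [:: 0; 1; 0]; [:: 1; 0; 0]; [:: 0; 0; 0]]
  + (a * ex i * (H p * lH)) *: mx3 [:: [:: 0; 0; 1]; [:: 0; 0; 0]; [:: 1; 0; 0]].
Proof.
move=> Up <- <-; apply/matrixP => k l; rewrite !mxE reE.
have D m f (c : R) : (forall k, Ck U k f) -> (forall q, U q -> 0 < f q) ->
    is_derive p (bvec j) (fun q => c * f q * m) (c * (f p * pd j (lnf f) p) * m).
  move=> cf f0; have Df := pder_mul (pder_mul (pder_cst c _ _) (pd_f j cf f0 Up)) (pder_cst m _ _).
  apply: is_derive_eq Df _; generalize (c * (f p * pd j (lnf f) p)) (f p) (c * f p) => *; ring.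
rewrite /pd (derive_val (is_derive := pder_add (D _ _ _ ch h_gt0) (D _ _ _ cH H_gt0))).
by rewrite !mxE.
Qed.

Lemma pd_conn_im i j p (lh lH sh sH : R) : U p -> pd j (lnf h) p = lh -> pd j (lnf H) p = lH ->
  pd j (star (lnf h) i) p = sh -> pd j (star (lnf H) i) p = sH ->
  \matrix_(k, l) pd j (fun q => conn_im i q k l) p =
  (a * ey i * (h p * lh)) *: mx3 [:: [:: 0; -1; 0]; [:: 1; 0; 0]; [:: 0; 0; 0]]
  + (a * ey i * (H p * lH)) *: mx3 [:: [:: 0; 0; 1]; [:: 0; 0; 0]; [:: -1; 0; 0]]
  + (sh / 3) *: mx3 [:: [:: 1; 0; 0]; [:: 0; -2; 0]; [:: 0; 0; 1]]
  + (sH / 3) *: mx3 [:: [:: -1; 0; 0]; [:: 0; -1; 0]; [:: 0; 0; 2]].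
Proof.
move=> Up <- <- <- <-; apply/matrixP => k l; rewrite !mxE imE.
have D m f (c : R) : (forall k, Ck U k f) -> (forall q, U q -> 0 < f q) ->
    is_derive p (bvec j) (fun q => c * f q * m) (c * (f p * pd j (lnf f) p) * m).
  move=> cf f0; have Df := pder_mul (pder_mul (pder_cst c _ _) (pd_f j cf f0 Up)) (pder_cst m _ _).
  apply: is_derive_eq Df _; generalize (c * (f p * pd j (lnf f) p)) (f p) (c * f p) => *; ring.
have S m f (c : R) : (forall k, Ck U k f) ->
    is_derive p (bvec j) (fun q => star f i q * c * m) (pd j (star f i) p * c * m).
  move=> cf; have Df := pder_mul (pder_mul (pd_star i j cf Up) (pder_cst c _ _)) (pder_cst m _ _).
  apply: is_derive_eq Df _; generalize (pd j (star f i) p) (star f i p) (star f i p * c) => *; ring.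
have clh n := cl n ch h_gt0; have clH n := cl n cH H_gt0.
rewrite /pd (derive_val (is_derive := pder_add (pder_add (pder_add (D _ _ _ ch h_gt0) (D _ _ _ cH H_gt0))
   (S _ _ _ clh)) (S _ _ _ clH))).
by rewrite !mxE.
Qed.

Hypothesis H_eq : forall q, U q ->
  laplacian (lnf H) q = - 2 * a ^+ 2 * h q ^+ 2 + 4 * a ^+ 2 * H q ^+ 2.
Hypothesis h_eq : forall q, U q ->
  laplacian (lnf h) q = 4 * a ^+ 2 * h q ^+ 2 - 2 * a ^+ 2 * H q ^+ 2.

Let x2 : 'I_2 := @Ordinal 2 0 isT.
Let y2 : 'I_2 := @Ordinal 2 1 isT.

Let ord2_ind (P : 'I_2 -> Prop) : P x2 -> P y2 -> forall i, P i.
Proof.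
move=> P0 P1 [[|[|//]] i]; [have -> : Ordinal i = x2 by exact: val_inj|].
  by [].
by have -> : Ordinal i = y2 by exact: val_inj.
Qed.

Let pd_star_xy f p : (forall k, Ck U k f) -> U p ->
  pd y2 (star f x2) p = dy2 (dy2 f) p /\ pd x2 (star f y2) p = - dx2 (dx2 f) p.
Proof.
move=> cf Up; split; first by [].
have D : differentiable (dx2 f) p by exact: Ck_differentiable (Ck_pd x2 (ltnSn 0) (cf 1%N)) Up.
by rewrite /pd (derive_val (is_derive := pder_opp (derivableP (diff_derivable (v := bvec x2) D)))).
Qed.

(** Off the diagonal the equations are identities between first derivatives of ln h and ln H. The
    diagonal ones have zero sum and amount to the two Laplace equations. *)
Let flat_xy p : U p ->
  (\matrix_(k, l) pd y2 (fun q => conn_re x2 q k l) p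
     + (conn_re y2 p *m conn_re x2 p - conn_im y2 p *m conn_im x2 p)
   = \matrix_(k, l) pd x2 (fun q => conn_re y2 q k l) p
     + (conn_re x2 p *m conn_re y2 p - conn_im x2 p *m conn_im y2 p)) /\
  (\matrix_(k, l) pd y2 (fun q => conn_im x2 q k l) p
     + (conn_re y2 p *m conn_im x2 p + conn_im y2 p *m conn_re x2 p)
   = \matrix_(k, l) pd x2 (fun q => conn_im y2 q k l) p
     + (conn_re x2 p *m conn_im y2 p + conn_im x2 p *m conn_re y2 p)).
Proof.
move=> Up; have clh n := cl n ch h_gt0; have clH n := cl n cH H_gt0.
have := h_eq Up; have := H_eq Up; rewrite /laplacian => eH eh.
have [s1 s2] := pd_star_xy clh Up; have [s3 s4] := pd_star_xy clH Up.
rewrite (pd_conn_re x2 Up (erefl (dy2 (lnf h) p)) (erefl (dy2 (lnf H) p))).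
rewrite (pd_conn_re y2 Up (erefl (dx2 (lnf h) p)) (erefl (dx2 (lnf H) p))).
rewrite (pd_conn_im Up (erefl (dy2 (lnf h) p)) (erefl (dy2 (lnf H) p)) s1 s3).
rewrite (pd_conn_im Up (erefl (dx2 (lnf h) p)) (erefl (dx2 (lnf H) p)) s2 s4).
rewrite /conn_re /conn_im.
have -> : star (lnf h) x2 p = dy2 (lnf h) p by [].
have -> : star (lnf H) x2 p = dy2 (lnf H) p by [].
have -> : star (lnf h) y2 p = - dx2 (lnf h) p by [].
have -> : star (lnf H) y2 p = - dx2 (lnf H) p by [].
have -> : ex x2 = 1 by []. have -> : ex y2 = 0 by []. have -> : ey x2 = 0 by []. have -> : ey y2 = 1 by [].
move: eH eh; generalize (dx2 (dx2 (lnf h)) p) (dx2 (dx2 (lnf H)) p) (dy2 (dy2 (lnf h)) p) (dy2 (dy2 (lnf H)) p).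
generalize (dx2 (lnf h) p) (dx2 (lnf H) p) (dy2 (lnf h) p) (dy2 (lnf H) p) (h p) (H p).
move=> lx Lx ly Ly hp Hp lxx Lxx lyy Lyy eH eh.
have {}eH : Lyy = - 2 * a ^+ 2 * hp ^+ 2 + 4 * a ^+ 2 * Hp ^+ 2 - Lxx by rewrite -eH; ring.
have {}eh : lyy = 4 * a ^+ 2 * hp ^+ 2 - 2 * a ^+ 2 * Hp ^+ 2 - lxx by rewrite -eh; ring.
rewrite {}eH {}eh !mulr1 !mulr0 !mul0r !scale0r !add0r ?addr0.
split; apply/matrixP => k l; rewrite !mxE !big_ord_recl !big_ord0 !mxE;
  case: k => [[|[|[|//]]] ?]; case: l => [[|[|[|//]]] ?] /=; by field.
Qed.

Lemma flat_conn_re p i j : U p ->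
  \matrix_(k, l) pd j (fun q => conn_re i q k l) p
     + (conn_re j p *m conn_re i p - conn_im j p *m conn_im i p)
  = \matrix_(k, l) pd i (fun q => conn_re j q k l) p
     + (conn_re i p *m conn_re j p - conn_im i p *m conn_im j p).
Proof. by move=> Up; elim/ord2_ind: i; elim/ord2_ind: j => //; rewrite (flat_xy Up).1. Qed.

Lemma flat_conn_im p i j : U p ->
  \matrix_(k, l) pd j (fun q => conn_im i q k l) p
     + (conn_re j p *m conn_im i p + conn_im j p *m conn_re i p)
  = \matrix_(k, l) pd i (fun q => conn_im j q k l) p
     + (conn_re i p *m conn_im j p + conn_im i p *m conn_re j p).
Proof. by move=> Up; elim/ord2_ind: i; elim/ord2_ind: j => //; rewrite (flat_xy Up).2. Qed.

Lemma flat_unitary_frame p0 : U p0 ->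
  exists2 r : R, 0 < r & ball p0 r `<=` U /\ exists P Q : 'rV[R]_2 -> 'M[R]_3,
    [/\ forall k i j, Ck (ball p0 r) k (fun q => P q i j) /\ Ck (ball p0 r) k (fun q => Q q i j),
        forall p l i j, ball p0 r p ->
          pd l (fun q => P q i j) p = (P p *m conn_re l p - Q p *m conn_im l p) i j /\
          pd l (fun q => Q q i j) p = (P p *m conn_im l p + Q p *m conn_re l p) i j &
        forall p, ball p0 r p ->
          (P p)^T *m eta3 *m P p + (Q p)^T *m eta3 *m Q p = eta3 /\
          (P p)^T *m eta3 *m Q p = (Q p)^T *m eta3 *m P p].
Proof.
apply: (unitary_frobenius U_open eta3_sq Ck_conn_re Ck_conn_im _ _ flat_conn_re flat_conn_im).
- by move=> i p _; exact: conn_re_skew.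
- by move=> i p _; exact: conn_im_herm.
Qed.

End FlatConnection.

(** * The Bergman metric in homogeneous coordinates *)

Section BergmanLift.
Context {R : realType}.

(** Take X = zeta (1, w) with zeta = p + i q and <X, X> = -1, which is n D = 1, and a tangent vector
    Y with Y_0 = y and Y_k = w_k y + x_k zeta. The left side is the Hermitian product of the parts
    of two such vectors orthogonal to X; the right side shows that it depends only on w and on the
    derivatives x_k of w. [Hr] and [Hi] are the parts of <Y, X>, [T1] and [T2] those of <x, w>. *)
Lemma bergman_lift (p q w1 w2 w3 w4 : R) (x1 x2 x3 x4 y1 y2 s1 s2 s3 s4 t1 t2 : R) :
  let n := p ^+ 2 + q ^+ 2 in
  let D := 1 - (w1 ^+ 2 + w2 ^+ 2 + w3 ^+ 2 + w4 ^+ 2) in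
  let T1 x1 x2 x3 x4 := x1 * w1 + x2 * w2 + x3 * w3 + x4 * w4 in
  let T2 x1 x2 x3 x4 := x2 * w1 - x1 * w2 + x4 * w3 - x3 * w4 in
  let zr w w' x x' y y' := w * y - w' * y' + (x * p - x' * q) in
  let zi w w' x x' y y' := w' * y + w * y' + (x' * p + x * q) in
  let Hr x1 x2 x3 x4 y1 y2 :=
    - (y1 * p + y2 * q)
    + (zr w1 w2 x1 x2 y1 y2 * (w1 * p - w2 * q) + zi w1 w2 x1 x2 y1 y2 * (w2 * p + w1 * q))
    + (zr w3 w4 x3 x4 y1 y2 * (w3 * p - w4 * q) + zi w3 w4 x3 x4 y1 y2 * (w4 * p + w3 * q)) in
  let Hi x1 x2 x3 x4 y1 y2 :=
    - (y2 * p - y1 * q)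
    + (zi w1 w2 x1 x2 y1 y2 * (w1 * p - w2 * q) - zr w1 w2 x1 x2 y1 y2 * (w2 * p + w1 * q))
    + (zi w3 w4 x3 x4 y1 y2 * (w3 * p - w4 * q) - zr w3 w4 x3 x4 y1 y2 * (w4 * p + w3 * q)) in
  n * D = 1 ->
  - (y1 * t1 + y2 * t2)
  + (zr w1 w2 x1 x2 y1 y2 * zr w1 w2 s1 s2 t1 t2 + zi w1 w2 x1 x2 y1 y2 * zi w1 w2 s1 s2 t1 t2)
  + (zr w3 w4 x3 x4 y1 y2 * zr w3 w4 s3 s4 t1 t2 + zi w3 w4 x3 x4 y1 y2 * zi w3 w4 s3 s4 t1 t2)
  + (Hr x1 x2 x3 x4 y1 y2 * Hr s1 s2 s3 s4 t1 t2 + Hi x1 x2 x3 x4 y1 y2 * Hi s1 s2 s3 s4 t1 t2)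
  = n * (x1 * s1 + x2 * s2 + x3 * s3 + x4 * s4)
    + n ^+ 2 * (T1 x1 x2 x3 x4 * T1 s1 s2 s3 s4 + T2 x1 x2 x3 x4 * T2 s1 s2 s3 s4).
Proof.
move=> n D T1 T2 zr zi Hr Hi nD.
have HrE x1' x2' x3' x4' y1' y2' : Hr x1' x2' x3' x4' y1' y2' =
    n * T1 x1' x2' x3' x4' - D * (y1' * p + y2' * q).
  by rewrite /Hr /n /D /T1 /zr /zi; ring.
have HiE x1' x2' x3' x4' y1' y2' : Hi x1' x2' x3' x4' y1' y2' =
    n * T2 x1' x2' x3' x4' - D * (y2' * p - y1' * q).
  by rewrite /Hi /n /D /T2 /zr /zi; ring.
(* The cofactor of n D - 1 in the difference of the two sides. *)
pose K := D * (y1 * t1 + y2 * t2)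
  - (T1 x1 x2 x3 x4 * (p * t1 + q * t2) + T2 x1 x2 x3 x4 * (p * t2 - q * t1))
  - (T1 s1 s2 s3 s4 * (p * y1 + q * y2) + T2 s1 s2 s3 s4 * (p * y2 - q * y1)).
apply/eqP; rewrite -subr_eq0; apply/eqP.
transitivity ((n * D - 1) * K); last by rewrite nD subrr mul0r.
rewrite !HrE !HiE /K.
have Q1 : - (y1 * t1 + y2 * t2)
  + (zr w1 w2 x1 x2 y1 y2 * zr w1 w2 s1 s2 t1 t2 + zi w1 w2 x1 x2 y1 y2 * zi w1 w2 s1 s2 t1 t2)
  + (zr w3 w4 x3 x4 y1 y2 * zr w3 w4 s3 s4 t1 t2 + zi w3 w4 x3 x4 y1 y2 * zi w3 w4 s3 s4 t1 t2)
  = - D * (y1 * t1 + y2 * t2) + n * (x1 * s1 + x2 * s2 + x3 * s3 + x4 * s4)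
   + (T1 x1 x2 x3 x4 * (p * t1 + q * t2) + T2 x1 x2 x3 x4 * (p * t2 - q * t1))
   + (T1 s1 s2 s3 s4 * (p * y1 + q * y2) + T2 s1 s2 s3 s4 * (p * y2 - q * y1)).
  by rewrite /n /D /T1 /T2 /zr /zi; ring.
rewrite Q1; generalize (T1 x1 x2 x3 x4) (T2 x1 x2 x3 x4) (T1 s1 s2 s3 s4) (T2 s1 s2 s3 s4) => a1 a2 b1 b2.
by rewrite /n; generalize D => d; ring.
Qed.

Lemma bergman_coord (a n : R) (w u v : 'rV[R]_4) : a != 0 ->
  n * (1 - (w 0 o1 ^+ 2 + w 0 o2 ^+ 2 + w 0 o3 ^+ 2 + w 0 o4 ^+ 2)) = 1 ->
  let T1 x := x 0 o1 * w 0 o1 + x 0 o2 * w 0 o2 + x 0 o3 * w 0 o3 + x 0 o4 * w 0 o4 in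
  let T2 x := x 0 o2 * w 0 o1 - x 0 o1 * w 0 o2 + x 0 o4 * w 0 o3 - x 0 o3 * w 0 o4 in
  a ^+ 2 * bergman a w u v =
  n * (u 0 o1 * v 0 o1 + u 0 o2 * v 0 o2 + u 0 o3 * v 0 o3 + u 0 o4 * v 0 o4)
  + n ^+ 2 * (T1 u * T1 v + T2 u * T2 v).
Proof.
move=> a0 nD T1 T2.
have n0 : n != 0 by apply: contra_eq_neq nD => ->; rewrite mul0r eq_sym oner_neq0.
have -> : bergman a w u v = a ^- 2 * (n * (u 0 o1 * v 0 o1 + u 0 o2 * v 0 o2 + u 0 o3 * v 0 o3 + u 0 o4 * v 0 o4)
  + n ^+ 2 * (T1 u * T1 v + T2 u * T2 v)).
  have dot : 1 - dot4 w w = n^-1 by apply: (mulfI n0); rewrite mulfV // -[RHS]nD /dot4 sum4.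
  rewrite /bergman dot invrK exprVn invrK /dot4 !sum4 !mxE /= /T1 /T2.
  by generalize (a ^- 2) => *; ring.
by rewrite mulrA mulfV ?mul1r // expf_neq0.
Qed.

End BergmanLift.

(** * The Hermitian form of signature (-, +, +) and its unitary invariance *)

Section Hermitian.
Context {R : realType}.
Implicit Types (x y : 'cV[R]_3).

(* Real and imaginary parts of the Hermitian form of signature (-, +, +) on
   [x + i x'] and [y + i y']. *)
Definition herm_re x x' y y' : R := (x^T *m eta3 *m y + x'^T *m eta3 *m y') 0 0.
Definition herm_im x x' y y' : R := herm_re x x' (- y') y.

Let k0 : 'I_3 := @Ordinal 3 0 isT.
Let k1 : 'I_3 := @Ordinal 3 1 isT.
Let k2 : 'I_3 := @Ordinal 3 2 isT.

Lemma sum3 (V : nmodType) (F : 'I_3 -> V) : \sum_i F i = F k0 + F k1 + F k2.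
Proof.
rewrite !big_ord_recl big_ord0 addr0 !addrA.
by congr (_ + _ + _); congr F; exact: val_inj.
Qed.

Lemma herm_reE x x' y y' : herm_re x x' y y' =
  - (x k0 0 * y k0 0 + x' k0 0 * y' k0 0) + (x k1 0 * y k1 0 + x' k1 0 * y' k1 0)
  + (x k2 0 * y k2 0 + x' k2 0 * y' k2 0).
Proof.
rewrite /herm_re !mxE !sum3 !mxE !sum3 !mxE /=.
ring.
Qed.

Lemma herm_imE x x' y y' : herm_im x x' y y' =
  - (x' k0 0 * y k0 0 - x k0 0 * y' k0 0) + (x' k1 0 * y k1 0 - x k1 0 * y' k1 0)
  + (x' k2 0 * y k2 0 - x k2 0 * y' k2 0).
Proof. by rewrite /herm_im herm_reE !mxE; ring. Qed.

Section Invariance.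
Variables (P Q : 'M[R]_3).
Hypotheses (PQ : P^T *m eta3 *m P + Q^T *m eta3 *m Q = eta3)
  (PQ' : P^T *m eta3 *m Q = Q^T *m eta3 *m P).

Lemma herm_re_invariant x x' y y' :
  herm_re (P *m x - Q *m x') (P *m x' + Q *m x) (P *m y - Q *m y') (P *m y' + Q *m y) = herm_re x x' y y'.
Proof.
have E1 (u v : 'cV[R]_3) : u^T *m eta3 *m v =
    u^T *m P^T *m eta3 *m P *m v + u^T *m Q^T *m eta3 *m Q *m v.
  by rewrite -{1}PQ mulmxDr mulmxDl !mulmxA.
have E2 (u v : 'cV[R]_3) : u^T *m P^T *m eta3 *m Q *m v = u^T *m Q^T *m eta3 *m P *m v.
  by have := congr1 (fun M => u^T *m M *m v) PQ'; rewrite /= !mulmxA.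
have tB (u v : 'cV[R]_3) : (u - v)^T = u^T - v^T by rewrite linearB.
have tD (u v : 'cV[R]_3) : (u + v)^T = u^T + v^T by rewrite linearD.
rewrite /herm_re [in RHS](E1 x y) [in RHS](E1 x' y').
rewrite tB tD !trmx_mul !(mulmxBl, mulmxBr, mulmxDl, mulmxDr) !mulmxN !mulmxA !E2.
move: (x^T *m P^T *m eta3 *m P *m y) (x^T *m Q^T *m eta3 *m Q *m y) (x'^T *m P^T *m eta3 *m P *m y')
  (x'^T *m Q^T *m eta3 *m Q *m y') (x^T *m Q^T *m eta3 *m P *m y') (x'^T *m Q^T *m eta3 *m P *m y) => *.
by rewrite !mxE; ring.
Qed.

Lemma herm_im_invariant x x' y y' :
  herm_im (P *m x - Q *m x') (P *m x' + Q *m x) (P *m y - Q *m y') (P *m y' + Q *m y) = herm_im x x' y y'.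
Proof.
rewrite /herm_im -(herm_re_invariant x x' (- y') y); congr herm_re.
  by rewrite mulmxN -opprD.
by rewrite mulmxN addrC.
Qed.

End Invariance.

End Hermitian.

(** * The lift to the hyperquadric and its projection *)

Section Developing.
Context {R : realType}.
Variables (a : R) (h H : 'rV[R]_2 -> R) (W : set 'rV[R]_2) (P Q : 'rV[R]_2 -> 'M[R]_3).
Hypotheses (a_neq0 : a != 0) (W_open : open W).
Hypothesis (cPQ : forall k i j, Ck W k (fun q => P q i j) /\ Ck W k (fun q => Q q i j)).
Hypothesis dPQ : forall p l i j, W p ->
  pd l (fun q => P q i j) p = (P p *m conn_re a h H l p - Q p *m conn_im a h H l p) i j /\
  pd l (fun q => Q q i j) p = (P p *m conn_im a h H l p + Q p *m conn_re a h H l p) i j.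
Hypothesis unitary : forall p, W p ->
  (P p)^T *m eta3 *m P p + (Q p)^T *m eta3 *m Q p = eta3 /\
  (P p)^T *m eta3 *m Q p = (Q p)^T *m eta3 *m P p.

Let k0 : 'I_3 := @Ordinal 3 0 isT.
Let k1 : 'I_3 := @Ordinal 3 1 isT.
Let k2 : 'I_3 := @Ordinal 3 2 isT.
Let x2 : 'I_2 := @Ordinal 2 0 isT.
Let y2 : 'I_2 := @Ordinal 2 1 isT.
Let M := domM W.
Implicit Types (p u v : 'rV[R]_4).

Definition col3 (x y z : R) : 'cV[R]_3 := \col_k [:: x; y; z]`_k.

(* In the flat frame [f] the developing map into the hyperquadric is
   [cosh (az) f_0 + sinh (az) i e^(2iat) f_2]. *)
Definition coord_re p := col3 (cosh (a * zc p)) 0 (- (sinh (a * zc p) * sin (2 * a * tc p))).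
Definition coord_im p := col3 0 0 (sinh (a * zc p) * cos (2 * a * tc p)).

Definition dcoord_re p v := col3 (a * sinh (a * zc p) * v 0 o3) 0
  (- (a * cosh (a * zc p) * v 0 o3 * sin (2 * a * tc p)
      + sinh (a * zc p) * (2 * a * v 0 o4 * cos (2 * a * tc p)))).
Definition dcoord_im p v := col3 0 0
  (a * cosh (a * zc p) * v 0 o3 * cos (2 * a * tc p)
   - sinh (a * zc p) * (2 * a * v 0 o4 * sin (2 * a * tc p))).

Definition Are p v := v 0 o1 *: conn_re a h H x2 (xy p) + v 0 o2 *: conn_re a h H y2 (xy p).
Definition Aim p v := v 0 o1 *: conn_im a h H x2 (xy p) + v 0 o2 *: conn_im a h H y2 (xy p).

(** The covariant derivative of the coordinate vector; P + i Q maps it to the derivative of the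
    lift. *)
Definition vel_re p v := Are p v *m coord_re p - Aim p v *m coord_im p + dcoord_re p v.
Definition vel_im p v := Are p v *m coord_im p + Aim p v *m coord_re p + dcoord_im p v.

Definition lift_re p := P (xy p) *m coord_re p - Q (xy p) *m coord_im p.
Definition lift_im p := P (xy p) *m coord_im p + Q (xy p) *m coord_re p.

Let ord3_ind (S : 'I_3 -> Prop) : S k0 -> S k1 -> S k2 -> forall i, S i.
Proof.
move=> S0 S1 S2 [[|[|[|//]]] i].
- by have -> : Ordinal i = k0 by exact: val_inj.
- by have -> : Ordinal i = k1 by exact: val_inj.
- by have -> : Ordinal i = k2 by exact: val_inj.
Qed.

Let is_derive_coord_reim p v k (j : 'I_1) :
  is_derive p v (fun q => coord_re q k j) (dcoord_re p v k j) /\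
  is_derive p v (fun q => coord_im q k j) (dcoord_im p v k j).
Proof.
have Dc := pder_cosh p a v; have Ds := pder_sinh p a v.
have Dk := pder_cos p (2 * a) v; have Di := pder_sin p (2 * a) v.
have E (x y z : 'rV[R]_4 -> R) i : (fun q => col3 (x q) (y q) (z q) i j) = fun q => [:: x q; y q; z q]`_i.
  by apply/funext => q; rewrite mxE.
rewrite /coord_re /coord_im !E /dcoord_re /dcoord_im !mxE.
elim/ord3_ind: k => /=; split; try exact: pder_cst.
- by apply: is_derive_eq Dc _; ring.
- apply: is_derive_eq (pder_opp (pder_mul Ds Di)) _.
  by generalize (cosh (a * zc p)) (sinh (a * zc p)) (cos (2 * a * tc p)) (sin (2 * a * tc p)) => *; ring.
- apply: is_derive_eq (pder_mul Ds Dk) _.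
  by generalize (cosh (a * zc p)) (sinh (a * zc p)) (cos (2 * a * tc p)) (sin (2 * a * tc p)) => *; ring.
Qed.

Let is_derive_frame p v i j : M p ->
  is_derive p v (fun q => P (xy q) i j) ((P (xy p) *m Are p v - Q (xy p) *m Aim p v) i j) /\
  is_derive p v (fun q => Q (xy q) i j) ((P (xy p) *m Aim p v + Q (xy p) *m Are p v) i j).
Proof.
move=> Mp; have Wp : W (xy p) by case: Mp.
have [DP DQ] := (dPQ x2 i j Wp, dPQ y2 i j Wp).
have [cP cQ] := cPQ 0 i j.
split.
- apply: is_derive_eq (pder_xy Mp v cP) _.
  rewrite /d2 -[dx2 _ _]/(pd x2 _ _) -[dy2 _ _]/(pd y2 _ _) DP.1 DQ.1 /Are /Aim.
  generalize (conn_re a h H x2 (xy p)) (conn_im a h H x2 (xy p)) (conn_re a h H y2 (xy p)) (conn_im a h H y2 (xy p)).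
  move=> A1 C1 A2 C2; rewrite !mulmxDr -!scalemxAr.
  move: (P (xy p) *m A1) (Q (xy p) *m C1) (P (xy p) *m A2) (Q (xy p) *m C2) => *.
  by rewrite !mxE; ring.
- apply: is_derive_eq (pder_xy Mp v cQ) _.
  rewrite /d2 -[dx2 _ _]/(pd x2 _ _) -[dy2 _ _]/(pd y2 _ _) DP.2 DQ.2 /Are /Aim.
  generalize (conn_re a h H x2 (xy p)) (conn_im a h H x2 (xy p)) (conn_re a h H y2 (xy p)) (conn_im a h H y2 (xy p)).
  move=> A1 C1 A2 C2; rewrite !mulmxDr -!scalemxAr.
  move: (P (xy p) *m C1) (Q (xy p) *m A1) (P (xy p) *m C2) (Q (xy p) *m A2) => *.
  by rewrite !mxE; ring.
Qed.

Lemma is_derive_lift p v k : M p ->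
  is_derive p v (fun q => lift_re q k 0) ((P (xy p) *m vel_re p v - Q (xy p) *m vel_im p v) k 0) /\
  is_derive p v (fun q => lift_im q k 0) ((P (xy p) *m vel_im p v + Q (xy p) *m vel_re p v) k 0).
Proof.
move=> Mp.
have DP i j := (is_derive_frame v i j Mp).1; have DQ i j := (is_derive_frame v i j Mp).2.
have Dr i j := (is_derive_coord_reim p v i j).1; have Di i j := (is_derive_coord_reim p v i j).2.
have re q : lift_re q k 0 = (P (xy q) *m coord_re q) k 0 + - (Q (xy q) *m coord_im q) k 0.
  by rewrite /lift_re; generalize (P (xy q) *m coord_re q) (Q (xy q) *m coord_im q) => *; rewrite !mxE.
have im q : lift_im q k 0 = (P (xy q) *m coord_im q) k 0 + (Q (xy q) *m coord_re q) k 0.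
  by rewrite /lift_im; generalize (P (xy q) *m coord_im q) (Q (xy q) *m coord_re q) => *; rewrite !mxE.
split.
- have -> : (fun q => lift_re q k 0) = _ := funext re.
  apply: is_derive_eq (pder_add (is_derive_mulmx DP Dr k 0) (pder_opp (is_derive_mulmx DQ Di k 0))) _.
  rewrite /vel_re /vel_im; clear.
  generalize (P (xy p)) (Q (xy p)) (Are p v) (Aim p v) (coord_re p) (coord_im p) (dcoord_re p v) (dcoord_im p v).
  move=> P0 Q0 A C xr xi dr di; rewrite !(mulmxBl, mulmxBr, mulmxDl, mulmxDr, mulmxN, mulNmx) !mulmxA.
  move: (P0 *m A *m xr) (P0 *m C *m xi) (P0 *m dr)
    (Q0 *m C *m xr) (Q0 *m A *m xi) (Q0 *m di) => *.
  by rewrite !mxE; ring.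
- have -> : (fun q => lift_im q k 0) = _ := funext im.
  apply: is_derive_eq (pder_add (is_derive_mulmx DP Di k 0) (is_derive_mulmx DQ Dr k 0)) _.
  rewrite /vel_re /vel_im; clear.
  generalize (P (xy p)) (Q (xy p)) (Are p v) (Aim p v) (coord_re p) (coord_im p) (dcoord_re p v) (dcoord_im p v).
  move=> P0 Q0 A C xr xi dr di; rewrite !(mulmxBl, mulmxBr, mulmxDl, mulmxDr, mulmxN, mulNmx) !mulmxA.
  move: (P0 *m A *m xi) (P0 *m C *m xr) (P0 *m di)
    (Q0 *m C *m xi) (Q0 *m A *m xr) (Q0 *m dr) => *.
  by rewrite !mxE; ring.
Qed.

Let sl f p v := dy2 f (xy p) * v 0 o1 - dx2 f (xy p) * v 0 o2.

Let AreE p v : Are p v = a *: mx3 [:: [:: 0; h (xy p) * v 0 o1; H (xy p) * v 0 o1];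
  [:: h (xy p) * v 0 o1; 0; 0]; [:: H (xy p) * v 0 o1; 0; 0]].
Proof.
rewrite /Are /conn_re (_ : (x2 == 0) = true) // (_ : (y2 == 0) = false) // !mulr0 !mul0r !scale0r addr0 scaler0 addr0.
generalize (h (xy p)) (H (xy p)) (v 0 o1) => x y z; apply/matrixP => i j; rewrite !mxE.
by elim/ord3_ind: i; elim/ord3_ind: j => /=; ring.
Qed.

Let AimE p v : Aim p v = a *: mx3 [:: [:: 0; - (h (xy p) * v 0 o2); H (xy p) * v 0 o2];
    [:: h (xy p) * v 0 o2; 0; 0]; [:: - (H (xy p) * v 0 o2); 0; 0]]
  + 3^-1 *: mx3 [:: [:: sl (lnf h) p v - sl (lnf H) p v; 0; 0];
    [:: 0; - 2 * sl (lnf h) p v - sl (lnf H) p v; 0]; [:: 0; 0; sl (lnf h) p v + 2 * sl (lnf H) p v]].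
Proof.
rewrite /Aim /conn_im /sl.
have -> : star (lnf h) x2 (xy p) = dy2 (lnf h) (xy p) by [].
have -> : star (lnf H) x2 (xy p) = dy2 (lnf H) (xy p) by [].
have -> : star (lnf h) y2 (xy p) = - dx2 (lnf h) (xy p) by [].
have -> : star (lnf H) y2 (xy p) = - dx2 (lnf H) (xy p) by [].
have -> : (x2 == 0) = true by []. have -> : (y2 == 0) = false by [].
generalize (dx2 (lnf h) (xy p)) (dx2 (lnf H) (xy p)) (dy2 (lnf h) (xy p)) (dy2 (lnf H) (xy p)) (h (xy p)) (H (xy p)).
generalize (v 0 o1) (v 0 o2) => *; apply/matrixP => i j; rewrite !mxE.
by elim/ord3_ind: i; elim/ord3_ind: j => /=; ring.
Qed.

(** The component along f_1 is a (theta_1 + i theta_2); [normal_theta] handles the other two. *)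
Lemma velE p v : let c := cosh (a * zc p) in let s := sinh (a * zc p) in
  let k := cos (2 * a * tc p) in let sg := sin (2 * a * tc p) in
  let sl := dy2 (lnf h) (xy p) * v 0 o1 - dx2 (lnf h) (xy p) * v 0 o2 in
  let sL := dy2 (lnf H) (xy p) * v 0 o1 - dx2 (lnf H) (xy p) * v 0 o2 in
  [/\ vel_re p v k0 0 = a * s * (v 0 o3 - H (xy p) * (sg * v 0 o1 + k * v 0 o2)),
      vel_im p v k0 0 = c * ((sl - sL) / 3) + a * s * H (xy p) * (k * v 0 o1 - sg * v 0 o2),
      vel_re p v k1 0 = c * a * h (xy p) * v 0 o1 /\ vel_im p v k1 0 = c * a * h (xy p) * v 0 o2,
      vel_re p v k2 0 = a * c * H (xy p) * v 0 o1 - s * k * ((sl + 2 * sL) / 3)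
         - (a * c * v 0 o3 * sg + s * (2 * a * v 0 o4 * k)) &
      vel_im p v k2 0 = - a * c * H (xy p) * v 0 o2 - s * sg * ((sl + 2 * sL) / 3)
         + (a * c * v 0 o3 * k - s * (2 * a * v 0 o4 * sg))].
Proof.
move=> c s k sg l L; rewrite /vel_re /vel_im AreE AimE.
have -> : sl (lnf h) p v = l by []. have -> : sl (lnf H) p v = L by [].
rewrite /coord_re /coord_im /dcoord_re /dcoord_im -/c -/s -/k -/sg.
generalize (h (xy p)) (H (xy p)) c s k sg l L (v 0 o1) (v 0 o2) (v 0 o3) (v 0 o4).
move=> h0 H0 c0 s0 kk ss l0 L0 v1 v2 v3 v4.
by split; try split; rewrite !mxE !sum3 !mxE /=; field.
Qed.

Lemma lift_norm p : M p -> herm_re (lift_re p) (lift_im p) (lift_re p) (lift_im p) = -1.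
Proof.
move=> [Wp _]; have [U1 U2] := unitary Wp.
rewrite /lift_re /lift_im herm_re_invariant // herm_reE /coord_re /coord_im !mxE /=.
have := cosh_sq (a * zc p); have := cos2Dsin2 (2 * a * tc p).
generalize (cosh (a * zc p)) (sinh (a * zc p)) (cos (2 * a * tc p)) (sin (2 * a * tc p)) => c s k sg e1 e2.
have e3 : k ^+ 2 = 1 - sg ^+ 2 by rewrite -e1; ring.
by ring: e2 e3.
Qed.

Definition dlift_re p v := P (xy p) *m vel_re p v - Q (xy p) *m vel_im p v.
Definition dlift_im p v := P (xy p) *m vel_im p v + Q (xy p) *m vel_re p v.

(* Decomposes along the point [x = (c, 0, s u)] of the hyperquadric, [u = i e^(2iat)], and the unit
   normal [(s, 0, c u)]. *)
Let hyperbolic_rotation (c s k sg d1 d2 z1 z2 d1' d2' z1' z2' : R) :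
  c ^+ 2 = 1 + s ^+ 2 -> k ^+ 2 = 1 - sg ^+ 2 ->
  let xr d1 z1 z2 := - (c * d1) + s * (k * z2 - sg * z1) in
  let nr d1 z1 z2 := - (s * d1) + c * (k * z2 - sg * z1) in
  let xi d2 z1 z2 := - (c * d2) - s * (sg * z2 + k * z1) in
  let ni d2 z1 z2 := - (s * d2) - c * (sg * z2 + k * z1) in
  - (d1 * d1' + d2 * d2') + (z1 * z1' + z2 * z2')
  + (xr d1 z1 z2 * xr d1' z1' z2' + xi d2 z1 z2 * xi d2' z1' z2')
  = nr d1 z1 z2 * nr d1' z1' z2' + ni d2 z1 z2 * ni d2' z1' z2'.
Proof. by move=> e1 e2 /=; ring: e1 e2. Qed.

(** The component of the velocity along the unit normal is a (theta_4 + i theta_3): the explicit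
    forms theta_3 and theta_4 emerge here from the developing map. *)
Let normal_theta p v :
  let c := cosh (a * zc p) in let s := sinh (a * zc p) in
  let k := cos (2 * a * tc p) in let sg := sin (2 * a * tc p) in
  - (s * vel_re p v k0 0) + c * (k * vel_im p v k2 0 - sg * vel_re p v k2 0) = a * theta4 a H p v /\
  - (s * vel_im p v k0 0) - c * (sg * vel_im p v k2 0 + k * vel_re p v k2 0) = a * theta3 a H p v.
Proof.
move=> c s k sg; have [-> -> _ -> ->] := velE p v.
rewrite /theta4 /theta3 /l2 /n2 -[2 * a * zc p]mulrA cosh_double sinh_double -/c -/s -/k -/sg.
have := cosh_sq (a * zc p); have := cos2Dsin2 (2 * a * tc p); rewrite -/c -/s -/k -/sg.
generalize (dx2 (lnf h) (xy p)) (dx2 (lnf H) (xy p)) (dy2 (lnf h) (xy p)) (dy2 (lnf H) (xy p)) (H (xy p)).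
generalize (v 0 o1) (v 0 o2) (v 0 o3) (v 0 o4) c s k sg.
move=> v1 v2 v3 v4 c0 s0 kk ss l1 L1 l0 L0 H0 e1 e2.
have e3 : kk ^+ 2 = 1 - ss ^+ 2 by rewrite -e1; ring.
by split; field: e2 e3.
Qed.

(** As <X, X> = -1, adding the products with X leaves the Hermitian form on the orthogonal
    complement of X. That complement is spanned by f_1 and the unit normal, where the velocity has
    known components. *)
Lemma lift_metric p u v : M p ->
  herm_re (dlift_re p u) (dlift_im p u) (dlift_re p v) (dlift_im p v)
  + (herm_re (dlift_re p u) (dlift_im p u) (lift_re p) (lift_im p)
       * herm_re (dlift_re p v) (dlift_im p v) (lift_re p) (lift_im p)
     + herm_im (dlift_re p u) (dlift_im p u) (lift_re p) (lift_im p)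
       * herm_im (dlift_re p v) (dlift_im p v) (lift_re p) (lift_im p))
  = a ^+ 2 * metric a h H p u v.
Proof.
move=> [Wp _]; have [U1 U2] := unitary Wp.
rewrite /dlift_re /dlift_im /lift_re /lift_im !herm_re_invariant // !herm_im_invariant //.
have [n1 n2] := normal_theta p u; have [m1 m2] := normal_theta p v.
have [_ _ [w1 w2] _ _] := velE p u; have [_ _ [w1' w2'] _ _] := velE p v.
have C2 := cosh_sq (a * zc p); have K2 : cos (2 * a * tc p) ^+ 2 = 1 - sin (2 * a * tc p) ^+ 2.
  by apply/eqP; rewrite eq_sym subr_eq cos2Dsin2.
have := hyperbolic_rotation (vel_re p u k0 0) (vel_im p u k0 0) (vel_re p u k2 0) (vel_im p u k2 0)
  (vel_re p v k0 0) (vel_im p v k0 0) (vel_re p v k2 0) (vel_im p v k2 0) C2 K2.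
rewrite /= n1 n2 m1 m2 => rot.
rewrite /metric sum4 /coframe /= /theta1 /theta2.
transitivity (vel_re p u k1 0 * vel_re p v k1 0 + vel_im p u k1 0 * vel_im p v k1 0
   + (a * theta4 a H p u * (a * theta4 a H p v) + a * theta3 a H p u * (a * theta3 a H p v))); last first.
  rewrite w1 w2 w1' w2'; generalize (theta3 a H p u) (theta4 a H p u) (theta3 a H p v) (theta4 a H p v).
  by generalize (cosh (a * zc p)) (h (xy p)) => *; ring.
rewrite -rot !herm_imE !herm_reE -/k0 -/k1 -/k2 /coord_re /coord_im /col3.
rewrite ![(\col_k [:: _; _; _]`_k) _ _]mxE /=.
generalize (vel_re p u k0 0) (vel_im p u k0 0) (vel_re p u k2 0) (vel_im p u k2 0) (vel_re p u k1 0) (vel_im p u k1 0).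
generalize (vel_re p v k0 0) (vel_im p v k0 0) (vel_re p v k2 0) (vel_im p v k2 0) (vel_re p v k1 0) (vel_im p v k1 0).
by generalize (cosh (a * zc p)) (sinh (a * zc p)) (cos (2 * a * tc p)) (sin (2 * a * tc p)) => *; ring.
Qed.

Definition lift_sq p := lift_re p k0 0 ^+ 2 + lift_im p k0 0 ^+ 2.

Definition aff_re k p := (lift_re p k 0 * lift_re p k0 0 + lift_im p k 0 * lift_im p k0 0) / lift_sq p.
Definition aff_im k p := (lift_im p k 0 * lift_re p k0 0 - lift_re p k 0 * lift_im p k0 0) / lift_sq p.

Definition devmap p : 'rV[R]_4 := \row_i [:: aff_re k1 p; aff_im k1 p; aff_re k2 p; aff_im k2 p]`_i.

(** <X, X> = -1 forces |X_0|^2 >= 1, so the affine coordinates X_k / X_0 make sense. *)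
Lemma lift_sq_gt0 p : M p -> 0 < lift_sq p.
Proof.
move=> Mp; have := lift_norm Mp; rewrite herm_reE -/k0 -/k1 -/k2 /lift_sq.
move: (lift_re p k0 0) (lift_im p k0 0) (lift_re p k1 0) (lift_im p k1 0) (lift_re p k2 0) (lift_im p k2 0).
move=> x y z t u v e; have := (sqr_ge0 z, sqr_ge0 t, sqr_ge0 u, sqr_ge0 v) => -[[[z0 t0] u0] v0].
by lra.
Qed.

Lemma lift_affine p k : M p ->
  lift_re p k 0 = aff_re k p * lift_re p k0 0 + - (aff_im k p * lift_im p k0 0) /\
  lift_im p k 0 = aff_im k p * lift_re p k0 0 + aff_re k p * lift_im p k0 0.
Proof.
move=> Mp; have := lift_sq_gt0 Mp; rewrite /aff_re /aff_im /lift_sq lt0r => /andP[+ _].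
generalize (lift_re p k0 0) (lift_im p k0 0) (lift_re p k 0) (lift_im p k 0) => x y z t n0.
by split; field.
Qed.

Lemma lift_sq_affine p : M p ->
  lift_sq p * (1 - (aff_re k1 p ^+ 2 + aff_im k1 p ^+ 2 + aff_re k2 p ^+ 2 + aff_im k2 p ^+ 2)) = 1.
Proof.
move=> Mp; have := lift_norm Mp; rewrite herm_reE -/k0 -/k1 -/k2.
have [-> ->] := lift_affine k1 Mp; have [-> ->] := lift_affine k2 Mp; rewrite /lift_sq.
move: (lift_re p k0 0) (lift_im p k0 0) (aff_re k1 p) (aff_im k1 p) (aff_re k2 p) (aff_im k2 p).
by move=> x y z t u v e; rewrite -[RHS]opprK -e; ring.
Qed.

Let M_open : open M := domM_open W_open.

Lemma Ck_lift m k : Ck M m (fun p => lift_re p k 0) /\ Ck M m (fun p => lift_im p k 0).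
Proof.
have c1 : Ck M m (fun p => a * zc p) by apply: (CkM M_open); [exact: Ck_cst|exact: Ck_coord].
have c2 : Ck M m (fun p => 2 * a * tc p) by apply: (CkM M_open); [exact: Ck_cst|exact: Ck_coord].
have cc := Ck_cosh M_open c1; have cs := Ck_sinh M_open c1; have [ck csg] := Ck_trig M_open c2.
have E (x y z : 'rV[R]_4 -> R) i (j : 'I_1) : (fun q => col3 (x q) (y q) (z q) i j) = fun q => [:: x q; y q; z q]`_i.
  by apply/funext => q; rewrite mxE.
have cr i : Ck M m (fun p => coord_re p i 0).
  rewrite /coord_re E; elim/ord3_ind: i => //=; first exact: Ck_cst.
  by apply: (CkN M_open); exact: CkM.
have ci i : Ck M m (fun p => coord_im p i 0).
  by rewrite /coord_im E; elim/ord3_ind: i => /=; [exact: Ck_cst|exact: Ck_cst|exact: CkM].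
have cP i := Ck_xy W_open (cPQ m k i).1; have cQ i := Ck_xy W_open (cPQ m k i).2.
have S (F G : 'I_3 -> 'rV[R]_4 -> R) : (forall i, Ck M m (F i)) -> (forall i, Ck M m (G i)) ->
    Ck M m (fun q => \sum_i F i q * G i q).
  by move=> cF cG; apply: (Ck_sum M_open) => i; exact: CkM.
split.
- have -> : (fun p => lift_re p k 0) = fun p => \sum_i P (xy p) k i * coord_re p i 0 - \sum_i Q (xy p) k i * coord_im p i 0.
    by apply/funext => p; rewrite /lift_re !mxE.
  by apply: (CkB M_open); exact: S.
- have -> : (fun p => lift_im p k 0) = fun p => \sum_i P (xy p) k i * coord_im p i 0 + \sum_i Q (xy p) k i * coord_re p i 0.
    by apply/funext => p; rewrite /lift_im !mxE.
  by apply: (CkD M_open); exact: S.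
Qed.

Lemma Ck_aff m k : Ck M m (aff_re k) /\ Ck M m (aff_im k).
Proof.
have [c0 d0] := Ck_lift m k0; have [c d] := Ck_lift m k.
have cV : Ck M m (fun p => (lift_sq p)^-1).
  apply: (CkV M_open) => [p Mp|]; first by rewrite gt_eqF // lift_sq_gt0.
  by apply: (CkD M_open); exact: (CkM M_open).
split; apply: (CkM M_open) => //.
- by apply: (CkD M_open); exact: (CkM M_open).
- by apply: (CkB M_open); exact: (CkM M_open).
Qed.

Lemma Ck_devmap m i : Ck M m (fun p => devmap p 0 i).
Proof.
have E : (fun p => devmap p 0 i) = fun p => [:: aff_re k1 p; aff_im k1 p; aff_re k2 p; aff_im k2 p]`_i.
  by apply/funext => p; rewrite mxE.
rewrite {}E; have [? ?] := Ck_aff m k1; have [? ?] := Ck_aff m k2.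
by elim/ord4_ind: i.
Qed.

(** Differentiates X_k = w_k X_0 rather than the quotient, which gives the shape expected by
    [bergman_lift]. *)
Let d_aff p v k : M p -> let Dr := 'D_v (aff_re k) p in let Di := 'D_v (aff_im k) p in
  dlift_re p v k 0 = aff_re k p * dlift_re p v k0 0 - aff_im k p * dlift_im p v k0 0
    + (Dr * lift_re p k0 0 - Di * lift_im p k0 0) /\
  dlift_im p v k 0 = aff_im k p * dlift_re p v k0 0 + aff_re k p * dlift_im p v k0 0
    + (Di * lift_re p k0 0 + Dr * lift_im p k0 0).
Proof.
move=> Mp Dr Di; have [cr ci] := Ck_aff 0 k.
have DR : is_derive p v (aff_re k) Dr by exact/derivableP/diff_derivable/(Ck_differentiable cr Mp).
have DI : is_derive p v (aff_im k) Di by exact/derivableP/diff_derivable/(Ck_differentiable ci Mp).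
have [D0 D0'] := is_derive_lift v k0 Mp; have [D D'] := is_derive_lift v k Mp.
rewrite -!/(dlift_re p v) -!/(dlift_im p v) in D0 D0' D D'; split.
- rewrite -(derive_val (is_derive := D)).
  rewrite (eq_on_derive (g := fun q => aff_re k q * lift_re q k0 0 + - (aff_im k q * lift_im q k0 0)) M_open) //.
    rewrite (derive_val (is_derive := pder_add (pder_mul DR D0) (pder_opp (pder_mul DI D0')))).
    by generalize (aff_re k p) (aff_im k p) (lift_re p k0 0) (lift_im p k0 0) (dlift_re p v k0 0) (dlift_im p v k0 0) Dr Di => *; ring.
  by move=> q Mq; exact: (lift_affine k Mq).1.
- rewrite -(derive_val (is_derive := D')).
  rewrite (eq_on_derive (g := fun q => aff_im k q * lift_re q k0 0 + aff_re k q * lift_im q k0 0) M_open) //.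
    rewrite (derive_val (is_derive := pder_add (pder_mul DI D0) (pder_mul DR D0'))).
    by generalize (aff_re k p) (aff_im k p) (lift_re p k0 0) (lift_im p k0 0) (dlift_re p v k0 0) (dlift_im p v k0 0) Dr Di => *; ring.
  by move=> q Mq; exact: (lift_affine k Mq).2.
Qed.

Let derive_devmap p v i : M p -> ('D_v devmap p) 0 i =
  [:: 'D_v (aff_re k1) p; 'D_v (aff_im k1) p; 'D_v (aff_re k2) p; 'D_v (aff_im k2) p]`_i.
Proof.
move=> Mp; rewrite derive_rowfun => [|j]; last exact: Ck_differentiable (Ck_devmap 0 j) Mp.
have -> : (fun q => devmap q 0 i) = fun q => [:: aff_re k1 q; aff_im k1 q; aff_re k2 q; aff_im k2 q]`_i.
  by apply/funext => q; rewrite mxE.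
by elim/ord4_ind: i.
Qed.

(** Multiplied by a^2, both sides equal the projected Hermitian product of the velocities of the
    lift: one by [bergman_lift], the other by [lift_metric]. *)
Lemma devmap_isometry p u v : M p ->
  bergman a (devmap p) ('D_u devmap p) ('D_v devmap p) = metric a h H p u v.
Proof.
move=> Mp; have n0 : lift_sq p != 0 by rewrite gt_eqF // lift_sq_gt0.
have nD := lift_sq_affine Mp.
have Mlift := lift_metric u v Mp.
have B := bergman_lift ('D_u (aff_re k1) p) ('D_u (aff_im k1) p) ('D_u (aff_re k2) p) ('D_u (aff_im k2) p)
  (dlift_re p u k0 0) (dlift_im p u k0 0) ('D_v (aff_re k1) p) ('D_v (aff_im k1) p) ('D_v (aff_re k2) p)
  ('D_v (aff_im k2) p) (dlift_re p v k0 0) (dlift_im p v k0 0) nD.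
apply: (mulfI (expf_neq0 2 a_neq0)); rewrite -Mlift.
have du i := derive_devmap u i Mp; have dv i := derive_devmap v i Mp.
move: du dv; generalize ('D_u devmap p) ('D_v devmap p) => Du Dv du dv.
rewrite (bergman_coord (n := lift_sq p)) //; last by rewrite !mxE.
rewrite !du !dv !mxE.
have [Er1 Ei1] := d_aff u k1 Mp; have [Er2 Ei2] := d_aff u k2 Mp.
have [Fr1 Fi1] := d_aff v k1 Mp; have [Fr2 Fi2] := d_aff v k2 Mp.
have [Lr1 Li1] := lift_affine k1 Mp; have [Lr2 Li2] := lift_affine k2 Mp.
rewrite !herm_imE !herm_reE -/k0 -/k1 -/k2.
rewrite Er1 Ei1 Er2 Ei2 Fr1 Fi1 Fr2 Fi2 Lr1 Li1 Lr2 Li2.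
refine (etrans _ (etrans (esym B) _)); rewrite /lift_sq /=;
  move: (lift_re p k0 0) (lift_im p k0 0) (dlift_re p u k0 0) (dlift_im p u k0 0) (dlift_re p v k0 0) (dlift_im p v k0 0);
  generalize ('D_u (aff_re k1) p) ('D_u (aff_im k1) p) ('D_u (aff_re k2) p) ('D_u (aff_im k2) p)
    ('D_v (aff_re k1) p) ('D_v (aff_im k1) p) ('D_v (aff_re k2) p) ('D_v (aff_im k2) p)
    (aff_re k1 p) (aff_im k1 p) (aff_re k2 p) (aff_im k2 p) => *; ring.
Qed.

End Developing.

Lemma local_isometry (R : realType) (a : R) (U : set 'rV[R]_2) (h H : 'rV[R]_2 -> R)
    (E : 'I_4 -> vfield R 4) : a != 0 -> open U -> smooth_on U h -> smooth_on U H ->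
  (forall q, U q -> 0 < h q) -> (forall q, U q -> 0 < H q) ->
  (forall q, U q -> laplacian (lnf H) q = - 2 * a ^+ 2 * h q ^+ 2 + 4 * a ^+ 2 * H q ^+ 2) ->
  (forall q, U q -> laplacian (lnf h) q = 4 * a ^+ 2 * h q ^+ 2 - 2 * a ^+ 2 * H q ^+ 2) ->
  dual_frame (domM U) (coframe a h H) E ->
  locally_isometric (domM U) (metric a h H) (@ball2C R) (bergman a).
Proof.
move=> a0 Uo hs Hs h0 H0 H_eq h_eq dual p Mp.
have [r r0 [rU [P [Q [cPQ dPQ uPQ]]]]] := flat_unitary_frame Uo hs Hs h0 H0 H_eq h_eq Mp.1.
have Wo : open (ball (xy p) r) by exact: ball_open.
have Mo := domM_open Wo; set M' := domM (ball (xy p) r) in Mo *.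
have Mp' : M' p by split; [exact: ballxx|exact: Mp.2].
have M'M : M' `<=` domM U by move=> q [Wq zq]; split=> //; exact: rU.
pose F := devmap a P Q.
have cF m k : Ck M' m (fun q => F q 0 k) by exact: Ck_devmap.
have isoF q u v : M' q -> bergman a (F q) ('D_u F q) ('D_v F q) = metric a h H q u v.
  by move=> Mq; exact: (devmap_isometry a0 Wo cPQ dPQ uPQ).
have ballF q : M' q -> ball2C (F q).
  (* The relation |X_0|^2 (1 - |w|^2) = 1 has a positive first factor, which puts w in the ball. *)
  move=> Mq; have nD := lift_sq_affine a uPQ Mq; have n0 := lift_sq_gt0 a uPQ Mq.
  rewrite /ball2C /= -subr_gt0 -(pmulr_rgt0 _ n0).
  suff -> : lift_sq a P Q q * (1 - dot4 (F q) (F q)) = 1 by [].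
  by rewrite -[RHS]nD /dot4 sum4 !mxE.
have sF : smooth_map M' F by move=> k; apply/smooth_onP => m; exact: cF.
(* A vector killed by the differential has zero length for the metric, hence is zero. *)
have jF : jac F p \in unitmx.
  rewrite -row_free_unit; apply: inj_row_free => v vJ.
  have dF0 : 'D_v F p = 0.
    apply/rowP => k; rewrite derive_rowfun => [|j]; last exact: Ck_differentiable (cF 0%N j) Mp'.
    rewrite derive_pd; last exact: Ck_differentiable (cF 0%N k) Mp'.
    rewrite -[RHS](congr1 (fun x : 'rV_4 => x 0 k) vJ) mxE; apply: eq_bigr => i _.
    by rewrite mxE.
  have dot0 w : dot4 0 w = 0 :> R by rewrite /dot4 big1 // => i _; rewrite mxE mul0r.
  have := isoF p v v Mp'; rewrite dF0 /bergman !dot0 !mul0r addr0 mul0r addr0 mulr0 => /esym gv.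
  apply: (theta_ext dual Mp) => k; rewrite [RHS]coframe_covec covec0.
  have /psumr_eq0P/(_ k isT)/eqP : \sum_i coframe a h H i p v ^+ 2 = 0.
    by rewrite -[RHS]gv; apply: eq_bigr => i _.
  by rewrite sqrf_eq0 => /(_ (fun i _ => sqr_ge0 _))/eqP.
have [V [V' [G [[Vo Vp VM V'o] sG FG GF]]]] := inverse_function Mo sF Mp' jF.
exists V, V', F, G; split=> //.
- by split=> // q /VM /M'M.
- by move=> y /GF [/VM Mq <-]; exact: ballF.
- split=> // [|q u v Vq]; last by apply: isoF; exact: VM.
  by split=> // k; apply/smooth_onP => m; exact: (Ck_sub VM (cF m k)).
Qed.

Theorem theorem4p8 (R : realType) (a : R) (a_neq0 : a != 0)
    (U : set 'rV[R]_2) (U_open : open U)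
    (h H : 'rV[R]_2 -> R)
    (h_smooth : smooth_on U h) (H_smooth : smooth_on U H)
    (h_gt0 : forall q, U q -> 0 < h q) (H_gt0 : forall q, U q -> 0 < H q)
    (H_eq : forall q, U q ->
      laplacian (lnf H) q = - 2 * a ^+ 2 * h q ^+ 2 + 4 * a ^+ 2 * H q ^+ 2)
    (E : 'I_4 -> vfield R 4)
    (E_dual : dual_frame (domM U) (coframe a h H) E)
    (Jb J : endfield R 4)
    (Jb_form : forall p u v, domM U p ->
      kahler_form (metric a h H) Jb p u v = OmegaBar a h H p u v)
    (J_form : forall p u v, domM U p ->
      kahler_form (metric a h H) J p u v = Omega a h H p u v) :
  let M := domM U in
  let g := metric a h H in
  let hh p := h (xy p) in
  let HH p := H (xy p) in
  let ch p := cosh (a * zc p) in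
  let sh p := sinh (a * zc p) in
  let lap_ln_h p := laplacian (lnf h) (xy p) in
  let lambda p :=
    (4 * a ^+ 2 * hh p ^+ 2 - 2 * a ^+ 2 * HH p ^+ 2 - lap_ln_h p)
      / (hh p ^+ 2 * ch p ^+ 2) - 6 * a ^+ 2 in
  (* (i) *)
  (forall q, U q ->
    laplacian (lnf H) q = - 2 * a ^+ 2 * h q ^+ 2 + 4 * a ^+ 2 * H q ^+ 2) /\
  (* (ii) *)
  (forall p, M p ->
    conn_coef g E p o2 o1 o1
      = - (a * sh p * cos (2 * a * tc p) * HH p / (ch p ^+ 2 * hh p))
        - dy2 h (xy p) / (ch p * hh p ^+ 2) /\
    conn_coef g E p o1 o2 o2
      = - (a * sh p * sin (2 * a * tc p) * HH p / (ch p ^+ 2 * hh p))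
        - dx2 h (xy p) / (ch p * hh p ^+ 2)) /\
  (* (iii) *)
  (forall p i j, M p ->
    ricci g E p (E i p) (E j p)
      = if i == j then (if (i < 2)%N then lambda p else - 6 * a ^+ 2)
        else 0) /\
  (* (iv) *)
  (forall p, M p ->
    scalar_curv g E p
      = (8 * a ^+ 2 * hh p ^+ 2 - 4 * a ^+ 2 * HH p ^+ 2 - 2 * lap_ln_h p)
          / (hh p ^+ 2 * ch p ^+ 2) - 24 * a ^+ 2) /\
  (* (v) *)
  (is_lee_form M g J (lee_theta a H) /\
   forall p, M p ->
     conformal_scalar_curv g E (lee_theta a H) p
       = (8 * a ^+ 2 * hh p ^+ 2 - 4 * a ^+ 2 * HH p ^+ 2 - 2 * lap_ln_h p)
           / (hh p ^+ 2 * ch p ^+ 2)) /\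
  (* (vi) *)
  (forall p (phi psi : form2 R 4), M p ->
    let vol := kahler_vol (OmegaBar a h H p) in
    let Om := Omega a h H p in
    orthonormal_LM (fun i => E i p) vol Om phi psi ->
    [/\ is_asd (fun i => E i p) vol Om,
        forall u v, weyl_minus g E vol p Om u v
          = (4 * a ^+ 2 * hh p ^+ 2 - 2 * a ^+ 2 * HH p ^+ 2 - lap_ln_h p)
              / (3 * hh p ^+ 2 * ch p ^+ 2) * Om u v,
        forall u v, weyl_minus g E vol p phi u v
          = (- 4 * a ^+ 2 * hh p ^+ 2 + 2 * a ^+ 2 * HH p ^+ 2 + lap_ln_h p)
              / (6 * hh p ^+ 2 * ch p ^+ 2) * phi u v &
        forall u v, weyl_minus g E vol p psi u v
          = (- 4 * a ^+ 2 * hh p ^+ 2 + 2 * a ^+ 2 * HH p ^+ 2 + lap_ln_h p)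
              / (6 * hh p ^+ 2 * ch p ^+ 2) * psi u v]) /\
  (* (vii) *)
  (forall p, M p ->
    sectional g p (E o1 p) (E o2 p)
      = - ((2 * a ^+ 2 * HH p ^+ 2 + lap_ln_h p) / (ch p ^+ 2 * hh p ^+ 2))
        - 4 * a ^+ 2 * tanh (a * zc p) ^+ 2 /\
    sectional g p (E o3 p) (E o4 p) = - 4 * a ^+ 2) /\
  (* (viii) *)
  ((is_space_form M g Jb <->
    forall q, U q ->
      laplacian (lnf h) q = 4 * a ^+ 2 * h q ^+ 2 - 2 * a ^+ 2 * H q ^+ 2) /\
   (is_space_form M g Jb ->
    locally_isometric M g (@ball2C R) (bergman a))).
Proof.
move=> M g hh HH ch sh lap_ln_h lambda.
(* The curvature quantities are already known in terms of [frame_mu]; matching them with the stated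
   quotients is a matter of clearing denominators. *)
have mu_lambda p : lambda p = frame_mu a h H p - 6 * a ^+ 2 by [].
have den p : M p -> hh p != 0 /\ ch p != 0.
  by move=> [Up _]; rewrite cosh_neq0 gt_eqF // h_gt0.
split; first exact: H_eq.
split; first by move=> p Mp; exact: (gamma_perp a_neq0 U_open h_smooth H_smooth h_gt0 H_gt0 H_eq E_dual Mp).
split.
  move=> p i j Mp; rewrite (ricci_model a_neq0 U_open h_smooth H_smooth h_gt0 H_gt0 H_eq E_dual _ _ Mp) !(theta_dual E_dual) // mu_lambda /model_ricci sum4 /basis4 /=.
  generalize (frame_mu a h H p) => mu.
  by elim/ord4_ind: i; elim/ord4_ind: j => /=; ring.
split.
  move=> p Mp; rewrite (scalar_curv_model a_neq0 U_open h_smooth H_smooth h_gt0 H_gt0 H_eq E_dual Mp) /frame_mu; have [h0 c0] := den p Mp.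
  rewrite -[h (xy p)]/(hh p) -[H (xy p)]/(HH p) -[cosh _]/(ch p) -[laplacian _ _]/(lap_ln_h p).
  by generalize (hh p) (HH p) (ch p) (lap_ln_h p) h0 c0 => *; field; apply/andP.
split.
  split; first exact: (lee_formP a_neq0 U_open h_smooth H_smooth h_gt0 H_gt0 H_eq E_dual J_form).
  move=> p Mp; rewrite (conformal_scalarE a_neq0 U_open h_smooth H_smooth h_gt0 H_gt0 H_eq E_dual Mp) /frame_mu; have [h0 c0] := den p Mp.
  rewrite -[h (xy p)]/(hh p) -[H (xy p)]/(HH p) -[cosh _]/(ch p) -[laplacian _ _]/(lap_ln_h p).
  by generalize (hh p) (HH p) (ch p) (lap_ln_h p) h0 c0 => *; field; apply/andP.
split.
  move=> p phi psi Mp vol Om [LMphi LMpsi _ _ _]; have [h0 c0] := den p Mp.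
  have mu6 : (- 4 * a ^+ 2 * hh p ^+ 2 + 2 * a ^+ 2 * HH p ^+ 2 + lap_ln_h p)
      / (6 * hh p ^+ 2 * ch p ^+ 2) = - (frame_mu a h H p / 6).
    rewrite /frame_mu.
    rewrite -[h (xy p)]/(hh p) -[H (xy p)]/(HH p) -[cosh _]/(ch p) -[laplacian _ _]/(lap_ln_h p).
    by generalize (hh p) (HH p) (ch p) (lap_ln_h p) h0 c0 => *; field; apply/andP.
  have mu3 : (4 * a ^+ 2 * hh p ^+ 2 - 2 * a ^+ 2 * HH p ^+ 2 - lap_ln_h p)
      / (3 * hh p ^+ 2 * ch p ^+ 2) = frame_mu a h H p / 3.
    rewrite /frame_mu.
    rewrite -[h (xy p)]/(hh p) -[H (xy p)]/(HH p) -[cosh _]/(ch p) -[laplacian _ _]/(lap_ln_h p).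
    by generalize (hh p) (HH p) (ch p) (lap_ln_h p) h0 c0 => *; field; apply/andP.
  rewrite mu6 mu3.
  have [asdOm WOm] := weyl_minus_Omega a_neq0 U_open h_smooth H_smooth h_gt0 H_gt0 H_eq E_dual Mp.
  have WLM w u v := @weyl_minus_LM R a U h H E a_neq0 U_open h_smooth H_smooth h_gt0 H_gt0 H_eq E_dual w p u v Mp.
  by split=> // u v; exact: WLM.
split.
  move=> p Mp; have [h0 c0] := den p Mp; split; last exact: (sectional_fibre a_neq0 U_open h_smooth H_smooth h_gt0 H_gt0 H_eq E_dual Mp).
  rewrite (sectional_perp a_neq0 U_open h_smooth H_smooth h_gt0 H_gt0 H_eq E_dual Mp) /frame_mu /tanh.
  rewrite -[h (xy p)]/(hh p) -[H (xy p)]/(HH p) -[cosh _]/(ch p) -[laplacian _ _]/(lap_ln_h p).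
  have := cosh_sq (a * zc p); rewrite -[cosh _]/(ch p); move: h0 c0.
  generalize (hh p) (HH p) (ch p) (lap_ln_h p) (sinh (a * zc p)) => x y c l s x0 c0 cs.
  have s2 : s ^+ 2 = c ^+ 2 - 1 by rewrite cs; ring.
  by field: s2; apply/andP.
have SF := space_formP a_neq0 U_open h_smooth H_smooth h_gt0 H_gt0 H_eq E_dual Jb_form.
split; first exact: SF.
by move/SF => h_eq; exact: local_isometry E_dual.
Qed.
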